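(* Let $n\ge 3$. Every non-equatorial homogeneous minimal surface in $S^n$ with flat normal connection is isometric to the Clifford torus in some $S^3\subset S^n$; that is, up to an isometry of $S^n$, it is the Clifford torus $\{(z_1,z_2)\in\mathbb{C}^2: |z_1|=|z_2|=\tfrac{1}{\sqrt2}\}$ in a totally geodesic $S^3\subset S^n$.
   Context: $S^n$ is the unit sphere in $\mathbb{R}^{n+1}$ with its round metric. A homogeneous surface in $S^n$ is a connected immersed surface that is a (2-dimensional) orbit of a Lie subgroup of the isometry group $O(n+1)$ of $S^n$. Non-equatorial means not contained in a totally geodesic 2-sphere of $S^n$. Flat normal connection means that the curvature of the normal connection on the normal bundle of the surface in $S^n$ vanishes identically. *)

(* Defs.v *)
From HB Require Import structures.
From mathcomp Require Import all_boot all_order all_algebra.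
From mathcomp Require Import all_classical all_reals all_analysis.

Set Implicit Arguments.
Unset Strict Implicit.
Unset Printing Implicit Defensive.

Import Order.TTheory GRing.Theory Num.Theory.
Import numFieldNormedType.Exports.

Local Open Scope classical_set_scope.
Local Open Scope ring_scope.

(* Used only for finite-dimensional E, where being differentiable with all
   directional derivatives of class C^r is the same as being of class C^(r+1). *)
Fixpoint Cr_on (R : realType) (E V : normedModType R) (r : nat)
    (U : set E) (f : E -> V) : Prop :=
  match r with
  | 0%N => forall x, U x -> {for x, continuous f}
  | r'.+1 => (forall x, U x -> differentiable f x) /\
             (forall v, Cr_on r' U ('D_v f))
  end.

Definition smooth_on (R : realType) (E V : normedModType R)
  (U : set E) (f : E -> V) : Prop := forall r, Cr_on r U f.

(* A countable family of local parametrizations, modelled on E, of a subset of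
   V: the i-th one is the restriction of [par i] to [dom i]. *)
Record atlas (R : realType) (E V : normedModType R) := Atlas {
  ix : countType;
  dom : ix -> set E;
  par : ix -> E -> V }.
Arguments dom {R E V} a i : rename.
Arguments par {R E V} a i _ : rename.

(* Smoothness with respect to the charts, not to the ambient spaces. *)
Definition smooth_map (R : realType) (E V E' V' : normedModType R)
    (A : atlas E V) (B : atlas E' V') (f : V -> V') : Prop :=
  forall (i : ix A) (j : ix B) (x : E), dom A i x ->
    (par B j @` dom B j) (f (par A i x)) ->
    exists (U : set E) (g : E -> E'),
      [/\ open U, U x, U `<=` dom A i, smooth_on U g &
          forall y, U y -> dom B j (g y) /\ par B j (g y) = f (par A i y)].

(* A makes M an injectively immersed submanifold of V. The last condition says
   that chart overlaps are open and that transition maps are smooth. The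
   resulting manifold topology is second countable ([ix A] is countable) and
   Hausdorff (the inclusion in V is continuous), and may be strictly finer than
   the subspace topology. *)
Definition immersed_submanifold (R : realType) (E V : normedModType R)
    (M : set V) (A : atlas E V) : Prop :=
  [/\ M = \bigcup_i (par A i @` dom A i),
      forall i, [/\ open (dom A i), smooth_on (dom A i) (par A i) &
                    set_inj (dom A i) (par A i)],
      forall i x, dom A i x -> injective ('d (par A i) x) &
      smooth_map A A id].

Definition atlas_open (R : realType) (E V : normedModType R)
    (A : atlas E V) (X : set V) : Prop :=
  forall i, open (dom A i `&` par A i @^-1` X).

(* Connectedness for the manifold topology. *)
Definition atlas_connected (R : realType) (E V : normedModType R)
    (M : set V) (A : atlas E V) : Prop :=
  forall X : set V, X `<=` M -> atlas_open A X -> atlas_open A (M `\` X) ->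
    X = set0 \/ X = M.

Definition prod_atlas (R : realType) (E V E' V' : normedModType R)
    (A : atlas E V) (B : atlas E' V') :
    atlas (E * E')%type (V * V')%type :=
  @Atlas R (E * E')%type (V * V')%type (ix A * ix B)%type
    (fun ij => dom A ij.1 `*` dom B ij.2)
    (fun ij x => (par A ij.1 x.1, par B ij.2 x.2)).

Definition orthogonal_group (R : realType) (n : nat) : set 'M[R]_n :=
  [set g | g *m g^T = 1%:M].

(* A Lie subgroup is an immersed one: it need not be closed in O(n). *)
Definition lie_subgroup (R : realType) (n k : nat) (G : set 'M[R]_n)
    (A : atlas 'rV[R]_k 'M[R]_n) : Prop :=
  [/\ G `<=` @orthogonal_group R n,
      [/\ G 1%:M, forall g h, G g -> G h -> G (g *m h) &
          forall g, G g -> G (invmx g)],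
      immersed_submanifold G A,
      smooth_map (prod_atlas A A) A (fun gh => gh.1 *m gh.2) &
      smooth_map A A (fun g => invmx g)].

Definition dot (R : realType) (m : nat) (u v : 'rV[R]_m) : R :=
  (u *m v^T) 0 0.

Definition sphere (R : realType) (n : nat) : set 'rV[R]_n.+1 :=
  [set x | dot x x = 1].

Definition great_sphere (R : realType) (n d : nat) (S : set 'rV[R]_n.+1) :
    Prop :=
  exists W : {vspace 'rV[R]_n.+1},
    \dim W = d.+1 /\ S = @sphere R n `&` [set x | x \in W].

Definition equatorial (R : realType) (n : nat) (M : set 'rV[R]_n.+1) : Prop :=
  exists2 S, great_sphere 2 S & M `<=` S.

(* The atlas B carries the immersed structure of the orbit M = pG, the one for
   which the transitive action of G is smooth, i.e. M = G / G_p as a manifold.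
   Vectors are rows, so groups of matrices act on the right. *)
Definition homogeneous_surface (R : realType) (n : nat)
    (M : set 'rV[R]_n.+1) (B : atlas 'rV[R]_2 'rV[R]_n.+1) : Prop :=
  [/\ M `<=` @sphere R n,
      immersed_submanifold M B,
      atlas_connected M B &
      exists (k : nat) (G : set 'M[R]_n.+1) (A : atlas 'rV[R]_k 'M[R]_n.+1),
        [/\ lie_subgroup G A,
            exists p, M = [set p *m g | g in G] &
            smooth_map (prod_atlas A B) B (fun gx => gx.2 *m gx.1)]].

(* In what follows f is a local parametrization of a surface in S^n; the rows
   of 'J f x are its partial derivatives at x. *)
Definition first_form (R : realType) (n : nat)
    (f : 'rV[R]_2 -> 'rV[R]_n.+1) (x : 'rV[R]_2) : 'M[R]_2 :=
  'J f x *m ('J f x)^T.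

(* Orthogonal projection of R^(n+1) onto the normal space at f x of the surface
   in S^n, the orthogonal complement of the span of the unit vector f x and of
   the tangent plane. *)
Definition normal_proj (R : realType) (n : nat)
    (f : 'rV[R]_2 -> 'rV[R]_n.+1) (x : 'rV[R]_2) (u : 'rV[R]_n.+1) :
    'rV[R]_n.+1 :=
  u - dot u (f x) *: f x
    - u *m ('J f x)^T *m invmx (first_form f x) *m 'J f x.

Definition second_form (R : realType) (n : nat)
    (f : 'rV[R]_2 -> 'rV[R]_n.+1) (x v w : 'rV[R]_2) : 'rV[R]_n.+1 :=
  normal_proj f x ('D_v ('D_w f) x).

Definition mean_curvature (R : realType) (n : nat)
    (f : 'rV[R]_2 -> 'rV[R]_n.+1) (x : 'rV[R]_2) : 'rV[R]_n.+1 :=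
  2^-1 *: \sum_(a < 2) \sum_(b < 2)
    invmx (first_form f x) a b *:
      second_form f x (delta_mx 0 a) (delta_mx 0 b).

Definition minimal (R : realType) (n : nat)
    (B : atlas 'rV[R]_2 'rV[R]_n.+1) : Prop :=
  forall i x, dom B i x -> mean_curvature (par B i) x = 0.

Definition normal_field (R : realType) (n : nat)
    (f : 'rV[R]_2 -> 'rV[R]_n.+1) (W : set 'rV[R]_2)
    (xi : 'rV[R]_2 -> 'rV[R]_n.+1) : Prop :=
  smooth_on W xi /\
  forall x, W x ->
    dot (xi x) (f x) = 0 /\ forall v, dot (xi x) ('D_v f x) = 0.

Definition normal_connection (R : realType) (n : nat)
    (f : 'rV[R]_2 -> 'rV[R]_n.+1) (v : 'rV[R]_2)
    (xi : 'rV[R]_2 -> 'rV[R]_n.+1) : 'rV[R]_2 -> 'rV[R]_n.+1 :=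
  fun x => normal_proj f x ('D_v xi x).

(* v and w are constant vector fields in the chart, so that the term of the
   curvature in their Lie bracket vanishes. *)
Definition normal_curvature (R : realType) (n : nat)
    (f : 'rV[R]_2 -> 'rV[R]_n.+1) (v w : 'rV[R]_2)
    (xi : 'rV[R]_2 -> 'rV[R]_n.+1) (x : 'rV[R]_2) : 'rV[R]_n.+1 :=
  normal_connection f v (normal_connection f w xi) x
    - normal_connection f w (normal_connection f v xi) x.

Definition flat_normal_connection (R : realType) (n : nat)
    (B : atlas 'rV[R]_2 'rV[R]_n.+1) : Prop :=
  forall i (W : set 'rV[R]_2) xi, open W -> W `<=` dom B i ->
    normal_field (par B i) W xi ->
    forall v w x, W x -> normal_curvature (par B i) v w xi x = 0.

(* z1 = x_0 + i x_1 and z2 = x_2 + i x_3, in the great 3-sphere of the first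
   four coordinates (n >= 3). *)
Definition clifford_torus (R : realType) (n : nat) : set 'rV[R]_n.+1 :=
  [set x | [/\ Num.sqrt (x 0 (inord 0) ^+ 2 + x 0 (inord 1) ^+ 2)
                 = (Num.sqrt 2)^-1,
               Num.sqrt (x 0 (inord 2) ^+ 2 + x 0 (inord 3) ^+ 2)
                 = (Num.sqrt 2)^-1 &
               forall i : 'I_n.+1, (3 < i)%N -> x 0 i = 0]].

(* Main.v *)
Require Import Defs.
From HB Require Import structures.
From mathcomp Require Import all_boot all_order all_algebra.
From mathcomp Require Import all_classical all_reals all_analysis.
From mathcomp Require Import ring lra.
Import Order.TTheory GRing.Theory Num.Theory.
Import numFieldNormedType.Exports.
Set Implicit Arguments.
Unset Strict Implicit.
Unset Printing Implicit Defensive.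
Local Open Scope classical_set_scope.
Local Open Scope ring_scope.

(** Let M = p G be the orbit, f a local parametrization and II the second
    fundamental form.

    Minimality makes II traceless, and for a flat normal connection the Ricci
    equation says that the shape operators commute. Together they force
    II = lam * (e1^2 - e2^2) nu for an orthonormal tangent frame (e1, e2), a
    unit normal nu and lam >= 0 ([adapted_frame_exists]). Isometries carry such
    frames to such frames ([adapted_transition]) and G is transitive, so lam is
    the same everywhere.

    If lam = 0, the span of f, e1 and e2 is constant ([projector_local]) and M
    lies in a great 2-sphere, which is excluded. If lam > 0, the frames can be
    chosen smooth ([adapted_frame_field]). The symmetry of second derivatives,
    in the form [derive_dot_symm], then gives all the integrability conditions:
    the derivative of nu is tangent ([derive_nu_perp]), the connection form
    vanishes ([connection_form_eq0]) and lam = 1 ([principal_curvature_eq1]).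
    The structure equations now say that nu - f and e1 turn into each other, and
    so do nu + f and e2. Hence the bivectors (nu - f) ^ e1 and (nu + f) ^ e2 are
    locally constant. At a point they are unique up to signs and an exchange
    ([torus_frame_unique]), so by connectedness one pair J serves for all of M,
    and G preserves J up to signs and exchange ([homogeneous_torus_frame]).

    Since f is half the sum of f - nu and f + nu, vectors of length sqrt 2 in
    the two orthogonal planes of J, M lies in the product torus of radii
    1/sqrt 2. A nearest-point argument shows that M contains a neighbourhood of
    p in the torus ([torus_neighborhood]). Finally, an element of G moving p to
    a nearby point of the torus need not be a translation, but among nine of
    them, moving p to successive multiples of one small angle pair, two act on J
    in the same way, and their quotient rotates both planes. Powers of such
    rotations reach every point of the torus ([torus_orbit]), so M is the whole
    torus, and an isometry puts the two planes in standard position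
    ([torus_clifford]). *)

(** * Smooth maps and the Leibniz rule *)

Section SmoothMaps.
Context {R : realType} {E : normedModType R}.
Implicit Types (V W X : normedModType R) (U : set E).

Lemma open_near U x : open U -> U x -> \forall y \near x, U y.
Proof. by move=> oU Ux; apply: open_nbhs_nbhs. Qed.

Lemma eq_differentiable V (f g : E -> V) x :
  (\near x, f x = g x) -> differentiable f x -> differentiable g x.
Proof.
move=> fg df; have fxgx : f x = g x by exact: (nbhs_singleton fg).
have dg : g \o shift x = cst (g x) + 'd f x +o_ 0 id.
  apply/eqaddoP => e e0.
  have /eqaddoP/(_ e e0) := diff_locally df.
  move: (fg); rewrite (near_shift 0 x) subr0 => fg'.
  apply: filterS2 fg' => y /=.
  rewrite /shift /= fxgx => e1; congr (_ <= _); congr (`| _ |).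
  by rewrite -[LHS]/(f (y + x) - _) -[RHS]/(g (y + x) - _) -e1.
have cf := diff_continuous df.
by apply/diff_locallyP; rewrite (diff_unique cf dg).
Qed.

Lemma eq_on_differentiable V (f g : E -> V) U x : open U -> U x ->
  (forall y, U y -> f y = g y) -> differentiable f x -> differentiable g x.
Proof.
by move=> oU Ux fg; apply: eq_differentiable; apply: filterS (open_near oU Ux).
Qed.

Lemma eq_on_derive V (f g : E -> V) U x v : open U -> U x ->
  (forall y, U y -> f y = g y) -> 'D_v f x = 'D_v g x.
Proof.
by move=> oU Ux fg; apply: near_eq_derive; apply: filterS (open_near oU Ux).
Qed.

Lemma Cr_on_ext V r (f g : E -> V) U : open U ->
  (forall y, U y -> f y = g y) -> Cr_on r U f -> Cr_on r U g.
Proof.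
move=> oU; elim: r f g => [|r IH] f g fg /=.
  move=> cf x Ux; have cfx : f @ x --> f x := cf x Ux.
  suff : g @ x --> g x by [].
  rewrite -fg //; apply: cvg_trans cfx.
  by apply: near_eq_cvg; apply: filterS (open_near oU Ux).
move=> [df cf]; split=> [x Ux|v].
  exact: (eq_on_differentiable oU Ux fg (df x Ux)).
by apply: IH (cf v) => y Uy; apply: eq_on_derive oU Uy fg.
Qed.

Lemma Cr_onS V r (f : E -> V) U U' : U' `<=` U ->
  Cr_on r U f -> Cr_on r U' f.
Proof.
move=> sU; elim: r f => [|r IH] f /=; first by move=> cf x /sU; apply: cf.
by move=> [df cf]; split=> [x /sU|v]; [apply: df|apply: IH].
Qed.

Lemma Cr_on_lower V r (f : E -> V) U : Cr_on r.+1 U f -> Cr_on r U f.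
Proof.
elim: r f => [|r IH] f /=.
  by move=> [df _] x Ux; apply: differentiable_continuous; apply: df.
by move=> [df cf]; split => // v; apply: IH; apply: cf.
Qed.

Lemma smooth_differentiable V (f : E -> V) U x :
  smooth_on U f -> U x -> differentiable f x.
Proof. by move=> /(_ 1%N)[df _]; apply: df. Qed.

Lemma smooth_continuous V (f : E -> V) U x :
  smooth_on U f -> U x -> {for x, continuous f}.
Proof. by move=> /(_ 0%N); apply. Qed.

Lemma smooth_derive V (f : E -> V) U v : smooth_on U f -> smooth_on U ('D_v f).
Proof. by move=> sf r; have [_] := sf r.+1; apply. Qed.

Lemma smoothS V (f : E -> V) U U' : U' `<=` U ->
  smooth_on U f -> smooth_on U' f.
Proof. by move=> sU sf r; apply: Cr_onS (sf r). Qed.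

Lemma Cr_on_cst V r U (c : V) : Cr_on r U (cst c).
Proof.
elim: r c => [|r IH] c /=; first by move=> x _; apply: cst_continuous.
split=> [x _|v]; first exact: differentiable_cst.
have -> : 'D_v (cst c) = cst 0 :> (E -> V).
  by apply/funext => x; rewrite derive_cst.
exact: IH.
Qed.

Lemma smooth_cst V U (c : V) : smooth_on U (fun=> c).
Proof. by move=> r; apply: Cr_on_cst. Qed.

Lemma Cr_onD V r U (f g : E -> V) : open U ->
  Cr_on r U f -> Cr_on r U g -> Cr_on r U (f + g).
Proof.
move=> oU; elim: r f g => [|r IH] f g /=.
  by move=> cf cg x Ux; apply: continuousD; [apply: cf|apply: cg].
move=> [df cf] [dg cg]; split=> [x Ux|v].
  by apply: differentiableD; [apply: df|apply: dg].
apply: (@Cr_on_ext _ _ ('D_v f + 'D_v g)) (IH _ _ (cf v) (cg v)) => // y Uy.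
by rewrite deriveD //; apply: diff_derivable; [apply: df|apply: dg].
Qed.

Lemma smoothD V U (f g : E -> V) : open U ->
  smooth_on U f -> smooth_on U g -> smooth_on U (fun x => f x + g x).
Proof. by move=> oU sf sg r; apply: Cr_onD. Qed.

Section Bilinear.
Variables (V W X : normedModType R) (B : {bilinear V -> W -> X}).
Hypothesis Bc : continuous (fun p => B p.1 p.2).

Lemma differentiable_bilinear (f : E -> V) (g : E -> W) x :
  differentiable f x -> differentiable g x ->
  differentiable (fun y => B (f y) (g y)) x.
Proof.
move=> df dg.
apply: (@differentiable_comp _ _ _ _ (fun y => (f y, g y)) (fun p => B p.1 p.2)).
  exact: differentiable_pair.
exact: differentiable_bilin.
Qed.

Lemma derive_bilinear (f : E -> V) (g : E -> W) x v :
  differentiable f x -> differentiable g x ->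
  'D_v (fun y => B (f y) (g y)) x = B ('D_v f x) (g x) + B (f x) ('D_v g x).
Proof.
move=> df dg; rewrite !deriveE //; last exact: differentiable_bilinear.
have -> : (fun y => B (f y) (g y)) = (fun p => B p.1 p.2) \o (fun y => (f y, g y)).
  by [].
rewrite diff_comp; [|exact: differentiable_pair|exact: differentiable_bilin].
by rewrite diff_bilin //= diff_pair //= addrC.
Qed.

(** Induction on the order: by the Leibniz rule a derivative of the product is
    a sum of two products in which one factor has lost one order and the other
    can be weakened by one. *)
Lemma Cr_on_bilinear r U (f : E -> V) (g : E -> W) : open U ->
  Cr_on r U f -> Cr_on r U g -> Cr_on r U (fun x => B (f x) (g x)).
Proof.
move=> oU; elim: r f g => [|r IH] f g.
  move=> /= cf cg x Ux.
  apply: (@continuous_comp _ _ _ (fun y => (f y, g y)) (fun p => B p.1 p.2)).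
    by apply: cvg_pair; [apply: cf|apply: cg].
  exact: Bc.
move=> cf cg; have [df cdf] := cf; have [dg cdg] := cg; split=> [x Ux|v].
  by apply: differentiable_bilinear; [apply: df|apply: dg].
apply: (@Cr_on_ext _ _ ((fun x => B ('D_v f x) (g x)) +
   (fun x => B (f x) ('D_v g x)))) => //.
  by move=> y Uy; rewrite derive_bilinear; [|exact: df|exact: dg].
by apply: Cr_onD => //; apply: IH; [exact: cdf|exact: Cr_on_lower cg|
  exact: Cr_on_lower cf|exact: cdg].
Qed.

Lemma smooth_bilinear U (f : E -> V) (g : E -> W) : open U ->
  smooth_on U f -> smooth_on U g -> smooth_on U (fun x => B (f x) (g x)).
Proof. by move=> oU sf sg r; apply: Cr_on_bilinear. Qed.

End Bilinear.

End SmoothMaps.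

Section SmoothFunctions.
Context {R : realType} {E : normedModType R}.
Implicit Types (V W X : normedModType R) (U : set E).

Lemma Cr_onM r U (f g : E -> R) : open U ->
  Cr_on r U f -> Cr_on r U g -> Cr_on r U (fun x => f x * g x).
Proof.
exact: (@Cr_on_bilinear R E R R R (GRing.mul : {bilinear R -> R -> R})
  (@mul_continuous R)).
Qed.

Lemma smoothM U (f g : E -> R) : open U ->
  smooth_on U f -> smooth_on U g -> smooth_on U (fun x => f x * g x).
Proof. by move=> oU sf sg r; apply: Cr_onM. Qed.

(** A derivative of 1/f is the product of - 'D_v f with two copies of 1/f, so
    regularity of order r of 1/f gives order r.+1. *)
Lemma smoothV U (f : E -> R) : open U -> (forall x, U x -> f x != 0) ->
  smooth_on U f -> smooth_on U (fun x => (f x)^-1).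
Proof.
move=> oU f0 sf; have df x : U x -> differentiable f x.
  exact: smooth_differentiable.
have dV x : U x -> differentiable (fun y => (f y)^-1) x.
  by move=> Ux; apply: differentiableV; [apply: df|apply: f0].
elim=> [|r IH]; first by move=> x Ux; apply: differentiable_continuous (dV x Ux).
split=> // v.
apply: (@Cr_on_ext R E R _ (fun x => - 'D_v f x * ((f x)^-1 * (f x)^-1))) => //.
  move=> y Uy; rewrite deriveV; [|exact: f0|exact/diff_derivable/df].
  by rewrite /GRing.scale /= -invfM -expr2 mulNr mulrC mulNr.
have h1 : Cr_on r U (fun x => (-1) * 'D_v f x : R).
  exact: (Cr_onM oU (@Cr_on_cst R E R r U (-1)) (smooth_derive v sf r)).
have h2 : Cr_on r U (fun x => - 'D_v f x : R).
  by apply: (@Cr_on_ext R E R _ _ _ U oU _ h1) => y _; rewrite mulN1r.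
exact: (Cr_onM oU h2 (Cr_onM oU IH IH)).
Qed.

Lemma derive_comp_R (f : E -> R) (g : R -> R) x v : differentiable f x ->
  derivable g (f x) 1 ->
  'D_v (g \o f) x = 'D_v f x * 'D_1 g (f x).
Proof.
move=> df /derivable1_diffP dg.
have dgf : differentiable (g \o f) x by exact: differentiable_comp.
rewrite (deriveE v dgf) (deriveE v df) (@deriveE R R R g (f x) 1 dg) (diff_comp df dg) /=.
by rewrite -[X in 'd g _ X = _]mulr1 -[X in 'd g _ X]/('d f x v *: (1 : R)) linearZ.
Qed.

(** A derivative of the root s of f is written 'D_v f * s / (2 * f) instead of
    'D_v f / (2 * s), so that s itself appears only as a factor and the
    induction on the order closes. *)
Lemma smooth_sqrt U (f : E -> R) : open U -> (forall x, U x -> 0 < f x) ->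
  smooth_on U f -> smooth_on U (fun x => Num.sqrt (f x)).
Proof.
move=> oU f0 sf; have df x : U x -> differentiable f x.
  exact: smooth_differentiable.
have ds x : U x -> derivable (@Num.sqrt R) (f x) 1.
  by move=> Ux; have [] := is_derive1_sqrt (f0 x Ux).
have dV x : U x -> differentiable (Num.sqrt \o f) x.
  move=> Ux; apply: differentiable_comp; first exact: df.
  exact/derivable1_diffP/ds.
elim=> [|r IH]; first by move=> x Ux; apply: differentiable_continuous (dV x Ux).
split=> // v.
apply: (@Cr_on_ext R E R _
  (fun x => 'D_v f x * (Num.sqrt (f x) * (2 * f x)^-1))) => //.
  move=> y Uy; rewrite derive_comp_R; [|exact: df|exact: ds].
  have fy := f0 y Uy; have -> : 'D_1 Num.sqrt (f y) = (2 * Num.sqrt (f y))^-1.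
    by apply: derive_val; apply: is_derive1_sqrt.
  congr (_ * _); rewrite -{2}(sqr_sqrtr (ltW fy)).
  have s0 : Num.sqrt (f y) != 0 by rewrite gt_eqF // sqrtr_gt0.
  by field.
have f2 : smooth_on U (fun x => (2 * f x)^-1).
  apply: smoothV => //.
    by move=> x Ux; rewrite mulf_neq0 ?pnatr_eq0 // gt_eqF // f0.
  exact: (smoothM oU (@smooth_cst R E R U 2) sf).
exact: (Cr_onM oU (smooth_derive v sf r) (Cr_onM oU IH (f2 r))).
Qed.

End SmoothFunctions.

(** * Euclidean inner product *)

Section Dot.
Context {R : realType} {N : nat}.
Implicit Types (u v w : 'rV[R]_N).

Lemma dotE u v : dot u v = \sum_i u 0 i * v 0 i.
Proof. by rewrite /dot mxE; apply: eq_bigr => i _; rewrite mxE. Qed.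

Lemma dotC u v : dot u v = dot v u.
Proof. by rewrite !dotE; apply: eq_bigr => i _; rewrite mulrC. Qed.

Lemma dotDl u v w : dot (u + v) w = dot u w + dot v w.
Proof. by rewrite /dot mulmxDl mxE. Qed.

Lemma dotZl a u v : dot (a *: u) v = a * dot u v.
Proof. by rewrite /dot -scalemxAl mxE. Qed.

Lemma dotDr u v w : dot u (v + w) = dot u v + dot u w.
Proof. by rewrite dotC dotDl !(dotC u). Qed.

Lemma dotZr a u v : dot u (a *: v) = a * dot u v.
Proof. by rewrite dotC dotZl dotC. Qed.

Lemma dotNl u v : dot (- u) v = - dot u v.
Proof. by rewrite -scaleN1r dotZl mulN1r. Qed.

Lemma dotNr u v : dot u (- v) = - dot u v.
Proof. by rewrite dotC dotNl dotC. Qed.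

Lemma dot0l v : dot 0 v = 0.
Proof. by rewrite -[0](scale0r 0) dotZl mul0r. Qed.

Lemma dot0r v : dot v 0 = 0.
Proof. by rewrite dotC dot0l. Qed.

Lemma dot_suml (I : Type) (r : seq I) (P : pred I) (F : I -> 'rV[R]_N) v :
  dot (\sum_(i <- r | P i) F i) v = \sum_(i <- r | P i) dot (F i) v.
Proof.
by elim/big_rec2: _ => [|i x y _ <-]; rewrite ?dot0l // dotDl.
Qed.

Definition dotl := (dotDl, dotZl, dotNl, dot0l).
Definition dotr := (dotDr, dotZr, dotNr, dot0r).

Lemma dot_ge0 u : 0 <= dot u u.
Proof. by rewrite dotE sumr_ge0 // => i _; rewrite -expr2 sqr_ge0. Qed.

Lemma dot_eq0 u : (dot u u == 0) = (u == 0).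
Proof.
apply/eqP/eqP => [|->]; last by rewrite dot0l.
rewrite dotE => /eqP; rewrite psumr_eq0 => [/allP h|i _]; last first.
  by rewrite -expr2 sqr_ge0.
apply/rowP => i; rewrite mxE.
have := h i; rewrite mem_index_enum => /(_ isT) /=.
by rewrite -expr2 sqrf_eq0 => /eqP.
Qed.

Lemma dot_gt0 u : (0 < dot u u) = (u != 0).
Proof. by rewrite lt_def dot_ge0 andbT dot_eq0. Qed.

Lemma dot_delta u i : dot u (delta_mx 0 i) = u 0 i.
Proof.
rewrite dotE (bigD1 i) //= big1 ?addr0 => [|j ji]; rewrite mxE !eqxx ?mulr1 //=.
by rewrite (negbTE ji) mulr0.
Qed.

Lemma dot_inj u v : (forall w, dot u w = dot v w) -> u = v.
Proof. by move=> h; apply/rowP => i; rewrite -!dot_delta h. Qed.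

Lemma dot_mul (P : nat) (A : 'M[R]_(N, P)) u (v : 'rV[R]_P) : dot (u *m A) v = dot u (v *m A^T).
Proof. by rewrite /dot trmx_mul trmxK mulmxA. Qed.

Lemma dot_is_bilinear :
  bilinear_for
    (GRing.Scale.Law.clone _ _ *:%R _) (GRing.Scale.Law.clone _ _ *:%R _)
    (@dot R N).
Proof.
by split=> [u'|u] a x y /=; [rewrite dotDl dotZl|rewrite dotDr dotZr].
Qed.
HB.instance Definition _ := bilinear_isBilinear.Build R 'rV[R]_N 'rV[R]_N R _ _
  (@dot R N) dot_is_bilinear.

Lemma dot_continuous :
  continuous (fun p : 'rV[R]_N * 'rV[R]_N => dot p.1 p.2).
Proof.
have -> : (fun p : 'rV[R]_N * 'rV[R]_N => dot p.1 p.2) =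
   (fun p => \sum_i p.1 0 i * p.2 0 i) by apply/funext => p; rewrite dotE.
apply: continuous_big => [|i _ p]; first exact: add_continuous.
apply: continuousM.
  apply: (@continuous_comp _ _ _ fst (fun u : 'rV[R]_N => u 0 i)).
    exact: cvg_fst.
  exact: coord_continuous.
apply: (@continuous_comp _ _ _ snd (fun u : 'rV[R]_N => u 0 i)).
  exact: cvg_snd.
exact: coord_continuous.
Qed.

End Dot.

Section VectorCalculus.
Context {R : realType} {E : normedModType R} {N : nat}.
Implicit Types (U : set E) (f g : E -> 'rV[R]_N).

Let dotB := (@dot R N : {bilinear 'rV[R]_N -> 'rV[R]_N -> R}).

Lemma smooth_dot U f g : open U ->
  smooth_on U f -> smooth_on U g -> smooth_on U (fun x => dot (f x) (g x)).
Proof.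
exact: (@smooth_bilinear R E _ _ R dotB dot_continuous).
Qed.

Lemma derive_dot f g x v : differentiable f x -> differentiable g x ->
  'D_v (fun y => dot (f y) (g y)) x = dot ('D_v f x) (g x) + dot (f x) ('D_v g x).
Proof. exact: (@derive_bilinear R E _ _ R dotB dot_continuous). Qed.

Lemma differentiable_dot f g x : differentiable f x -> differentiable g x ->
  differentiable (fun y => dot (f y) (g y)) x.
Proof. exact: (@differentiable_bilinear R E _ _ R dotB dot_continuous). Qed.

(** The form in which orthogonality relations between vector fields are
    differentiated throughout. *)
Lemma derive_dot_cst f g U x v c : open U -> U x ->
  differentiable f x -> differentiable g x ->
  (forall y, U y -> dot (f y) (g y) = c) ->
  dot ('D_v f x) (g x) = - dot (f x) ('D_v g x).
Proof.
move=> oU Ux df dg h; apply/eqP; rewrite -addr_eq0 -derive_dot //.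
by rewrite (@eq_on_derive R E R _ (cst c) U x v oU Ux h) derive_cst.
Qed.

Lemma scale_is_bilinear :
  bilinear_for
    (GRing.Scale.Law.clone _ _ *:%R _) (GRing.Scale.Law.clone _ _ *:%R _)
    (@GRing.scale R 'rV[R]_N).
Proof.
split=> [u'|u] a x y /=; first by rewrite scalerDl -scalerA.
by rewrite scalerDr !scalerA mulrC.
Qed.
HB.instance Definition _ := bilinear_isBilinear.Build R R 'rV[R]_N 'rV[R]_N _ _
  (@GRing.scale R 'rV[R]_N) scale_is_bilinear.

Let scaleB := (@GRing.scale R 'rV[R]_N : {bilinear R -> 'rV[R]_N -> 'rV[R]_N}).

Lemma smoothZ U (c : E -> R) f : open U ->
  smooth_on U c -> smooth_on U f -> smooth_on U (fun x => c x *: f x).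
Proof.
exact: (@smooth_bilinear R E R _ _ scaleB (@scale_continuous R 'rV[R]_N)).
Qed.

Lemma smoothN U f : open U -> smooth_on U f -> smooth_on U (fun x => - f x).
Proof.
move=> oU sf; have h := smoothZ oU (@smooth_cst R E R U (-1)) sf.
move=> r; apply: (Cr_on_ext oU _ (h r)) => y _ /=.
by rewrite scaleN1r.
Qed.

Lemma smoothB U f g : open U ->
  smooth_on U f -> smooth_on U g -> smooth_on U (fun x => f x - g x).
Proof. by move=> oU sf sg; apply: smoothD => //; apply: smoothN. Qed.

Definition normalize (f : E -> 'rV[R]_N) (x : E) : 'rV[R]_N :=
  (Num.sqrt (dot (f x) (f x)))^-1 *: f x.

Lemma smooth_normalize U f : open U -> (forall x, U x -> f x != 0) ->
  smooth_on U f -> smooth_on U (normalize f).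
Proof.
move=> oU f0 sf; have f0' x : U x -> 0 < dot (f x) (f x).
  by move=> /f0; rewrite dot_gt0.
apply: smoothZ => //; apply: smoothV => //.
  by move=> x Ux; rewrite gt_eqF // sqrtr_gt0 f0'.
by apply: smooth_sqrt => //; apply: smooth_dot.
Qed.

Lemma dot_normalize f x : f x != 0 -> dot (normalize f x) (normalize f x) = 1.
Proof.
rewrite -dot_gt0 => f0; rewrite dotZl dotZr mulrA -invfM -expr2.
by rewrite sqr_sqrtr ?ltW // mulVf // gt_eqF.
Qed.

End VectorCalculus.

(** * Mean values and symmetry of second derivatives *)

Section Lines.
Context {R : realType} {E : normedModType R}.
Implicit Types (f : E -> R).

Lemma is_derive_line f (x v : E) (s : R) : derivable f (x + s *: v) v ->
  is_derive s 1 (fun s => f (x + s *: v)) ('D_v f (x + s *: v)).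
Proof.
move=> df.
have e : (fun h : R => h^-1 *: (((fun s => f (x + s *: v)) \o shift s) (h *: (1 : R))
      - f (x + s *: v))) =
   (fun h => h^-1 *: ((f \o shift (x + s *: v)) (h *: v) - f (x + s *: v))).
  apply/funext => h /=; congr (_ *: (f _ - _)).
  by rewrite [h *: 1]mulr1 scalerDl addrCA.
by split; rewrite /derivable /derive e.
Qed.

(* Keeps unification from unfolding directional derivatives into limits. *)
Opaque derive.

Lemma ball_line (x v : E) (e s : R) : `|s *: v| < e -> ball x e (x + s *: v).
Proof. by rewrite -ball_normE /= opprD addNKr normrN. Qed.

Lemma MVT0 (g dg : R -> R) (t : R) : 0 < t ->
  (forall s : R, s \in `[0, t]%R -> is_derive s 1 g (dg s)) ->
  exists2 c : R, c \in `[0, t]%R & g t - g 0 = dg c * t.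
Proof.
move=> t0 Dg.
have Dg' (s : R) : s \in `]0, t[%R -> is_derive s 1 g (dg s).
  by rewrite in_itv /= => /andP[s0 st]; apply: Dg; rewrite in_itv /= !ltW.
have cg : {within `[0, t], continuous g}.
  apply: derivable_within_continuous => s st.
  by have [] := Dg s st.
have [c] := MVT t0 Dg' cg.
rewrite in_itv subr0 /= => /andP[c0 ct] e; exists c => //.
by rewrite in_itv /= !ltW.
Qed.

Lemma ball_constant f (x : E) (e : R) :
  (forall y, ball x e y -> differentiable f y) ->
  (forall y v, ball x e y -> 'D_v f y = 0) ->
  forall y, ball x e y -> f y = f x.
Proof.
move=> df Df y By; pose v := y - x.
have Bs (s : R) : s \in `[0, 1]%R -> ball x e (x + s *: v).
  rewrite in_itv /= => /andP[s0 s1]; apply: ball_line.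
  rewrite normrZ ger0_norm //; apply: le_lt_trans (_ : `|v| < e).
    by rewrite ler_piMl.
  by move: By; rewrite -ball_normE /= distrC.
have dg (s : R) : s \in `[0, 1]%R -> is_derive s 1 (fun s => f (x + s *: v)) 0.
  move=> /Bs sB; rewrite -(Df _ v sB).
  by apply: is_derive_line; apply/diff_derivable/df.
have [c _] := MVT0 ltr01 dg.
rewrite mul0r scale1r scale0r addr0 /v addrCA subrr addr0.
by move/eqP; rewrite subr_eq0 => /eqP.
Qed.

(** Two mean values: one in the direction v for the increment of f along w,
    one in the direction w for 'D_v f. *)
Lemma second_difference f (x v w : E) (e t : R) : 0 < t ->
  t * (`|v| + `|w|) < e ->
  (forall y, ball x e y -> differentiable f y) ->
  (forall y, ball x e y -> differentiable ('D_v f) y) ->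
  exists2 y, ball x e y &
    f (x + t *: v + t *: w) - f (x + t *: v) - f (x + t *: w) + f x
    = t * t * 'D_w ('D_v f) y.
Proof.
move=> t0 te df ddf.
have Bst (s r : R) : s \in `[0, t]%R -> r \in `[0, t]%R ->
    ball x e (x + s *: v + r *: w).
  rewrite !in_itv /= => /andP[s0 st] /andP[r0 rt].
  rewrite -ball_normE /= -addrA opprD addNKr normrN.
  apply: le_lt_trans te; apply: (le_trans (ler_normD _ _)).
  rewrite !normrZ !ger0_norm // mulrDr lerD //; exact: ler_wpM2r.
have I0 : (0 : R) \in `[0, t]%R by rewrite in_itv /= lexx ltW.
have It : t \in `[0, t]%R by rewrite in_itv /= lexx ltW.
have Bs0 (s : R) : s \in `[0, t]%R -> ball x e (x + s *: v).
  by move=> st; have := Bst s 0 st I0; rewrite scale0r addr0.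
pose g := fun s : R => f (x + t *: w + s *: v) - f (x + s *: v).
have dg (s : R) : s \in `[0, t]%R -> is_derive s 1 g
    ('D_v f (x + t *: w + s *: v) - 'D_v f (x + s *: v)).
  move=> st; apply: is_deriveB; apply: is_derive_line; apply/diff_derivable/df.
    by rewrite addrAC; apply: Bst.
  exact: Bs0.
have [s st] := MVT0 t0 dg.
pose h := fun r : R => 'D_v f (x + s *: v + r *: w).
have dh (r : R) : r \in `[0, t]%R -> is_derive r 1 h ('D_w ('D_v f) (x + s *: v + r *: w)).
  by move=> rt; apply: is_derive_line; apply/diff_derivable/ddf/Bst.
have [r rt] := MVT0 t0 dh.
rewrite /h /g !scale0r !addr0 => e1 e2.
exists (x + s *: v + r *: w); first exact: Bst.
rewrite (addrAC x (t *: w) (s *: v)) e1 (addrAC x (t *: w) (t *: v)) in e2.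
by rewrite -mulrA mulrC -mulrA in e2 *; move: e2; lra.
Qed.

(** The second difference does not depend on the order of v and w. If the two
    mixed derivatives differed at x, they would differ by a definite amount at
    all pairs of nearby points, but the mean values of the second difference
    yield two nearby points at which they agree. *)
Lemma schwarz_R f (U : set E) x v w : open U -> U x -> smooth_on U f ->
  'D_v ('D_w f) x = 'D_w ('D_v f) x.
Proof.
move=> oU Ux sf; apply/eqP/negPn/negP => ne.
set a := 'D_v ('D_w f) x in ne *; set b := 'D_w ('D_v f) x in ne *.
pose d := `|a - b| / 2.
have d0 : 0 < d by rewrite divr_gt0 // normr_gt0 subr_eq0.
have ca : \forall y \near x, `|a - 'D_v ('D_w f) y| < d.
  have := smooth_continuous (smooth_derive v (smooth_derive w sf)) Ux.
  by move=> /cvgrPdist_lt /(_ d d0).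
have cb : \forall y \near x, `|b - 'D_w ('D_v f) y| < d.
  have := smooth_continuous (smooth_derive w (smooth_derive v sf)) Ux.
  by move=> /cvgrPdist_lt /(_ d d0).
have /nbhs_ballP[e /= e0 He] : nbhs x [set y | [/\ U y,
   `|a - 'D_v ('D_w f) y| < d & `|b - 'D_w ('D_v f) y| < d]].
  by apply: filterS3 (open_near oU Ux) ca cb => y Uy ya yb; split.
(* Small enough for the parallelogram spanned by t v and t w to fit in the
   ball. *)
pose t := e / (2 * (1 + `|v| + `|w|)).
have p0 : 0 < 1 + `|v| + `|w| by rewrite -addrA ltr_pwDl // addr_ge0.
have t0 : 0 < t by rewrite divr_gt0 // mulr_gt0.
have te : t * (`|v| + `|w|) < e.
  rewrite /t mulrAC ltr_pdivrMr ?mulr_gt0 // ltr_pM2l //.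
  by rewrite -addrA; have := normr_ge0 v; have := normr_ge0 w; lra.
have dB (g : E -> R) : smooth_on U g -> forall y, ball x e y -> differentiable g y.
  by move=> sg y /He[Uy _ _]; apply: smooth_differentiable sg Uy.
have [y /He[_ _ yb] ey] := second_difference t0 te (dB f sf)
  (dB _ (smooth_derive v sf)).
rewrite addrC in te.
have [z /He[_ za _] ez] := second_difference t0 te (dB f sf)
  (dB _ (smooth_derive w sf)).
have tt : t * t != 0 by rewrite mulf_neq0 // gt_eqF.
have eyz : 'D_w ('D_v f) y = 'D_v ('D_w f) z.
  apply: (mulfI tt); apply: (etrans (esym ey)); apply: etrans ez.
  by rewrite (addrAC x (t *: w) (t *: v)); ring.
have eab : a - b = (a - 'D_v ('D_w f) z) - (b - 'D_w ('D_v f) y).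
  by rewrite eyz opprB addrA subrK.
have := le_lt_trans (ler_normB _ _) (ltrD za yb).
by rewrite -eab -splitr ltxx.
Qed.

End Lines.

Section Schwarz.
Context {R : realType} {E : normedModType R} {N : nat}.
Implicit Types (U : set E) (f X Y : E -> 'rV[R]_N).

Lemma schwarz f U x v w : open U -> U x -> smooth_on U f ->
  'D_v ('D_w f) x = 'D_w ('D_v f) x.
Proof.
move=> oU Ux sf; apply: dot_inj => z.
have sfz : smooth_on U (fun y => dot (f y) z).
  by apply: smooth_dot => //; apply: smooth_cst.
have D g u y : smooth_on U g -> U y ->
    dot ('D_u g y) z = 'D_u (fun y => dot (g y) z) y.
  move=> sg Uy; have dz : differentiable (fun=> z) y := differentiable_cst z y.
  rewrite (derive_dot u (smooth_differentiable sg Uy) dz).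
  by rewrite (_ : 'D_u (fun=> z) y = 0) ?dot0r ?addr0 //; apply: derive_cst.
have swap a b : 'D_a (fun y => dot ('D_b f y) z) x =
    'D_a ('D_b (fun y => dot (f y) z)) x.
  by apply: (eq_on_derive a oU Ux) => y Uy; apply: D.
have e a b : dot ('D_a ('D_b f) x) z = 'D_a ('D_b (fun y => dot (f y) z)) x.
  exact: (etrans (D _ a x (smooth_derive b sf) Ux) (swap a b)).
exact: (etrans (e v w) (etrans (schwarz_R v w oU Ux sfz) (esym (e w v)))).
Qed.

(** The integrability condition behind all the Codazzi and Gauss type
    equations below. Differentiating <'D_v X, Y> = 0 along w gives <'D_v X,
    'D_w Y> = - <'D_w ('D_v X), Y>, whose right-hand side is symmetric in v
    and w. *)
Lemma derive_dot_symm X Y U x v w : open U -> U x ->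
  smooth_on U X -> smooth_on U Y ->
  (forall u y, U y -> dot ('D_u X y) (Y y) = 0) ->
  dot ('D_w X x) ('D_v Y x) = dot ('D_v X x) ('D_w Y x).
Proof.
move=> oU Ux sX sY h.
have D u z : dot ('D_u ('D_z X) x) (Y x) = - dot ('D_z X x) ('D_u Y x).
  apply: (derive_dot_cst u oU Ux) (h z).
    exact: smooth_differentiable (smooth_derive _ sX) Ux.
  exact: smooth_differentiable sY Ux.
apply: oppr_inj; apply: etrans (D w v); apply: (etrans (esym (D v w))).
exact: (congr1 (fun z => dot z (Y x)) (schwarz v w oU Ux sX)).
Qed.

End Schwarz.

(** * Orthonormal frames of a surface in the sphere *)

Section Frames.
Context {R : realType} {n : nat}.
Local Notation E := 'rV[R]_2.
Local Notation V := 'rV[R]_n.+1.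
Implicit Types (f : E -> V) (x u v w : E) (e p xi nu : V).

Definition normal_vector f x xi :=
  dot xi (f x) = 0 /\ forall v, dot xi ('D_v f x) = 0.

Definition tangent_frame f x e1 e2 : Prop :=
  [/\ [/\ dot e1 e1 = 1, dot e2 e2 = 1 & dot e1 e2 = 0],
      exists u, 'D_u f x = e1, exists u, 'D_u f x = e2 &
      forall v, 'D_v f x = dot ('D_v f x) e1 *: e1 + dot ('D_v f x) e2 *: e2].

(** The second fundamental form is lam * (e1^2 - e2^2) times nu: e1 and e2 are
    principal directions, of curvatures lam and - lam. As the last clause runs
    over all normal vectors xi, it also says that the second form takes its
    values in the line of nu. *)
Definition adapted_frame f x (lam : R) e1 e2 nu : Prop :=
  [/\ tangent_frame f x e1 e2, normal_vector f x nu, dot nu nu = 1 &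
   forall v w xi, normal_vector f x xi ->
    dot ('D_v ('D_w f) x) xi =
      lam * (dot ('D_v f x) e1 * dot ('D_w f x) e1
             - dot ('D_v f x) e2 * dot ('D_w f x) e2) * dot nu xi].

(** The projection on the normal space, computed in an orthonormal tangent
    frame instead of through the inverse of the first fundamental form. *)
Definition nproj p e1 e2 (u : V) : V :=
  u - dot u p *: p - dot u e1 *: e1 - dot u e2 *: e2.

Lemma nproj_normal p e1 e2 (u : V) : dot p p = 1 -> dot p e1 = 0 -> dot p e2 = 0 ->
  dot e1 e1 = 1 -> dot e2 e2 = 1 -> dot e1 e2 = 0 ->
  [/\ dot (nproj p e1 e2 u) p = 0, dot (nproj p e1 e2 u) e1 = 0 &
      dot (nproj p e1 e2 u) e2 = 0].
Proof.
move=> pp p1 p2 e11 e22 e12; rewrite /nproj !dotl !(dotC e1 p) !(dotC e2 p).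
by rewrite (dotC e2 e1) pp p1 p2 e11 e22 e12; split; ring.
Qed.

Lemma dot_nproj p e1 e2 (u : V) xi : dot xi p = 0 -> dot xi e1 = 0 -> dot xi e2 = 0 ->
  dot (nproj p e1 e2 u) xi = dot u xi.
Proof.
move=> x0 x1 x2; rewrite /nproj !dotl (dotC p) (dotC e1) (dotC e2) x0 x1 x2.
by ring.
Qed.

Lemma nproj_id p e1 e2 (u : V) : dot u p = 0 -> dot u e1 = 0 -> dot u e2 = 0 ->
  nproj p e1 e2 u = u.
Proof. by move=> h0 h1 h2; rewrite /nproj h0 h1 h2 !scale0r !subr0. Qed.

End Frames.

Section Chart.
Context {R : realType} {n : nat}.
Local Notation E := 'rV[R]_2.
Local Notation V := 'rV[R]_n.+1.
Variables (f : E -> V) (U : set E).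
Hypotheses (oU : open U) (sf : smooth_on U f).
Hypothesis (fI : forall x, U x -> injective ('d f x)).
Hypothesis (fS : forall x, U x -> dot (f x) (f x) = 1).
Implicit Types (x u v w : E) (e p xi nu : V).

Lemma derive_linear (W : normedModType R) (g : E -> W) x a v w :
  differentiable g x ->
  'D_(a *: v + w) g x = a *: 'D_v g x + 'D_w g x.
Proof. by move=> dg; rewrite !deriveE // linearP. Qed.

Lemma derive_scale (W : normedModType R) (g : E -> W) x a v :
  differentiable g x -> 'D_(a *: v) g x = a *: 'D_v g x.
Proof. by move=> dg; rewrite !deriveE // linearZ. Qed.

Lemma derive_linear2 (W : normedModType R) (g : E -> W) x a b v w :
  differentiable g x ->
  'D_(a *: v + b *: w) g x = a *: 'D_v g x + b *: 'D_w g x.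
Proof. by move=> dg; rewrite !deriveE // linearD !linearZ. Qed.

Lemma chart_diff x : U x -> differentiable f x.
Proof. exact: smooth_differentiable. Qed.

Lemma chart_derive_eq0 x v : U x -> 'D_v f x = 0 -> v = 0.
Proof.
move=> Ux; rewrite deriveE; last exact: chart_diff.
by move=> h; apply: (fI Ux); rewrite h linear0.
Qed.

Lemma dot_chart_derive x v : U x -> dot (f x) ('D_v f x) = 0.
Proof.
move=> Ux; have df := chart_diff Ux.
have := derive_dot_cst v oU Ux df df fS.
by rewrite dotC; set t := dot _ _; lra.
Qed.

Lemma row2E v : v = v 0 0 *: delta_mx 0 0 + v 0 1 *: delta_mx 0 1.
Proof.
rewrite {1}(row_sum_delta v) !big_ord_recl big_ord0 addr0.
by congr (_ + v 0 _ *: delta_mx 0 _); apply: val_inj.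
Qed.

Lemma unit_field (W : set E) (g : E -> V) : open W ->
  (forall x, W x -> g x != 0) -> smooth_on W g ->
  exists2 e : E -> V, smooth_on W e & forall x, W x ->
    exists2 c, 0 < c & g x = c *: e x /\ dot (e x) (e x) = 1.
Proof.
move=> oW g0 sg; exists (normalize g); first exact: smooth_normalize.
move=> x Wx; have gx := g0 x Wx.
have c0 : 0 < Num.sqrt (dot (g x) (g x)) by rewrite sqrtr_gt0 dot_gt0.
exists (Num.sqrt (dot (g x) (g x))) => //; split; last exact: dot_normalize.
by rewrite scalerA mulfV ?scale1r // gt_eqF.
Qed.

(** Gram-Schmidt on the two partial derivatives; injectivity of the
    differential keeps both steps away from zero. *)
Lemma orthonormal_frame : exists E1 E2 : E -> V,
  [/\ smooth_on U E1, smooth_on U E2 &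
      forall x, U x -> tangent_frame f x (E1 x) (E2 x)].
Proof.
pose f1 := 'D_(delta_mx 0 0) f; pose f2 := 'D_(delta_mx 0 1) f.
have sf1 : smooth_on U f1 by exact: smooth_derive.
have sf2 : smooth_on U f2 by exact: smooth_derive.
have f1N0 x : U x -> f1 x != 0.
  move=> Ux; apply/eqP => /(chart_derive_eq0 Ux)/rowP/(_ 0).
  by rewrite !mxE !eqxx => /eqP; rewrite oner_eq0.
have [E1 sE1 E1P] := unit_field oU f1N0 sf1.
pose g2 x := f2 x - dot (f2 x) (E1 x) *: E1 x.
have sg2 : smooth_on U g2.
  by apply: smoothB => //; apply: smoothZ => //; apply: smooth_dot.
have g2N0 x : U x -> g2 x != 0.
  move=> Ux; have [c c0 [f1E _]] := E1P x Ux.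
  apply/eqP => g20.
  have : 'D_(- (dot (f2 x) (E1 x) / c) *: delta_mx 0 0 + delta_mx 0 1) f x = 0.
    rewrite derive_linear; last exact: chart_diff.
    rewrite -/(f1 x) f1E scalerA mulNr divfK ?gt_eqF //.
    by rewrite -[RHS]g20 /g2 addrC scaleNr.
  move=> /(chart_derive_eq0 Ux)/rowP/(_ 1).
  by rewrite !mxE !eqxx /= mulr0 add0r => /eqP; rewrite oner_eq0.
have [E2 sE2 E2P] := unit_field oU g2N0 sg2.
exists E1, E2; split => // x Ux.
have [c c0 [f1E e11]] := E1P x Ux; have [d d0 [g2E e22]] := E2P x Ux.
have f2E : f2 x = dot (f2 x) (E1 x) *: E1 x + d *: E2 x.
  by rewrite -g2E /g2 addrC subrK.
have e12 : dot (E1 x) (E2 x) = 0.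
  have dN0 : d != 0 by rewrite gt_eqF.
  apply: (mulfI dN0); rewrite mulr0 -dotZr -g2E /g2 dotDr dotNr dotZr e11.
  by rewrite (dotC (E1 x)) mulr1 subrr.
have E1D : 'D_(c^-1 *: delta_mx 0 0) f x = E1 x.
  rewrite (derive_scale _ _ (chart_diff Ux)) -/(f1 x) f1E.
  by rewrite scalerA mulVf ?scale1r ?gt_eqF.
have E2D : 'D_(- (dot (f2 x) (E1 x) / c / d) *: delta_mx 0 0
   + d^-1 *: delta_mx 0 1) f x = E2 x.
  set k := dot _ _ in f2E *.
  rewrite (derive_linear2 _ _ _ _ (chart_diff Ux)) -/(f1 x) -/(f2 x) f1E f2E.
  have cN : c != 0 by rewrite gt_eqF.
  have dN : d != 0 by rewrite gt_eqF.
  rewrite scalerDr !scalerA mulVf // scale1r addrA -scalerDl.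
  rewrite (_ : _ + _ = 0 :> R) ?scale0r ?add0r //; field.
  by rewrite cN dN.
split=> //; [by eexists; exact: E1D|by eexists; exact: E2D|].
move=> v; suff [a [b ->]] : exists a b, 'D_v f x = a *: E1 x + b *: E2 x.
  rewrite !dotDl !dotZl (dotC (E2 x) (E1 x)) e11 e12 e22.
  by rewrite !mulr0 !mulr1 addr0 add0r.
exists (v 0 0 * c + v 0 1 * dot (f2 x) (E1 x)), (v 0 1 * d).
rewrite {1}(row2E v) (derive_linear2 _ _ _ _ (chart_diff Ux)).
rewrite -/(f1 x) -/(f2 x) {1}f2E f1E.
by rewrite scalerDr !scalerA scalerDl addrA.
Qed.

Lemma frame_orth x e1 e2 : U x -> tangent_frame f x e1 e2 ->
  dot (f x) e1 = 0 /\ dot (f x) e2 = 0.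
Proof.
by move=> Ux [_ [u1 <-] [u2 <-] _]; split; apply: dot_chart_derive.
Qed.

Lemma normal_frame x e1 e2 xi : tangent_frame f x e1 e2 ->
  normal_vector f x xi <->
  [/\ dot xi (f x) = 0, dot xi e1 = 0 & dot xi e2 = 0].
Proof.
move=> [_ [u1 E1] [u2 E2] fE]; split=> [[x0 xv]|[x0 x1 x2]].
  by split=> //; [rewrite -E1|rewrite -E2]; apply: xv.
by split=> // v; rewrite fE !dotr x1 x2 !mulr0 addr0.
Qed.

Lemma nproj_normal_vector x e1 e2 (u : V) : U x -> tangent_frame f x e1 e2 ->
  normal_vector f x (nproj (f x) e1 e2 u).
Proof.
move=> Ux fr; apply/(normal_frame _ fr); have [p1 p2] := frame_orth Ux fr.
by have [[e11 e22 e12] _ _ _] := fr; apply: nproj_normal => //; apply: fS.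
Qed.

Lemma dot_nproj_normal x e1 e2 (u : V) xi : tangent_frame f x e1 e2 ->
  normal_vector f x xi -> dot (nproj (f x) e1 e2 u) xi = dot u xi.
Proof. by move=> fr /(normal_frame _ fr)[? ? ?]; apply: dot_nproj. Qed.

Lemma normal_vector_eq0 x e1 e2 (u : V) : U x -> tangent_frame f x e1 e2 ->
  dot u (f x) = 0 -> dot u e1 = 0 -> dot u e2 = 0 ->
  (forall xi, normal_vector f x xi -> dot u xi = 0) -> u = 0.
Proof.
move=> Ux fr u0 u1 u2 h; apply/eqP; rewrite -dot_eq0; apply/eqP/h.
exact/(normal_frame _ fr).
Qed.

Lemma smooth_nproj (W : set E) (E1 E2 u : E -> V) : open W ->
  smooth_on W f ->
  smooth_on W E1 -> smooth_on W E2 -> smooth_on W u ->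
  smooth_on W (fun x => nproj (f x) (E1 x) (E2 x) (u x)).
Proof.
move=> oW sfW s1 s2 su; do !apply: smoothB => //;
  by apply: smoothZ => //; apply: smooth_dot.
Qed.

(** Second derivatives of the chart are paired with normal vectors by
    differentiating along a normal field, so each normal vector has to be the
    value of one; projecting a constant vector does it. *)
Lemma normal_extension x xi : U x -> normal_vector f x xi ->
  exists2 eta, normal_field f U eta & eta x = xi.
Proof.
move=> Ux nx; have [E1 [E2 [s1 s2 fr]]] := orthonormal_frame.
exists (fun y => nproj (f y) (E1 y) (E2 y) xi).
  split; first by apply: smooth_nproj => //; apply: smooth_cst.
  by move=> y Uy; apply: nproj_normal_vector => //; apply: fr.
by have /(normal_frame _ (fr x Ux))[? ? ?] := nx; apply: nproj_id.
Qed.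

(** Both sides equal - <X, 'D_v eta>, which depends only on the value of X at
    x. A frame field therefore sees the second fundamental form through its
    derivative, although it is not a coordinate field. *)
Lemma weingarten (W : set E) (X eta : E -> V) x u v :
  open W -> W x -> W `<=` U ->
  differentiable X x -> (forall y, W y -> dot (X y) (eta y) = 0) ->
  normal_field f W eta -> X x = 'D_u f x ->
  dot ('D_v X x) (eta x) = dot ('D_v ('D_u f) x) (eta x).
Proof.
move=> oW Wx WU dX Xn [se en] Xu.
have de := smooth_differentiable se Wx.
apply: (etrans (derive_dot_cst v oW Wx dX de Xn)); rewrite Xu; apply: esym.
have h y : W y -> dot ('D_u f y) (eta y) = 0.
  by move=> Wy; rewrite dotC; have [_] := en y Wy; apply.
apply: (derive_dot_cst v oW Wx _ de h).
exact: (smooth_differentiable (smooth_derive u sf) (WU _ Wx)).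
Qed.

Lemma second_pairing eta x v w : U x -> normal_field f U eta ->
  dot ('D_v ('D_w f) x) (eta x) = - dot ('D_w f x) ('D_v eta x).
Proof.
move=> Ux [se en]; have de := smooth_differentiable se Ux.
have h y : U y -> dot ('D_w f y) (eta y) = 0.
  by move=> Uy; rewrite dotC; have [_] := en y Uy; apply.
apply: (derive_dot_cst v oU Ux _ de h).
exact: (smooth_differentiable (smooth_derive w sf) Ux).
Qed.

Lemma second_sym x v w : U x -> 'D_v ('D_w f) x = 'D_w ('D_v f) x.
Proof. by move=> Ux; apply: schwarz oU Ux sf. Qed.

End Chart.

(** * Principal frames from minimality and the Ricci equation *)

(** The traceless symmetric matrix with entries a, b, b, - a is the rotate of
    diag (lam, - lam) through the angle whose cosine and sine are c and s. *)
Lemma half_angle {R : realType} (a b : R) : exists lam c s : R,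
  [/\ 0 <= lam, c ^+ 2 + s ^+ 2 = 1, a = lam * (c ^+ 2 - s ^+ 2) &
      b = lam * (2 * c * s)].
Proof.
pose lam := Num.sqrt (a ^+ 2 + b ^+ 2).
have lam2 : lam ^+ 2 = a ^+ 2 + b ^+ 2.
  by rewrite sqr_sqrtr // addr_ge0 // sqr_ge0.
have [l0|lN0] := eqVneq lam 0.
  exists 0, 1, 0; rewrite expr0n expr1n addr0 mul0r; split => //.
    apply/eqP; rewrite -sqrf_eq0 eq_le sqr_ge0 andbT.
    by move: lam2; rewrite l0 expr0n /= => /eqP; rewrite eq_sym paddr_eq0 ?sqr_ge0 // => /andP[/eqP -> _].
  apply/eqP; rewrite mul0r -sqrf_eq0 eq_le sqr_ge0 andbT.
  by move: lam2; rewrite l0 expr0n /= => /eqP; rewrite eq_sym paddr_eq0 ?sqr_ge0 // => /andP[_ /eqP ->].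
have lp : 0 < lam by rewrite lt_def lN0 sqrtr_ge0.
have al : `|a / lam| <= 1.
  rewrite -(expr_le1 (n := 2)) // real_normK ?num_real // expr_div_n lam2.
  rewrite ler_pdivrMr -?lam2 ?exprn_gt0 // mul1r lam2 lerDl sqr_ge0 //.
move: al; rewrite ler_norml => /andP[al1 al2].
pose c := Num.sqrt ((1 + a / lam) / 2); pose s := Num.sqrt ((1 - a / lam) / 2).
have c2 : c ^+ 2 = (1 + a / lam) / 2 by rewrite sqr_sqrtr //; lra.
have s2 : s ^+ 2 = (1 - a / lam) / 2 by rewrite sqr_sqrtr //; lra.
have cs : (lam * (2 * c * s)) ^+ 2 = b ^+ 2.
  rewrite !exprMn c2 s2 -[RHS](addKr (a ^+ 2)) -lam2; field.
  exact: lN0.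
have /orP[/eqP e|/eqP e] : (lam * (2 * c * s) == b) || (lam * (2 * c * s) == - b).
  by rewrite -eqf_sqr cs.
- exists lam, c, s; split; rewrite ?sqrtr_ge0 ?c2 ?s2 //; field; exact: lN0.
- exists lam, c, (- s); split; rewrite ?sqrtr_ge0 ?sqrrN ?c2 ?s2 //.
  + by field; exact: lN0.
  + by field; exact: lN0.
  + by rewrite !mulrN e opprK.
Qed.

Lemma unit_orthogonal {R : realType} {m N : nat} (F : 'M[R]_(m, N)) :
  (m < N)%N -> exists2 u : 'rV[R]_N, dot u u = 1 & F *m u^T = 0.
Proof.
move=> mN.
have : kermx F^T != 0.
  by rewrite kermx_eq0 /row_free neq_ltn (leq_ltn_trans (rank_leq_col _)).
case/rowV0Pn => u /sub_kermxP uF uN0.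
exists ((Num.sqrt (dot u u))^-1 *: u).
  rewrite dotZl dotZr mulrA -invfM -expr2 sqr_sqrtr ?dot_ge0 // mulVf //.
  by rewrite dot_eq0.
by rewrite linearZ -scalemxAr -[F]trmxK -trmx_mul uF trmx0 scaler0.
Qed.

Section ChartCurvature.
Context {R : realType} {n : nat}.
Local Notation E := 'rV[R]_2.
Local Notation V := 'rV[R]_n.+1.
Variables (f : E -> V) (U : set E).
Hypotheses (oU : open U) (sf : smooth_on U f).
Hypothesis (fI : forall x, U x -> injective ('d f x)).
Hypothesis (fS : forall x, U x -> dot (f x) (f x) = 1).
Implicit Types (x u v w : E) (e p xi nu : V).

Lemma dot11 (a b : V) : a *m b^T = (dot a b)%:M.
Proof. by rewrite [LHS]mx11_scalar. Qed.

Lemma dot_lin2 (a b : R) (A B C : V) :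
  dot (a *: A + b *: B) C = a * dot A C + b * dot B C.
Proof. by rewrite dotDl !dotZl. Qed.

Lemma dot_sub_eq (A B C : V) (c : R) : dot (A - B) C = c -> dot A C = dot B C + c.
Proof. by move=> <-; rewrite dotDl dotNl addrC subrK. Qed.

Lemma nproj_pair p e1 e2 (A B : V) : dot A p = 0 ->
  - dot (nproj p e1 e2 A - A) B = dot e1 A * dot e1 B + dot e2 A * dot e2 B.
Proof.
move=> Ap; rewrite /nproj Ap scale0r subr0 addrAC [A - _ - A]addrAC subrr sub0r.
by rewrite !dotDl !dotNl !dotZl (dotC e1 A) (dotC e2 A); ring.
Qed.

Lemma bilinear_diag (b : E -> E -> R) u :
  (forall a c v v' w, b (a *: v + c *: v') w = a * b v w + c * b v' w) ->
  (forall v w, b v w = b w v) ->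
  b u u = \sum_(i < 2) \sum_(j < 2) (u 0 i * u 0 j) *
    b (delta_mx 0 i) (delta_mx 0 j).
Proof.
move=> hl bC; have hr a c v v' w : b w (a *: v + c *: v') = a * b w v + c * b w v'.
  by rewrite bC hl (bC v) (bC v').
rewrite {1 2}(row2E u) hl !hr !big_ord_recl !big_ord0 !addr0.
rewrite (_ : lift ord0 ord0 = 1); last exact: val_inj.
by rewrite (_ : ord0 = 0) //; ring.
Qed.

(** If W has the rows u1 and u2, the Jacobian J satisfies W J = F for the
    orthonormal matrix F of the frame. Hence W inverts J F^T, and the inverse
    of J J^T is W^T W. *)
Lemma frame_matrix x e1 e2 u1 u2 : U x -> tangent_frame f x e1 e2 ->
  'D_u1 f x = e1 -> 'D_u2 f x = e2 ->
  let W : 'M[R]_(1 + 1, 2) := col_mx u1 u2 in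
  invmx (first_form f x) = W^T *m W /\
  forall y : V, normal_proj f x y = nproj (f x) e1 e2 y.
Proof.
move=> Ux [[e11 e22 e12] _ _ fE] E1 E2 W.
have df := smooth_differentiable sf Ux.
pose F : 'M[R]_(1 + 1, n.+1) := col_mx e1 e2.
have FF : F *m F^T = 1%:M.
  rewrite tr_col_mx mul_col_row !dot11 (dotC e2 e1) e11 e22 e12.
  by rewrite scalar_mx_block !raddf0.
have projF (y : V) : y *m F^T *m F = dot y e1 *: e1 + dot y e2 *: e2.
  by rewrite tr_col_mx mul_mx_row mul_row_col !dot11 !mul_scalar_mx.
have JF : 'J f x = 'J f x *m F^T *m F.
  apply/row_matrixP => i; rewrite !row_mul rowE -(deriveEjacobian _ df).
  by rewrite projF -fE.
have WJ : W *m 'J f x = F.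
  by rewrite mul_col_mx -!(deriveEjacobian _ df) E1 E2.
set C := 'J f x *m F^T in JF.
have WC : W *m C = 1%:M by rewrite mulmxA WJ FF.
have CW : C *m W = 1%:M by exact: mulmx1C.
have IE : first_form f x = C *m C^T.
  by rewrite /first_form JF trmx_mul mulmxA -(mulmxA C) FF mulmx1.
have IV : first_form f x *m (W^T *m W) = 1%:M.
  by rewrite IE mulmxA -(mulmxA C) -trmx_mul WC trmx1 mulmx1.
have invI : invmx (first_form f x) = W^T *m W.
  have /mulmx1_unit[uI _] := IV.
  by rewrite -[RHS]mul1mx -(mulVmx uI) -mulmxA IV mulmx1.
split=> // y; rewrite /normal_proj /nproj invI -[RHS]addrA -opprD.
congr (_ - _).
rewrite -projF {1}JF trmx_mul -!mulmxA WJ (mulmxA C^T) -trmx_mul WC trmx1.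
by rewrite mul1mx !mulmxA.
Qed.

(** With inverse metric W^T W, the metric trace of the second form is the
    plain sum over the orthonormal frame. *)
Lemma minimal_trace x e1 e2 u1 u2 xi : U x -> tangent_frame f x e1 e2 ->
  'D_u1 f x = e1 -> 'D_u2 f x = e2 ->
  mean_curvature f x = 0 -> normal_vector f x xi ->
  dot ('D_u1 ('D_u1 f) x) xi + dot ('D_u2 ('D_u2 f) x) xi = 0.
Proof.
move=> Ux fr E1 E2 mc nx.
have [invI npE] := frame_matrix Ux fr E1 E2.
pose b v w := dot ('D_v ('D_w f) x) xi.
have sE v w : dot (second_form f x v w) xi = b v w.
  by rewrite /second_form npE; apply: dot_nproj_normal.
have bE u : b u u = \sum_(i < 2) \sum_(j < 2) (u 0 i * u 0 j) *
    b (delta_mx 0 i) (delta_mx 0 j).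
  have hl a c v v' w : b (a *: v + c *: v') w = a * b v w + c * b v' w.
    have dw := smooth_differentiable (smooth_derive w sf) Ux.
    exact: (etrans (congr1 (fun z => dot z xi) (derive_linear2 a c v v' dw))
      (dot_lin2 _ _ _ _ _)).
  have bC v w : b v w = b w v.
    exact: (congr1 (fun z => dot z xi) (second_sym oU sf v w Ux)).
  exact: (bilinear_diag u hl bC).
apply: (etrans (congr2 +%R (bE u1) (bE u2))).
have := congr1 (fun z => dot z xi) mc; rewrite /mean_curvature dotZl dot0l.
move/eqP; rewrite mulf_eq0 invr_eq0 pnatr_eq0 /= => /eqP.
rewrite dot_suml => h; apply: etrans h; rewrite -big_split /=; apply: eq_bigr => i _.
rewrite dot_suml -big_split /=; apply: eq_bigr => j _.
rewrite dotZl sE -mulrDl; congr (_ * _).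
rewrite invI tr_col_mx mul_row_col mxE !mxE !big_ord1 !mxE.
by congr (_ + _); rewrite mulrC.
Qed.

(** The normal connection differs from the flat derivative by its tangential
    part. Second derivatives of a normal field commute and cancel, so the
    normal curvature is the commutator of the shape operators of xi and eta;
    flatness makes them commute. *)
Lemma ricci_equation x e1 e2 u1 u2 xi eta v w :
  (forall zeta, normal_field f U zeta ->
     forall v w y, U y -> normal_curvature f v w zeta y = 0) ->
  U x -> tangent_frame f x e1 e2 ->
  'D_u1 f x = e1 -> 'D_u2 f x = e2 ->
  normal_vector f x xi -> normal_vector f x eta ->
  let b v u z := dot ('D_v ('D_u f) x) z in
  b w u1 xi * b v u1 eta + b w u2 xi * b v u2 eta =
  b v u1 xi * b w u1 eta + b v u2 xi * b w u2 eta.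
Proof.
move=> flat Ux fr E1x E2x nxi neta b.
have [xi' nf1 xi'x] := normal_extension oU sf fI fS Ux nxi.
have [eta' nf2 eta'x] := normal_extension oU sf fI fS Ux neta.
have [E1 [E2 [sE1 sE2 frE]]] := orthonormal_frame oU sf fI.
have [sxi xiN] := nf1; have [seta etaN] := nf2.
pose Z u y := nproj (f y) (E1 y) (E2 y) ('D_u xi' y).
have sZ u : smooth_on U (Z u).
  by apply: smooth_nproj => //; apply: smooth_derive.
have ncE u y : U y -> normal_connection f u xi' y = Z u y.
  move=> Uy; rewrite /normal_connection.
  have [_ [a1 a1E] [a2 a2E] _] := frE y Uy.
  by have [_ ->] := frame_matrix Uy (frE y Uy) a1E a2E.
have ncE2 u u' : dot (normal_connection f u' (normal_connection f u xi') x) eta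
   = dot ('D_u' (Z u) x) eta.
  rewrite {1}/normal_connection.
  have [_ ->] := frame_matrix Ux fr E1x E2x.
  rewrite (dot_nproj_normal _ fr neta).
  have := eq_on_derive u' oU Ux (ncE u).
  exact: (congr1 (fun z => dot z eta)).
have ZxE u : Z u x = nproj (f x) e1 e2 ('D_u xi' x).
  have [_ [a1 a1E] [a2 a2E] _] := frE x Ux.
  have [_ h1] := frame_matrix Ux (frE x Ux) a1E a2E.
  have [_ h2] := frame_matrix Ux fr E1x E2x.
  exact: (etrans (esym (h1 _)) (h2 _)).
have pair u : b u u1 eta = - dot e1 ('D_u eta' x) /\
              b u u2 eta = - dot e2 ('D_u eta' x).
  rewrite -eta'x -E1x -E2x.
  by split; [exact: (second_pairing oU sf u u1 Ux nf2)
            |exact: (second_pairing oU sf u u2 Ux nf2)].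
have pairxi u : b u u1 xi = - dot e1 ('D_u xi' x) /\
                b u u2 xi = - dot e2 ('D_u xi' x).
  rewrite -xi'x -E1x -E2x.
  by split; [exact: (second_pairing oU sf u u1 Ux nf1)
            |exact: (second_pairing oU sf u u2 Ux nf1)].
(* The normal component Z u of 'D_u xi' differs from 'D_u xi' by a tangent
   field; its derivative has a normal component given by the second form. *)
have key u u' : dot ('D_u' (Z u) x) eta = dot ('D_u' ('D_u xi') x) eta
   + (b u u1 xi * b u' u1 eta + b u u2 xi * b u' u2 eta).
  pose X := Z u - 'D_u xi'.
  have sX : smooth_on U X.
    by apply: smoothB => //; apply: smooth_derive.
  have Xn y : U y -> dot (X y) (eta' y) = 0.
    move=> Uy; rewrite dotDl dotNl.
    by rewrite (dot_nproj_normal _ (frE y Uy) (etaN y Uy)) subrr.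
  have dZ := diff_derivable (v := u') (smooth_differentiable (sZ u) Ux).
  have dD := diff_derivable (v := u') (smooth_differentiable (smooth_derive u sxi) Ux).
  have xif : dot ('D_u xi' x) (f x) = 0.
    apply: (etrans (derive_dot_cst u oU Ux (smooth_differentiable sxi Ux)
       (smooth_differentiable sf Ux) (fun y Uy => (xiN y Uy).1))).
    by rewrite (proj2 (xiN x Ux)) oppr0.
  apply: dot_sub_eq.
  have eX : 'D_u' X x = 'D_u' (Z u) x - 'D_u' ('D_u xi') x := deriveB dZ dD.
  rewrite -{}eX -{1}eta'x.
  apply: (etrans (derive_dot_cst u' oU Ux (smooth_differentiable sX Ux)
    (smooth_differentiable seta Ux) Xn)).
  apply: (etrans (congr1 (fun z => - dot (z - 'D_u xi' x) ('D_u' eta' x)) (ZxE u))).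
  apply: (etrans (nproj_pair _ _ _ xif)).
  have [-> ->] := pair u'; have [-> ->] := pairxi u.
  by rewrite !mulrNN.
have ncS : normal_connection f v (normal_connection f w xi') x =
           normal_connection f w (normal_connection f v xi') x.
  exact: subr0_eq (flat xi' nf1 v w x Ux).
have DZ : dot ('D_v (Z w) x) eta = dot ('D_w (Z v) x) eta.
  apply: (etrans (esym (ncE2 w v))); apply: etrans (ncE2 v w).
  exact: (congr1 (fun z => dot z eta) ncS).
have DD := congr1 (fun z => dot z eta) (schwarz v w oU Ux sxi).
apply: (addrI (dot ('D_v ('D_w xi') x) eta)).
apply: (etrans (esym (key w v))); apply: (etrans DZ); apply: (etrans (key v w)).
exact: (congr1 (fun z => z + _) (esym DD)).
Qed.

End ChartCurvature.

Section ProportionalVectors.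
Context {R : realType} {N : nat}.
Implicit Types (a b xi : 'rV[R]_N).

(** The hypothesis says that the skew form made of a and b vanishes on S.
    Testing it on the direction of a and on the component of b orthogonal to
    it shows that this component is zero. When both vectors vanish, any unit
    vector of S serves. *)
Lemma proportional_vectors (S : 'rV[R]_N -> Prop) a b :
  S a -> S b -> (forall k c d, S c -> S d -> S (c + k *: d)) ->
  (exists2 nu, S nu & dot nu nu = 1) ->
  (forall xi eta, S xi -> S eta -> dot b xi * dot a eta = dot a xi * dot b eta) ->
  exists (nu : 'rV[R]_N) (al be : R), [/\ S nu, dot nu nu = 1, a = al *: nu & b = be *: nu].
Proof.
move=> Sa Sb SD Snu h.
have S0 : S 0 by have := SD (-1) a a Sa Sa; rewrite scaleN1r subrr.
have unit c : S c -> c != 0 -> exists2 nu, S nu & dot nu nu = 1 /\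
    exists2 k : R, k != 0 & c = k *: nu.
  move=> Sc c0; have d0 : 0 < Num.sqrt (dot c c) by rewrite sqrtr_gt0 dot_gt0.
  exists (0 + (Num.sqrt (dot c c))^-1 *: c); first exact: SD.
  rewrite add0r; split; last first.
    by exists (Num.sqrt (dot c c)); rewrite ?gt_eqF // scalerA mulfV ?scale1r ?gt_eqF.
  rewrite dotZl dotZr mulrA -invfM -expr2 sqr_sqrtr ?dot_ge0 // mulVf //.
  by rewrite dot_eq0.
have [a0|aN0] := eqVneq a 0.
  have [b0|bN0] := eqVneq b 0.
    have [nu Sn nn] := Snu; exists nu, 0, 0; split; rewrite ?scale0r //.
  have [nu Sn [nn [k kN0 bE]]] := unit b Sb bN0.
  by exists nu, 0, k; split; rewrite ?scale0r.
have [nu Sn [nn [k kN0 aE]]] := unit a Sa aN0.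
exists nu, k, (dot b nu); split => //; apply/eqP; rewrite -subr_eq0 -dot_eq0.
set xi := b - _; have Sxi : S xi by rewrite /xi -scaleNr; apply: SD.
have := h xi nu Sxi Sn; rewrite aE !dotZl nn mulr1 mulrC -mulrA => /(mulfI kN0).
move=> e; apply/eqP; rewrite {1}/xi dotDl dotNl dotZl.
by rewrite e; ring.
Qed.

End ProportionalVectors.

Section AdaptedFrames.
Context {R : realType} {n : nat}.
Local Notation E := 'rV[R]_2.
Local Notation V := 'rV[R]_n.+1.
Variables (f : E -> V) (U : set E).
Hypotheses (oU : open U) (sf : smooth_on U f).
Hypothesis (fI : forall x, U x -> injective ('d f x)).
Hypothesis (fS : forall x, U x -> dot (f x) (f x) = 1).
Implicit Types (x u v w : E) (e p xi nu : V).

(** The Ricci equation for two traceless symmetric matrices, with entries a,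
    b, b, - a for each normal vector. *)
Lemma ricci_alg (x21 x11 x22 x12 y21 y11 y22 y12 ax bx ay b_y : R) :
  x21 * y11 + x22 * y12 = x11 * y21 + x12 * y22 ->
  x21 = bx -> x12 = bx -> x11 = ax -> x22 = - ax ->
  y21 = b_y -> y12 = b_y -> y11 = ay -> y22 = - ay -> bx * ay = ax * b_y.
Proof. by move=> h *; subst; lra. Qed.

(** A traceless symmetric form in the frame (e1, e2) is diagonal in the frame
    rotated by the half angle. *)
Lemma rotated_form (al be lam c s t b11 b12 b22 : R) (e1 e2 v' w' : V) :
  al = lam * (c ^+ 2 - s ^+ 2) -> be = lam * (2 * c * s) ->
  b11 = al * t -> b12 = be * t -> b22 = - (al * t) ->
  dot v' e1 * dot w' e1 * b11
   + (dot v' e1 * dot w' e2 + dot v' e2 * dot w' e1) * b12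
   + dot v' e2 * dot w' e2 * b22 =
  lam * (dot v' (c *: e1 + s *: e2) * dot w' (c *: e1 + s *: e2)
    - dot v' ((- s) *: e1 + c *: e2) * dot w' ((- s) *: e1 + c *: e2)) * t.
Proof. by move=> -> -> -> -> ->; rewrite !dotDr !dotZr; ring. Qed.

Lemma rotate_frame x e1 e2 (c s : R) : U x -> tangent_frame f x e1 e2 ->
  c ^+ 2 + s ^+ 2 = 1 ->
  tangent_frame f x (c *: e1 + s *: e2) ((- s) *: e1 + c *: e2).
Proof.
move=> Ux [[e11 e22 e12] [u1 E1] [u2 E2] fE] cs.
have df := smooth_differentiable sf Ux.
split.
- rewrite !dotDl !dotDr !dotZl !dotZr (dotC e2 e1) e11 e22 e12.
  by rewrite !mulr0 !mulr1 -cs; split; ring.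
- by exists (c *: u1 + s *: u2); rewrite -E1 -E2; apply: derive_linear2.
- by exists ((- s) *: u1 + c *: u2); rewrite -E1 -E2; apply: derive_linear2.
move=> v; have := fE v; set t1 := dot _ _; set t2 := dot _ _; move=> {1}->.
rewrite !dotDr !dotZr -/t1 -/t2 !scalerDr !scalerA addrACA -!scalerDl.
by congr (_ *: _ + _ *: _); rewrite -[LHS]mul1r -cs; ring.
Qed.

Lemma frame_coordinates x e1 e2 u1 u2 v : U x -> tangent_frame f x e1 e2 ->
  'D_u1 f x = e1 -> 'D_u2 f x = e2 ->
  v = dot ('D_v f x) e1 *: u1 + dot ('D_v f x) e2 *: u2.
Proof.
move=> Ux [_ _ _ fE] E1 E2; have df := smooth_differentiable sf Ux.
set t1 := dot _ _; set t2 := dot _ _.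
apply/eqP; rewrite -subr_eq0; apply/eqP/(chart_derive_eq0 sf fI Ux).
rewrite -[v - _]/(v - (t1 *: u1 + t2 *: u2)) -[v in X in 'D_X _ _]scale1r -scaleN1r.
apply: (etrans (derive_linear2 1 (-1) v _ df)).
rewrite scale1r scaleN1r; apply/eqP; rewrite subr_eq0; apply/eqP.
apply: (etrans (fE v)); apply: esym.
by apply: (etrans (derive_linear2 _ _ _ _ df)); rewrite E1 E2.
Qed.

Lemma second_frame x e1 e2 u1 u2 v w xi : U x -> tangent_frame f x e1 e2 ->
  'D_u1 f x = e1 -> 'D_u2 f x = e2 ->
  let b v w := dot ('D_v ('D_w f) x) xi in
  let t1 v := dot ('D_v f x) e1 in let t2 v := dot ('D_v f x) e2 in
  b v w = t1 v * t1 w * b u1 u1 + (t1 v * t2 w + t2 v * t1 w) * b u1 u2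
          + t2 v * t2 w * b u2 u2.
Proof.
move=> Ux fr E1 E2 b t1 t2.
have hl a c v1 v2 w1 : b (a *: v1 + c *: v2) w1 = a * b v1 w1 + c * b v2 w1.
  have dw := smooth_differentiable (smooth_derive w1 sf) Ux.
  exact: (etrans (congr1 (fun z => dot z xi) (derive_linear2 a c v1 v2 dw))
      (dot_lin2 _ _ _ _ _)).
have bC v1 v2 : b v1 v2 = b v2 v1.
  exact: (congr1 (fun z => dot z xi) (second_sym oU sf v1 v2 Ux)).
have vE := frame_coordinates v Ux fr E1 E2.
have wE := frame_coordinates w Ux fr E1 E2.
rewrite -/(t1 v) -/(t2 v) in vE; rewrite -/(t1 w) -/(t2 w) in wE.
clearbody b t1 t2.
move: (t1 v) (t2 v) (t1 w) (t2 w) vE wE => a1 a2 b1 b2 -> ->.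
have hr a c v1 v2 w1 : b w1 (a *: v1 + c *: v2) = a * b w1 v1 + c * b w1 v2.
  by rewrite bC hl (bC v1) (bC v2).
by rewrite hl !hr (bC u2 u1); ring.
Qed.

(** Let a and b be the normal vectors II(e1, e1) and II(e1, e2) in any
    orthonormal frame. Minimality gives II(e2, e2) = - a, and the Ricci
    equation of a flat normal bundle says that a and b are proportional. So II
    is a traceless real form times one unit normal, and rotating the frame by
    half an angle diagonalizes it. A unit normal vector exists even when II
    vanishes because 3 <= n. *)
Lemma adapted_frame_exists x : (3 <= n)%N -> U x ->
  mean_curvature f x = 0 ->
  (forall zeta, normal_field f U zeta ->
     forall v w y, U y -> normal_curvature f v w zeta y = 0) ->
  exists (lam : R) (e1 e2 nu : V), 0 <= lam /\ adapted_frame f x lam e1 e2 nu.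
Proof.
move=> n3 Ux mc flat.
have [E1 [E2 [_ _ frE]]] := orthonormal_frame oU sf fI.
move: (E1 x) (E2 x) (frE x Ux) => {E1 E2 frE} e1 e2 fr.
have [[e11 e22 e12] [u1 E1] [u2 E2] fE] := fr.
pose a := nproj (f x) e1 e2 ('D_u1 ('D_u1 f) x).
pose b := nproj (f x) e1 e2 ('D_u1 ('D_u2 f) x).
have Na : normal_vector f x a by exact: nproj_normal_vector oU sf fS _ _ _ _ Ux fr.
have Nb : normal_vector f x b by exact: nproj_normal_vector oU sf fS _ _ _ _ Ux fr.
have aE xi : normal_vector f x xi -> dot ('D_u1 ('D_u1 f) x) xi = dot a xi.
  by move=> nx; apply: esym; apply: dot_nproj_normal fr nx.
have bE xi : normal_vector f x xi -> dot ('D_u1 ('D_u2 f) x) xi = dot b xi.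
  by move=> nx; apply: esym; apply: dot_nproj_normal fr nx.
have bE' xi : normal_vector f x xi -> dot ('D_u2 ('D_u1 f) x) xi = dot b xi.
  move=> nx; apply: etrans (bE xi nx).
  exact: (congr1 (fun z => dot z xi) (second_sym oU sf u2 u1 Ux)).
have cE xi : normal_vector f x xi -> dot ('D_u2 ('D_u2 f) x) xi = - dot a xi.
  move=> nx; have := minimal_trace oU sf Ux fr E1 E2 mc nx.
  by move/eqP; rewrite addrC addr_eq0 => /eqP ->; congr (- _); apply: aE.
have nD k c d : normal_vector f x c -> normal_vector f x d ->
    normal_vector f x (c + k *: d).
  move=> [c0 c1] [d0 d1]; split; first by rewrite dotDl dotZl c0 d0 mulr0 addr0.
  by move=> v; rewrite dotDl dotZl c1 d1 mulr0 addr0.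
have unu : exists2 nu, normal_vector f x nu & dot nu nu = 1.
  have [|nu nn] := unit_orthogonal (col_mx (f x) (col_mx e1 e2)); first exact: n3.
  rewrite !mul_col_mx !dot11 => /eqP; rewrite !col_mx_eq0.
  move=> /andP[/eqP h0 /andP[/eqP h1 /eqP h2]]; exists nu => //.
  have s0 (y : R) : (y%:M : 'M[R]_1) = 0 -> y = 0.
    by move=> /matrixP/(_ 0 0); rewrite !mxE eqxx mulr1n.
  by apply/(normal_frame _ fr); split; rewrite dotC; apply: s0.
(* The off-diagonal entry of the commutator of the shape operators of xi and
   eta. *)
have prop xi eta : normal_vector f x xi -> normal_vector f x eta ->
    dot b xi * dot a eta = dot a xi * dot b eta.
  move=> nx ne.
  exact: (ricci_alg
    (ricci_equation oU sf fI fS u1 u2 flat Ux fr E1 E2 nx ne)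
    (bE' _ nx) (bE _ nx) (aE _ nx) (cE _ nx)
    (bE' _ ne) (bE _ ne) (aE _ ne) (cE _ ne)).
have [nu [al [be [nnu nn aN bN]]]] := proportional_vectors Na Nb nD unu prop.
have [lam [c [s [l0 cs alE beE]]]] := half_angle al be.
exists lam, (c *: e1 + s *: e2), ((- s) *: e1 + c *: e2), nu; split => //.
split=> //; first exact: rotate_frame.
move=> v w xi nx.
apply: (etrans (second_frame v w xi Ux fr E1 E2)) => /=.
have ea : dot ('D_u1 ('D_u1 f) x) xi = al * dot nu xi.
  by apply: (etrans (aE xi nx)); rewrite aN dotZl.
have eb : dot ('D_u1 ('D_u2 f) x) xi = be * dot nu xi.
  by apply: (etrans (bE xi nx)); rewrite bN dotZl.
have ec : dot ('D_u2 ('D_u2 f) x) xi = - (al * dot nu xi).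
  by apply: (etrans (cE xi nx)); rewrite aN dotZl.
exact: (rotated_form _ _ _ _ alE beE ea eb ec).
Qed.

End AdaptedFrames.

(** * Principal frames under orthogonal transformations *)

Section CompositionRules.
Context {R : realType} {E F : normedModType R}.

Lemma derive_chain (W : normedModType R) (g : F -> W) (phi : E -> F) x v :
  differentiable phi x -> differentiable g (phi x) ->
  'D_v (g \o phi) x = 'D_('d phi x v) g (phi x).
Proof.
move=> dphi dg.
rewrite (deriveE v (differentiable_comp dphi dg)) (deriveE _ dg).
by rewrite diff_comp.
Qed.

Lemma derive_dot_const {N} (g : E -> 'rV[R]_N) z x v : differentiable g x ->
  'D_v (fun y => dot (g y) z) x = dot ('D_v g x) z.
Proof.
move=> dg; have dz : differentiable (fun=> z) x := differentiable_cst z x.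
apply: (etrans (derive_dot v dg dz)).
have -> : 'D_v (fun=> z) x = 0 := derive_cst z x v.
by rewrite dot0r addr0.
Qed.

Lemma differentiable_mulmxr {N P} (g : E -> 'rV[R]_N) (A : 'M[R]_(N, P)) x :
  differentiable g x -> differentiable (fun y => g y *m A) x.
Proof.
move=> dg.
have -> : (fun y => g y *m A) =
    \sum_(i < N) (fun y => dot (g y) (delta_mx 0 i) *: row i A).
  apply/funext => y; rewrite fct_sumE mulmx_sum_row.
  by apply: eq_bigr => i _; rewrite dot_delta.
apply: differentiable_sum => i.
have dz : differentiable (fun=> delta_mx 0 i : 'rV[R]_N) x :=
  differentiable_cst _ x.
exact: (differentiableZl _ (differentiable_dot dg dz)).
Qed.

Lemma derive_mulmxr {N P} (g : E -> 'rV[R]_N) (A : 'M[R]_(N, P)) x v :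
  differentiable g x -> 'D_v (fun y => g y *m A) x = 'D_v g x *m A.
Proof.
move=> dg; have dgA := differentiable_mulmxr A dg.
apply: dot_inj => z; rewrite dot_mul.
apply: (etrans (esym (derive_dot_const z v dgA))).
apply: etrans (derive_dot_const (z *m A^T) v dg).
by congr (derive _ x v); apply/funext => y; rewrite dot_mul.
Qed.

End CompositionRules.

Section Transport.
Context {R : realType} {n : nat}.
Local Notation E := 'rV[R]_2.
Local Notation V := 'rV[R]_n.+1.
Variables (f h : E -> V) (U W : set E).
Hypotheses (oU : open U) (sf : smooth_on U f).
Hypothesis (fI : forall x, U x -> injective ('d f x)).
Hypotheses (oW : open W) (sh : smooth_on W h).
Hypothesis (hI : forall x, W x -> injective ('d h x)).
Hypothesis (hS : forall x, W x -> dot (h x) (h x) = 1).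
Variables (g : 'M[R]_n.+1) (O : set E) (phi : E -> E).
Hypothesis (go : g *m g^T = 1%:M).
Hypotheses (oO : open O) (OU : O `<=` U).
Hypothesis (dphi : forall y, O y -> differentiable phi y).
Hypothesis (phiW : forall y, O y -> W (phi y)).
Hypothesis (hphi : forall y, O y -> h (phi y) = f y *m g).

Lemma dot_orthogonal (a b : V) : dot (a *m g) (b *m g) = dot a b.
Proof. by rewrite /dot trmx_mul mulmxA -(mulmxA a) go mulmx1. Qed.

Lemma derive_transition y v : O y ->
  'D_v f y *m g = 'D_('d phi y v) h (phi y).
Proof.
move=> Oy; have df := smooth_differentiable sf (OU Oy).
have dh := smooth_differentiable sh (phiW Oy).
apply: (etrans (esym (derive_mulmxr g v df))).
apply: etrans (derive_chain v (dphi Oy) dh).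
by apply: (eq_on_derive v oO Oy) => z Oz; rewrite /= hphi.
Qed.

Lemma orthogonal_inj (a : V) : a *m g = 0 -> a = 0.
Proof. by move=> e; rewrite -[a]mulmx1 -go mulmxA e mul0mx. Qed.

(** An injective linear map of the plane to itself is onto; injectivity comes
    from that of the differentials of f. *)
Lemma transition_surj x (v' : E) : O x -> exists v, 'd phi x v = v'.
Proof.
move=> Ox; pose A := lin1_mx ('d phi x).
have AE v : v *m A = 'd phi x v by rewrite mul_rV_lin1.
have Au : A \in unitmx.
  rewrite -row_free_unit -kermx_eq0; apply/rowV0P => v /sub_kermxP vA.
  apply: (chart_derive_eq0 sf fI (OU Ox)); apply: orthogonal_inj.
  apply: (etrans (derive_transition v Ox)); rewrite -AE vA.
  exact: derive0.
by exists (v' *m invmx A); rewrite -AE mulmxKV.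
Qed.

(** The second fundamental form is an invariant of the surface. Pairing with a
    normal field turns second derivatives of the charts into first
    derivatives, for which only the first derivative of the transition map phi
    matters. *)
Lemma second_transition x v w xi : O x -> normal_vector h (phi x) xi ->
  dot ('D_('d phi x v) ('D_('d phi x w) h) (phi x)) xi =
  dot ('D_v ('D_w f) x) (xi *m g^T).
Proof.
move=> Ox nx; have [eta nfe ex] := normal_extension oW sh hI hS (phiW Ox) nx.
have [se eN] := nfe.
have df := smooth_differentiable (smooth_derive w sf) (OU Ox).
have de := smooth_differentiable se (phiW Ox).
rewrite -ex; apply: (etrans (second_pairing oW sh _ _ (phiW Ox) nfe)).
have h0 y : O y -> dot ('D_w f y *m g) (eta (phi y)) = 0.
  move=> Oy; rewrite (derive_transition w Oy) dotC.
  by have [_] := eN _ (phiW Oy); apply.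
have := derive_dot_cst v oO Ox (differentiable_mulmxr g df)
  (differentiable_comp (dphi Ox) de) h0.
move=> h1; have {h1} := etrans (esym (congr1 (fun z => dot z _)
  (derive_mulmxr g v df))) h1.
move=> h1; apply: esym; apply: (etrans (esym (dot_mul _ _ _))).
exact: (etrans h1 (congr1 -%R (congr2 (fun a b => dot a b)
  (derive_transition w Ox) (derive_chain v (dphi Ox) de)))).
Qed.

Lemma adapted_transition x lam e1 e2 nu : O x -> adapted_frame f x lam e1 e2 nu ->
  adapted_frame h (phi x) lam (e1 *m g) (e2 *m g) (nu *m g).
Proof.
move=> Ox [[[e11 e22 e12] [u1 E1] [u2 E2] fE] [nf nv] nn sE].
have D v : 'D_('d phi x v) h (phi x) = 'D_v f x *m g.
  by rewrite (derive_transition v Ox).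
split; last 1 first.
- move=> v' w' xi nx.
  have [v <-] := transition_surj v' Ox; have [w <-] := transition_surj w' Ox.
  have nxg : normal_vector f x (xi *m g^T).
    have [x0 xv] := nx; split; first by rewrite dot_mul trmxK -hphi.
    by move=> u; rewrite dot_mul trmxK -D.
  apply: (etrans (second_transition v w Ox nx)).
  apply: (etrans (sE v w _ nxg)).
  rewrite -dot_mul (D v) (D w).
  by move: ('D_v f x) ('D_w f x) => a b; rewrite !dot_orthogonal.
- split; first by rewrite !dot_orthogonal.
  + by exists ('d phi x u1); rewrite D E1.
  + by exists ('d phi x u2); rewrite D E2.
  move=> v'; have [v <-] := transition_surj v' Ox; rewrite D.
  move: (fE v); move: ('D_v f x) => a aE; rewrite !dot_orthogonal {1}aE.
  by rewrite mulmxDl -!scalemxAl.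
- split; first by rewrite hphi // dot_orthogonal.
  move=> v'; have [v <-] := transition_surj v' Ox; rewrite D.
  by apply: etrans (nv v); rewrite dot_orthogonal.
- by rewrite dot_orthogonal.
Qed.

End Transport.

(** * Structure equations and integrability conditions *)

Section StructureEquations.
Context {R : realType} {n : nat}.
Local Notation E := 'rV[R]_2.
Local Notation V := 'rV[R]_n.+1.
Variables (f : E -> V) (U : set E).
Hypotheses (oU : open U) (sf : smooth_on U f).
Hypothesis (fI : forall x, U x -> injective ('d f x)).
Hypothesis (fS : forall x, U x -> dot (f x) (f x) = 1).
Variables (W : set E) (e1 e2 nu : E -> V) (lam : R).
Hypotheses (oW : open W) (WU : W `<=` U).
Hypotheses (s1 : smooth_on W e1) (s2 : smooth_on W e2) (sn : smooth_on W nu).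
Hypothesis ad : forall y, W y -> adapted_frame f y lam (e1 y) (e2 y) (nu y).
Implicit Types (x y u v w : E) (xi : V).

Local Notation t1 v y := (dot ('D_v f y) (e1 y)).
Local Notation t2 v y := (dot ('D_v f y) (e2 y)).
Local Notation om v y := (dot ('D_v e1 y) (e2 y)).

Let df y (Wy : W y) : differentiable f y := smooth_differentiable sf (WU Wy).
Let d1 y (Wy : W y) : differentiable e1 y := smooth_differentiable s1 Wy.
Let d2 y (Wy : W y) : differentiable e2 y := smooth_differentiable s2 Wy.
Let dn y (Wy : W y) : differentiable nu y := smooth_differentiable sn Wy.

Let fr y (Wy : W y) : tangent_frame f y (e1 y) (e2 y).
Proof. by have [] := ad Wy. Qed.

Lemma frame_dots y : W y ->
  [/\ dot (f y) (f y) = 1, dot (e1 y) (e1 y) = 1, dot (e2 y) (e2 y) = 1 &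
   dot (nu y) (nu y) = 1] /\
  [/\ dot (f y) (e1 y) = 0, dot (f y) (e2 y) = 0, dot (f y) (nu y) = 0,
    dot (e1 y) (e2 y) = 0 & dot (e1 y) (nu y) = 0 /\ dot (e2 y) (nu y) = 0].
Proof.
move=> Wy; have [fy nn uu _] := ad Wy; have [[e11 e22 e12] _ _ _] := fy.
have [f1 f2] := frame_orth oU sf fS (WU Wy) fy.
have /(normal_frame _ fy)[n0 n1 n2] := nn.
by do ?split => //; rewrite ?fS // 1?dotC //; apply: WU.
Qed.

Lemma derive_unit (X : E -> V) y v : W y -> smooth_on W X ->
  (forall z, W z -> dot (X z) (X z) = 1) -> dot ('D_v X y) (X y) = 0.
Proof.
move=> Wy sX h; have dX := smooth_differentiable sX Wy.
have := derive_dot_cst v oW Wy dX dX h; rewrite (dotC (X y)).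
by move: (dot _ _) => r e; lra.
Qed.

Lemma derive_orthogonal (X Y : E -> V) y v : W y -> smooth_on W X ->
  smooth_on W Y -> (forall z, W z -> dot (X z) (Y z) = 0) ->
  dot ('D_v X y) (Y y) = - dot ('D_v Y y) (X y).
Proof.
move=> Wy sX sY h; rewrite (dotC ('D_v Y y)).
exact: (derive_dot_cst v oW Wy (smooth_differentiable sX Wy)
  (smooth_differentiable sY Wy) h).
Qed.

Let sfW : smooth_on W f := smoothS WU sf.

Lemma derive_e1_normal y v xi : W y -> normal_vector f y xi ->
  dot ('D_v e1 y) xi = lam * t1 v y * dot (nu y) xi.
Proof.
move=> Wy nx; have [eta nfe ex] := normal_extension oU sf fI fS (WU Wy) nx.
have [[[e11 e22 e12] [u1 E1] [u2 E2] fE] _ _ sE] := ad Wy.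
have nfW : normal_field f W eta.
  by split=> [|z /WU]; [apply: smoothS nfe.1|apply: nfe.2].
have h0 z : W z -> dot (e1 z) (eta z) = 0.
  move=> Wz; have [_ /(_ z (WU Wz))nz] := nfe.
  by have /(normal_frame _ (fr Wz))[_ + _] := nz; rewrite dotC.
rewrite -ex.
apply: (etrans (weingarten sf v oW Wy WU (d1 Wy) h0 nfW (esym E1))).
rewrite ex; apply: (etrans (sE _ _ _ nx)); rewrite E1 e11 e12.
by rewrite mulr1 mulr0 subr0.
Qed.

Lemma derive_e2_normal y v xi : W y -> normal_vector f y xi ->
  dot ('D_v e2 y) xi = - (lam * t2 v y * dot (nu y) xi).
Proof.
move=> Wy nx; have [eta nfe ex] := normal_extension oU sf fI fS (WU Wy) nx.
have [[[e11 e22 e12] [u1 E1] [u2 E2] fE] _ _ sE] := ad Wy.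
have nfW : normal_field f W eta.
  by split=> [|z /WU]; [apply: smoothS nfe.1|apply: nfe.2].
have h0 z : W z -> dot (e2 z) (eta z) = 0.
  move=> Wz; have [_ /(_ z (WU Wz))nz] := nfe.
  by have /(normal_frame _ (fr Wz))[_ _] := nz; rewrite dotC.
rewrite -ex.
apply: (etrans (weingarten sf v oW Wy WU (d2 Wy) h0 nfW (esym E2))).
rewrite ex; apply: (etrans (sE _ _ _ nx)); rewrite E2 e22 (dotC (e2 y)) e12.
by rewrite mulr1 mulr0 sub0r mulrN mulNr.
Qed.

Lemma eq_in_frame y (A B : V) : W y ->
  dot A (f y) = dot B (f y) -> dot A (e1 y) = dot B (e1 y) ->
  dot A (e2 y) = dot B (e2 y) ->
  (forall xi, normal_vector f y xi -> dot A xi = dot B xi) -> A = B.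
Proof.
move=> Wy h0 h1 h2 hn; apply/eqP; rewrite -subr_eq0; apply/eqP.
apply: (normal_vector_eq0 (WU Wy) (fr Wy)); rewrite ?dotDl ?dotNl.
- by rewrite h0 subrr.
- by rewrite h1 subrr.
- by rewrite h2 subrr.
by move=> xi /hn e; rewrite dotDl dotNl e subrr.
Qed.

Lemma derive_e1 y v : W y ->
  'D_v e1 y = - t1 v y *: f y + om v y *: e2 y + (lam * t1 v y) *: nu y.
Proof.
move=> Wy; have [[ff e11 e22 nn] [f1 f2 fn e12 [n1 n2]]] := frame_dots Wy.
have a0 : dot ('D_v e1 y) (f y) = - t1 v y.
  rewrite (derive_orthogonal v Wy s1 sfW) // => z Wz.
  by have [_ [+ _ _ _ _]] := frame_dots Wz; rewrite dotC.
have a1 : dot ('D_v e1 y) (e1 y) = 0.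
  by apply: (derive_unit v Wy s1) => z Wz; have [[]] := frame_dots Wz.
have an xi := derive_e1_normal v (xi := xi) Wy.
move: (t1 v y) a0 a1 an; move: ('D_v e1 y) => A t a0 a1 an.
apply: (eq_in_frame Wy); rewrite ?dotDl ?dotZl ?a0 ?a1.
- by rewrite ff (dotC _ (f y)) f2 (dotC _ (f y)) fn; ring.
- by rewrite f1 (dotC _ (e1 y)) e12 (dotC _ (e1 y)) n1; ring.
- by rewrite f2 e22 (dotC (nu y)) n2; ring.
move=> xi nx; rewrite an // !dotDl !dotZl.
have /(normal_frame _ (fr Wy))[x0 x1 x2] := nx.
by rewrite (dotC (f y)) x0 (dotC (e2 y)) x2; ring.
Qed.

Lemma derive_e2 y v : W y ->
  'D_v e2 y = - t2 v y *: f y - om v y *: e1 y - (lam * t2 v y) *: nu y.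
Proof.
move=> Wy; have [[ff e11 e22 nn] [f1 f2 fn e12 [n1 n2]]] := frame_dots Wy.
have a0 : dot ('D_v e2 y) (f y) = - t2 v y.
  rewrite (derive_orthogonal v Wy s2 sfW) // => z Wz.
  by have [_ [_ + _ _ _]] := frame_dots Wz; rewrite dotC.
have a1 : dot ('D_v e2 y) (e1 y) = - om v y.
  rewrite (derive_orthogonal v Wy s2 s1) // => z Wz.
  by have [_ [_ _ _ + _]] := frame_dots Wz; rewrite dotC.
have a2 : dot ('D_v e2 y) (e2 y) = 0.
  by apply: (derive_unit v Wy s2) => z Wz; have [[]] := frame_dots Wz.
have an xi := derive_e2_normal v (xi := xi) Wy.
move: (t2 v y) (om v y) a0 a1 a2 an; move: ('D_v e2 y) => A t o a0 a1 a2 an.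
apply: (eq_in_frame Wy); rewrite ?dotDl ?dotNl ?dotZl ?a0 ?a1 ?a2.
- by rewrite ff (dotC _ (f y)) f1 (dotC _ (f y)) fn; ring.
- by rewrite f1 e11 (dotC (nu y)) n1; ring.
- by rewrite f2 e12 (dotC (nu y)) n2; ring.
move=> xi nx; rewrite an // !dotDl !dotNl !dotZl.
have /(normal_frame _ (fr Wy))[x0 x1 x2] := nx.
by rewrite (dotC (f y)) x0 (dotC (e1 y)) x1; ring.
Qed.

End StructureEquations.

Section NormalDerivative.
Context {R : realType} {n : nat}.
Local Notation E := 'rV[R]_2.
Local Notation V := 'rV[R]_n.+1.
Variables (f : E -> V) (U : set E).
Hypotheses (oU : open U) (sf : smooth_on U f).
Hypothesis (fI : forall x, U x -> injective ('d f x)).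
Hypothesis (fS : forall x, U x -> dot (f x) (f x) = 1).
Variables (W : set E) (e1 e2 nu : E -> V) (lam : R).
Hypotheses (oW : open W) (WU : W `<=` U).
Hypotheses (s1 : smooth_on W e1) (s2 : smooth_on W e2) (sn : smooth_on W nu).
Hypothesis ad : forall y, W y -> adapted_frame f y lam (e1 y) (e2 y) (nu y).
Hypothesis l0 : 0 < lam.
Implicit Types (x y u v w : E) (xi : V).

Local Notation t1 v y := (dot ('D_v f y) (e1 y)).
Local Notation t2 v y := (dot ('D_v f y) (e2 y)).
Local Notation om v y := (dot ('D_v e1 y) (e2 y)).

Let De1 y v (Wy : W y) := derive_e1 oU sf fI fS oW WU s1 ad v Wy.
Let De2 y v (Wy : W y) := derive_e2 oU sf fI fS oW WU s1 s2 ad v Wy.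
Let dots y (Wy : W y) := frame_dots oU sf fS WU ad Wy.
Let sfW : smooth_on W f := smoothS WU sf.
Let df y (Wy : W y) : differentiable f y := smooth_differentiable sfW Wy.
Let dn y (Wy : W y) : differentiable nu y := smooth_differentiable sn Wy.
Let fr y (Wy : W y) : tangent_frame f y (e1 y) (e2 y).
Proof. by have [] := ad Wy. Qed.
Let lamN0 : lam != 0. Proof. by rewrite gt_eqF. Qed.

Lemma coframe_dual y : W y -> exists u1 u2,
  [/\ t1 u1 y = 1, t2 u1 y = 0, t1 u2 y = 0 & t2 u2 y = 1].
Proof.
move=> Wy; have [[e11 e22 e12] [u1 E1] [u2 E2] _] := fr Wy.
by exists u1, u2; rewrite E1 E2 (dotC (e2 y)).
Qed.

Lemma dot_comb3 (a b c : R) (A B C D : V) :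
  dot (a *: A + b *: B + c *: C) D = a * dot A D + b * dot B D + c * dot C D.
Proof. by rewrite !dotDl !dotZl. Qed.

Lemma dot_comb3_last (a b c : R) (A B C D : V) : dot A D = 0 -> dot B D = 0 ->
  dot (a *: A + b *: B + c *: C) D = c * dot C D.
Proof. by move=> hA hB; rewrite dot_comb3 hA hB !mulr0 !add0r. Qed.

Lemma dot_comb3_eq0 (a b c : R) (A B C D : V) : dot A D = 0 -> dot B D = 0 ->
  dot C D = 0 -> dot (a *: A + b *: B + c *: C) D = 0.
Proof. by move=> hA hB hC; rewrite dot_comb3_last // hC mulr0. Qed.

Lemma cancel_factor (k a b c d : R) : k != 0 ->
  (k * a) * b = (k * c) * d -> a * b = c * d.
Proof. by move=> k0; rewrite -!mulrA => /(mulfI k0). Qed.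

Lemma cancel_factorN (k a b c d : R) : k != 0 ->
  (- (k * a)) * b = (- (k * c)) * d -> a * b = c * d.
Proof. by move=> k0; rewrite !mulNr => /oppr_inj; apply: cancel_factor. Qed.

Lemma derive_e2' y v : W y ->
  'D_v e2 y = - t2 v y *: f y + (- om v y) *: e1 y + (- (lam * t2 v y)) *: nu y.
Proof.
move=> Wy; apply: (etrans (De2 v Wy)).
by rewrite -!scaleNr.
Qed.

Lemma two_wedges (T : Type) (a b q : T -> R) (u1 u2 : T) :
  a u1 = 1 -> b u1 = 0 -> a u2 = 0 -> b u2 = 1 ->
  (forall v w : T, a w * q v = a v * q w) ->
  (forall v w : T, b w * q v = b v * q w) ->
  forall v : T, q v = 0.
Proof.
move=> a1 b1 a2 b2 ha hb v.
have q2 : q u2 = 0 by have := ha u2 u1; rewrite a1 a2 mul1r mul0r.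
by have := hb v u2; rewrite b2 q2 mulr0 mul1r.
Qed.

(** Codazzi. For xi normal and orthogonal to nu, extend xi to a normal field
    eta orthogonal to nu. Then 'D_v e1 and 'D_v e2 are orthogonal to eta, and
    [derive_dot_symm] for each of them says that the covector v |-> <nu, 'D_v
    eta> is proportional to both coframe covectors, after division by lam.
    Hence it is zero. *)
Lemma derive_nu_perp y v xi : W y -> normal_vector f y xi ->
  dot (nu y) xi = 0 -> dot ('D_v nu y) xi = 0.
Proof.
move=> Wy nx nux.
have [eta0 [se0 n0] ex] := normal_extension oU sf fI fS (WU Wy) nx.
pose eta z := eta0 z - dot (eta0 z) (nu z) *: nu z.
have se : smooth_on W eta.
  have se0W := smoothS WU se0.
  by apply: smoothB => //; apply: smoothZ => //; apply: smooth_dot.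
have ey : eta y = xi.
  by rewrite /eta ex (dotC xi) nux scale0r subr0.
have nuN z (Wz : W z) : normal_vector f z (nu z) by have [] := ad Wz.
have nE z : W z -> normal_vector f z (eta z).
  move=> Wz; have [a0 av] := n0 z (WU Wz); have [b0 bv] := nuN z Wz.
  split=> [|w]; rewrite dotDl dotNl dotZl ?a0 ?b0 ?mulr0 ?subr0 //.
  by rewrite av bv mulr0 subr0.
have nuE z : W z -> dot (nu z) (eta z) = 0.
  move=> Wz; have [[_ _ _ nn] _] := dots Wz.
  by rewrite dotC dotDl dotNl dotZl nn mulr1 subrr.
have nE' z : W z -> [/\ dot (f z) (eta z) = 0, dot (e1 z) (eta z) = 0 &
    dot (e2 z) (eta z) = 0].
  move=> Wz; have /(normal_frame _ (fr Wz))[? ? ?] := nE z Wz.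
  by rewrite !(dotC _ (eta z)).
have k1 u z : W z -> dot ('D_u e1 z) (eta z) = 0.
  move=> Wz; have [h0 h1 h2] := nE' z Wz.
  apply: (etrans (congr1 (fun A => dot A (eta z)) (De1 u Wz))).
  exact: (dot_comb3_eq0 _ _ _ h0 h2 (nuE z Wz)).
have k2 u z : W z -> dot ('D_u e2 z) (eta z) = 0.
  move=> Wz; have [h0 h1 h2] := nE' z Wz.
  apply: (etrans (congr1 (fun A => dot A (eta z)) (derive_e2' u Wz))).
  exact: (dot_comb3_eq0 _ _ _ h0 h1 (nuE z Wz)).
pose q u := dot (nu y) ('D_u eta y).
have de := smooth_differentiable se Wy.
have m0 u : dot (f y) ('D_u eta y) = 0.
  apply: oppr_inj; rewrite oppr0.
  apply: (etrans (esym (derive_dot_cst u oW Wy (df Wy) de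
    (fun z Wz => let: And3 h _ _ := nE' z Wz in h)))).
  by rewrite dotC; apply: (nE y Wy).2.
have m1 u : dot (e1 y) ('D_u eta y) = 0.
  apply: oppr_inj; rewrite oppr0.
  apply: (etrans (esym (derive_dot_cst u oW Wy (smooth_differentiable s1 Wy) de
    (fun z Wz => let: And3 _ h _ := nE' z Wz in h)))).
  exact: k1.
have m2 u : dot (e2 y) ('D_u eta y) = 0.
  apply: oppr_inj; rewrite oppr0.
  apply: (etrans (esym (derive_dot_cst u oW Wy (smooth_differentiable s2 Wy) de
    (fun z Wz => let: And3 _ _ h := nE' z Wz in h)))).
  exact: k2.
have ha u w : t1 w y * q u = t1 u y * q w.
  have e u' w' : dot ('D_w' e1 y) ('D_u' eta y) = (lam * t1 w' y) * q u'.
    exact: (etrans (congr1 (fun A => dot A _) (De1 w' Wy))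
      (dot_comb3_last _ _ _ _ (m0 u') (m2 u'))).
  apply: (cancel_factor lamN0); apply: (etrans (esym (e u w))).
  by apply: etrans (e w u); exact: (derive_dot_symm u w oW Wy s1 se k1).
have hb u w : t2 w y * q u = t2 u y * q w.
  have e u' w' : dot ('D_w' e2 y) ('D_u' eta y) = (- (lam * t2 w' y)) * q u'.
    exact: (etrans (congr1 (fun A => dot A _) (derive_e2' w' Wy))
      (dot_comb3_last _ _ _ _ (m0 u') (m1 u'))).
  apply: (cancel_factorN lamN0); apply: (etrans (esym (e u w))).
  by apply: etrans (e w u); exact: (derive_dot_symm u w oW Wy s2 se k2).
have [u1 [u2 [a1 b1 a2 b2]]] := coframe_dual Wy.
have qv := two_wedges (a := fun v => t1 v y) (b := fun v => t2 v y) a1 b1 a2 b2 ha hb v.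
rewrite -ey; apply: (etrans (derive_dot_cst v oW Wy (dn Wy) de nuE)).
by rewrite -/(q v) qv oppr0.
Qed.

Lemma derive_nu_coordinates y (A : V) (a b : R) : W y ->
  dot A (f y) = 0 -> dot A (e1 y) = - (lam * a) -> dot A (e2 y) = lam * b ->
  dot A (nu y) = 0 ->
  (forall xi, normal_vector f y xi -> dot (nu y) xi = 0 -> dot A xi = 0) ->
  A = (- (lam * a)) *: e1 y + (lam * b) *: e2 y.
Proof.
move=> Wy a0 a1 a2 an ax.
have [[ff e11 e22 nn] [f1 f2 fn e12 [n1 n2]]] := dots Wy.
have nuN : normal_vector f y (nu y) by have [] := ad Wy.
apply: (eq_in_frame WU ad Wy); rewrite ?dot_lin2 ?a0 ?a1 ?a2.
- by rewrite (dotC _ (f y)) f1 (dotC _ (f y)) f2 !mulr0 addr0.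
- by rewrite e11 (dotC (e2 y)) e12 mulr0 mulr1 addr0.
- by rewrite e22 e12 mulr0 mulr1 add0r.
move=> xi nx; rewrite dot_lin2.
have /(normal_frame _ (fr Wy))[x0 x1 x2] := nx.
rewrite (dotC (e1 y)) x1 (dotC (e2 y)) x2 !mulr0 addr0.
pose xi0 := xi - dot xi (nu y) *: nu y.
have nx0 : normal_vector f y xi0.
  have [b0 bv] := nx; have [c0 cv] := nuN.
  split=> [|u]; rewrite dotDl dotNl dotZl ?b0 ?c0 ?mulr0 ?subr0 //.
  by rewrite bv cv mulr0 subr0.
have := ax xi0 nx0; rewrite dotC /xi0 dotDl dotNl dotZl nn mulr1 subrr => /(_ erefl).
by rewrite dotDr dotNr dotZr an mulr0 subr0.
Qed.

Lemma derive_nu y v : W y ->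
  'D_v nu y = (- (lam * t1 v y)) *: e1 y + (lam * t2 v y) *: e2 y.
Proof.
move=> Wy; have [[ff e11 e22 nn] [f1 f2 fn e12 [n1 n2]]] := dots Wy.
have a0 : dot ('D_v nu y) (f y) = 0.
  apply: (etrans (derive_orthogonal oW v Wy sn sfW _)) => [z Wz|].
    by have [_ [_ _ + _ _]] := dots Wz; rewrite dotC.
  by have [_ [_ nv] _ _] := ad Wy; rewrite dotC nv oppr0.
have a1 : dot ('D_v nu y) (e1 y) = - (lam * t1 v y).
  apply: (etrans (derive_orthogonal oW v Wy sn s1 _)) => [z Wz|].
    by have [_ [_ _ _ _ [+ _]]] := dots Wz; rewrite dotC.
  congr (- _).
  apply: (etrans (congr1 (fun A => dot A (nu y)) (De1 v Wy))).
  by apply: (etrans (dot_comb3_last _ _ _ _ fn n2)); rewrite nn mulr1.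
have a2 : dot ('D_v nu y) (e2 y) = lam * t2 v y.
  apply: (etrans (derive_orthogonal oW v Wy sn s2 _)) => [z Wz|].
    by have [_ [_ _ _ _ [_ +]]] := dots Wz; rewrite dotC.
  apply: oppr_inj; rewrite opprK.
  apply: (etrans (congr1 (fun A => dot A (nu y)) (derive_e2' v Wy))).
  by apply: (etrans (dot_comb3_last _ _ _ _ fn n1)); rewrite nn mulr1.
have an : dot ('D_v nu y) (nu y) = 0.
  by apply: (derive_unit oW v Wy sn) => z Wz; have [[]] := dots Wz.
exact: (derive_nu_coordinates Wy a0 a1 a2 an (fun xi => derive_nu_perp v Wy)).
Qed.

End NormalDerivative.

Lemma sqr_eq1_gt0 {R : realFieldType} (l : R) : 0 < l -> 1 - l ^+ 2 = 0 -> l = 1.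
Proof.
move=> l0 h; have : (1 - l) * (1 + l) = 0 by rewrite -h; ring.
move/eqP; rewrite mulf_eq0 => /orP[|/eqP e]; last by lra.
by rewrite subr_eq0 => /eqP.
Qed.

Section IntegrabilityConditions.
Context {R : realType} {n : nat}.
Local Notation E := 'rV[R]_2.
Local Notation V := 'rV[R]_n.+1.
Variables (f : E -> V) (U : set E).
Hypotheses (oU : open U) (sf : smooth_on U f).
Hypothesis (fI : forall x, U x -> injective ('d f x)).
Hypothesis (fS : forall x, U x -> dot (f x) (f x) = 1).
Variables (W : set E) (e1 e2 nu : E -> V) (lam : R).
Hypotheses (oW : open W) (WU : W `<=` U).
Hypotheses (s1 : smooth_on W e1) (s2 : smooth_on W e2) (sn : smooth_on W nu).
Hypothesis ad : forall y, W y -> adapted_frame f y lam (e1 y) (e2 y) (nu y).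
Hypothesis l0 : 0 < lam.
Implicit Types (x y u v w : E) (xi : V).

Local Notation t1 v y := (dot ('D_v f y) (e1 y)).
Local Notation t2 v y := (dot ('D_v f y) (e2 y)).
Local Notation om v y := (dot ('D_v e1 y) (e2 y)).

Let De1 y v (Wy : W y) := derive_e1 oU sf fI fS oW WU s1 ad v Wy.
Let De2 y v (Wy : W y) := derive_e2' oU sf fI fS oW WU s1 s2 ad v Wy.
Let Dnu y v (Wy : W y) := derive_nu oU sf fI fS oW WU s1 s2 sn ad l0 v Wy.
Let dots y (Wy : W y) := frame_dots oU sf fS WU ad Wy.
Let sfW : smooth_on W f := smoothS WU sf.
Let fr y (Wy : W y) : tangent_frame f y (e1 y) (e2 y).
Proof. by have [] := ad Wy. Qed.
Let dual y (Wy : W y) := coframe_dual ad Wy.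

Lemma derive_addZ (g h : E -> V) (a : R) y v :
  differentiable g y -> differentiable h y ->
  'D_v (fun z => g z + a *: h z) y = 'D_v g y + a *: 'D_v h y.
Proof.
move=> dg dh; have dg' := diff_derivable (v := v) dg.
have dh' := diff_derivable (v := v) dh.
apply: (etrans (deriveD dg' (derivableZ (k := a) dh'))).
exact: (congr1 (fun A => _ + A) (deriveZ a dh')).
Qed.

Lemma derive_nu_addZ a y v : W y ->
  'D_v (fun z => nu z + a *: f z) y =
   ((a - lam) * t1 v y) *: e1 y + ((a + lam) * t2 v y) *: e2 y.
Proof.
move=> Wy; have dn := smooth_differentiable sn Wy.
apply: (etrans (derive_addZ a v dn (smooth_differentiable sfW Wy))).
have [_ _ _ fE] := fr Wy.
apply: (etrans (congr2 (fun A B => A + a *: B) (Dnu v Wy) (fE v))).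
move: (t1 v y) (t2 v y) => p q.
rewrite scalerDr !scalerA addrACA -!scalerDl.
congr (_ *: e1 y + _ *: e2 y); first by ring.
by rewrite [lam + a]addrC.
Qed.

Let smooth_nu_addZ a : smooth_on W (fun z => nu z + a *: f z).
Proof.
apply: smoothD => //; apply: smoothZ => //; exact: smooth_cst.
Qed.

Lemma nu_addZ_lam u z : W z ->
  'D_u (fun z => nu z + lam *: f z) z = (2 * lam * t2 u z) *: e2 z.
Proof.
move=> Wz; apply: (etrans (derive_nu_addZ lam u Wz)).
rewrite subrr mul0r scale0r add0r; congr (_ * _ *: _).
by rewrite mulr_natl mulr2n.
Qed.

Lemma nu_addZ_lamN u z : W z ->
  'D_u (fun z => nu z + (- lam) *: f z) z = (- (2 * lam * t1 u z)) *: e1 z.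
Proof.
move=> Wz; apply: (etrans (derive_nu_addZ (- lam) u Wz)).
rewrite addNr mul0r scale0r addr0 -mulNr; congr (_ * _ *: _).
by rewrite mulr_natl mulr2n opprD.
Qed.

(** Codazzi again. Since nu + lam f moves only along e2 and nu - lam f only
    along e1, [derive_dot_symm] against e1 and e2 says that the connection
    form is proportional to both coframe covectors, so it vanishes and the
    surface is flat. *)
Lemma connection_form_eq0 y v : W y -> om v y = 0.
Proof.
move=> Wy; have lam20 : 2 * lam != 0 by rewrite mulf_neq0 ?pnatr_eq0 ?gt_eqF.
have hA u w : t2 w y * om u y = t2 u y * om w y.
  have k z u' (Wz : W z) : dot ('D_u' (fun z => nu z + lam *: f z) z) (e1 z) = 0.
    apply: (etrans (congr1 (fun A => dot A (e1 z)) (nu_addZ_lam u' Wz))).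
    have [_ [_ _ _ e12 _]] := dots Wz.
    by rewrite dotZl (dotC (e2 z)) e12 mulr0.
  have key := derive_dot_symm u w oW Wy (smooth_nu_addZ lam) s1 (fun u z Wz => k z u Wz).
  have e u' w' : dot ('D_w' (fun z => nu z + lam *: f z) y) ('D_u' e1 y)
     = (2 * lam * t2 w' y) * om u' y.
    apply: (etrans (congr1 (fun A => dot A _) (nu_addZ_lam w' Wy))).
    by rewrite dotZl (dotC (e2 y)).
  apply: (cancel_factor lam20); apply: (etrans (esym (e u w))).
  exact: (etrans key (e w u)).
have hB u w : t1 w y * om u y = t1 u y * om w y.
  have k z u' (Wz : W z) : dot ('D_u' (fun z => nu z + (- lam) *: f z) z) (e2 z) = 0.
    apply: (etrans (congr1 (fun A => dot A (e2 z)) (nu_addZ_lamN u' Wz))).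
    have [_ [_ _ _ e12 _]] := dots Wz.
    by rewrite dotZl e12 mulr0.
  have key := derive_dot_symm u w oW Wy (smooth_nu_addZ (- lam)) s2 (fun u z Wz => k z u Wz).
  have o2 u' : dot (e1 y) ('D_u' e2 y) = - om u' y.
    apply: (etrans (dotC _ _)).
    apply: (derive_orthogonal oW u' Wy s2 s1) => z Wz.
    by have [_ [_ _ _ + _]] := dots Wz; rewrite dotC.
  have e u' w' : dot ('D_w' (fun z => nu z + (- lam) *: f z) y) ('D_u' e2 y)
     = (2 * lam * t1 w' y) * om u' y.
    apply: (etrans (congr1 (fun A => dot A _) (nu_addZ_lamN w' Wy))).
    by rewrite dotZl o2 mulrNN.
  apply: (cancel_factor lam20); apply: (etrans (esym (e u w))).
  exact: (etrans key (e w u)).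
have [u1 [u2 [a1 b1 a2 b2]]] := dual Wy.
exact: (two_wedges (a := fun v => t1 v y) (b := fun v => t2 v y)
  (q := fun v => om v y) a1 b1 a2 b2 hB hA v).
Qed.

(** Gauss. With zero connection form, <'D_u1 e1, 'D_u2 e2> = <'D_u2 e1, 'D_u1
    e2> reads 1 - lam^2 = 0. *)
Lemma principal_curvature_eq1 y : W y -> lam = 1.
Proof.
move=> Wy; have [u1 [u2 [a1 b1 a2 b2]]] := dual Wy.
have key := derive_dot_symm u2 u1 oW Wy s1 s2 (fun u z Wz => connection_form_eq0 u Wz).
have E1 : 'D_u1 e1 y = - f y + lam *: nu y.
  apply: (etrans (De1 u1 Wy)); rewrite (connection_form_eq0 u1 Wy) a1.
  by rewrite scaleN1r scale0r addr0 mulr1.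
have E2 : 'D_u2 e2 y = - f y - lam *: nu y.
  apply: (etrans (De2 u2 Wy)); rewrite (connection_form_eq0 u2 Wy) b2.
  by rewrite scaleN1r oppr0 scale0r addr0 mulr1 scaleNr.
have E3 : 'D_u2 e1 y = 0.
  apply: (etrans (De1 u2 Wy)); rewrite (connection_form_eq0 u2 Wy) a2.
  by rewrite oppr0 mulr0 !scale0r !addr0.
have [[ff e11 e22 nn] [f1 f2 fn e12 [n1 n2]]] := dots Wy.
apply: (sqr_eq1_gt0 l0).
apply: etrans (etrans key (etrans (congr1 (fun A => dot A _) E3) (dot0l _))).
apply: esym; apply: (etrans (congr2 (fun A B => dot A B) E1 E2)).
rewrite !(dotDl, dotDr, dotNl, dotNr, dotZl, dotZr) ff nn fn (dotC (nu y)) fn.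
by ring.
Qed.

End IntegrabilityConditions.

(** * Smooth fields of principal frames *)

Section AdaptedFrameFields.
Context {R : realType} {n : nat}.
Local Notation E := 'rV[R]_2.
Local Notation V := 'rV[R]_n.+1.
Variables (f : E -> V) (U : set E).
Hypotheses (oU : open U) (sf : smooth_on U f).
Hypothesis (fI : forall x, U x -> injective ('d f x)).
Hypothesis (fS : forall x, U x -> dot (f x) (f x) = 1).
Implicit Types (x y u v w : E) (xi nu : V).

(** Makes a smooth normalized field agree, up to sign, with principal vectors
    chosen pointwise and without any regularity. *)
Lemma unit_proportional {N} (a b : 'rV[R]_N) (c k : R) : c != 0 ->
  dot a a = 1 -> dot b b = 1 -> c *: a = k *: b -> a = b \/ a = - b.
Proof.
move=> c0 aa bb e.
have : c ^+ 2 == k ^+ 2.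
  have := congr1 (fun z => dot z z) e; rewrite !dotZl !dotZr aa bb !mulr1.
  by rewrite !expr2 => ->.
rewrite eqf_sqr => /orP[/eqP ck|/eqP ck].
  by left; apply: (scalerI c0); rewrite e ck.
by right; apply: (scalerI c0); rewrite e scalerN -scaleNr ck opprK.
Qed.

Lemma derive_opp x u : U x -> 'D_(- u) f x = - 'D_u f x.
Proof.
move=> Ux; rewrite -scaleN1r -[RHS]scaleN1r.
exact: derive_scale (smooth_differentiable sf Ux).
Qed.

Lemma sign_form (l t : R) (A B e1 e2 : V) :
  l * (dot A (- e1) * dot B (- e1) - dot A e2 * dot B e2) * t =
  l * (dot A e1 * dot B e1 - dot A e2 * dot B e2) * t.
Proof. by rewrite !dotNr mulrNN. Qed.

Lemma dot_expand (A B e1 e2 : V) : B = dot B e1 *: e1 + dot B e2 *: e2 ->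
  dot A B = dot A e1 * dot B e1 + dot A e2 * dot B e2.
Proof. by move=> {1}->; rewrite dotDr !dotZr mulrC [X in _ + X]mulrC. Qed.

Lemma form_minus (l p q A B : R) : B = p + q -> A = l * (p - q) ->
  A + - l * B = - (2 * l) * q.
Proof. by move=> -> ->; ring. Qed.

Lemma form_plus (l p q A B : R) : B = p + q -> A = l * (p - q) ->
  A + l * B = 2 * l * p.
Proof. by move=> -> ->; ring. Qed.

Lemma adapted_opp1 x lam (e1 e2 : V) nu : U x -> adapted_frame f x lam e1 e2 nu ->
  adapted_frame f x lam (- e1) e2 nu.
Proof.
move=> Ux [[[e11 e22 e12] [u1 E1] E2 fE] nn uu sE]; split => //.
  split => //; first by rewrite !dotNl dotNr opprK e11 e12 oppr0.
    by exists (- u1); rewrite -E1; apply: derive_opp.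
  by move=> v; apply: (etrans (fE v)); rewrite dotNr scalerN scaleNr opprK.
by move=> v w xi nx; apply: (etrans (sE v w xi nx)); apply: esym; apply: sign_form.
Qed.

(** Exchanging the principal directions changes the sign of the form e1^2 -
    e2^2, which nu absorbs. *)
Lemma adapted_swap x lam (e1 e2 : V) nu : U x -> adapted_frame f x lam e1 e2 nu ->
  adapted_frame f x lam e2 e1 (- nu).
Proof.
move=> Ux [[[e11 e22 e12] E1 E2 fE] [n0 nv] uu sE]; split.
- split => //; first by rewrite dotC.
  by move=> v; apply: (etrans (fE v)); rewrite addrC.
- by split=> [|v]; rewrite dotNl ?n0 ?nv oppr0.
- by rewrite dotNl dotNr opprK.
move=> v w xi nx; apply: (etrans (sE v w xi nx)).
by rewrite dotNl -opprB mulrN mulNr mulrN.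
Qed.

Lemma adapted_opp2 x lam (e1 e2 : V) nu : U x -> adapted_frame f x lam e1 e2 nu ->
  adapted_frame f x lam e1 (- e2) nu.
Proof.
move=> Ux /(adapted_swap Ux)/(adapted_opp1 Ux)/(adapted_swap Ux).
by rewrite opprK.
Qed.

Lemma open_nonzero (W : set E) (g : E -> V) : open W -> smooth_on W g ->
  open (W `&` [set y | g y != 0]).
Proof.
move=> oW sg; rewrite openE => y [Wy gy]; rewrite /interior.
have sgg := smooth_dot oW sg sg.
have := smooth_continuous sgg Wy => /cvgr_gt/(_ 0).
rewrite dot_gt0 => /(_ gy) h.
by apply: filterS2 (open_near oW Wy) h => z Wz; rewrite dot_gt0.
Qed.

Lemma principal_form x lam (e1 e2 nu : V) v w : adapted_frame f x lam e1 e2 nu ->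
  dot ('D_v f x) ('D_w f x) = dot ('D_v f x) e1 * dot ('D_w f x) e1
     + dot ('D_v f x) e2 * dot ('D_w f x) e2 /\
  dot ('D_v ('D_w f) x) nu =
    lam * (dot ('D_v f x) e1 * dot ('D_w f x) e1
             - dot ('D_v f x) e2 * dot ('D_w f x) e2).
Proof.
move=> [[_ _ _ fE] nn uu sE]; split; last first.
  by apply: (etrans (sE v w nu nn)); rewrite uu mulr1.
exact: dot_expand (fE w).
Qed.

(** The form with coefficients q is l times the square of the covector t. The
    left side is the vector of its kernel read off from its second row, so it
    lies on the line of b1 whatever the basis f1, f2 is. *)
Lemma eigenvector_field (l s1 t1 s2 t2 q12 q22 : R) (f1 f2 b1 b2 : V) :
  f1 = s1 *: b1 + t1 *: b2 -> f2 = s2 *: b1 + t2 *: b2 ->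
  q22 = l * (t2 * t2) -> q12 = l * (t1 * t2) ->
  q22 *: f1 - q12 *: f2 = (l * t2 * (t2 * s1 - t1 * s2)) *: b1.
Proof.
move=> -> -> -> ->; apply: dot_inj => z.
by rewrite !(dotDl, dotNl, dotZl); ring.
Qed.

(** The principal frames given pointwise are arbitrary choices. Near x, nu is
    recovered by normalizing the normal component of the second derivative in
    one principal direction of x. The forms <II, nu> - lam I and <II, nu> +
    lam I equal - 2 lam e2^2 and 2 lam e1^2, so their kernels are the
    principal lines, which smooth vectors span. By [unit_proportional] the
    result agrees with the pointwise frames up to signs. *)
Lemma adapted_frame_field x lam : 0 < lam -> U x ->
  (forall y, U y -> exists e1 e2 nu, adapted_frame f y lam e1 e2 nu) ->
  exists (W : set E) (e1 e2 nu : E -> V),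
  [/\ [/\ open W, W x & W `<=` U],
      [/\ smooth_on W e1, smooth_on W e2 & smooth_on W nu] &
      forall y, W y -> adapted_frame f y lam (e1 y) (e2 y) (nu y)].
Proof.
move=> l0 Ux all; have lN0 : lam != 0 by rewrite gt_eqF.
have [a1 [a2 [n0 ad0]]] := all x Ux.
have [fr0 nn0 nu0 sE0] := ad0; have [[a11 a22 a12] [w1 A1] [w2 A2] _] := fr0.
have [E1 [E2 [sE1 sE2 frE]]] := orthonormal_frame oU sf fI.
pose f1 := 'D_w1 f; pose f2 := 'D_w2 f; pose f11 := 'D_w1 f1.
have sf1 : smooth_on U f1 by exact: smooth_derive.
have sf2 : smooth_on U f2 by exact: smooth_derive.
pose s y := nproj (f y) (E1 y) (E2 y) (f11 y).
have ss : smooth_on U s.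
  exact: (smooth_nproj oU sf sE1 sE2 (smooth_derive w1 sf1)).
have sP y b1 b2 m : U y -> adapted_frame f y lam b1 b2 m ->
    exists k, s y = k *: m /\
     k = lam * (dot (f1 y) b1 * dot (f1 y) b1 - dot (f1 y) b2 * dot (f1 y) b2).
  move=> Uy [fb [m0 mv] mm sb]; eexists; split; last by [].
  apply/eqP; rewrite -subr_eq0; apply/eqP.
  have nm : normal_vector f y m by exact: conj m0 mv.
  have [p0 pv] : normal_vector f y (s y).
    exact: (nproj_normal_vector oU sf fS _ Uy (frE y Uy)).
  set k := lam * _; have nd : normal_vector f y (s y - k *: m).
    split=> [|v]; rewrite dotDl dotNl dotZl ?p0 ?m0 ?mulr0 ?subr0 //.
    by rewrite pv mv mulr0 subr0.
  have /(normal_frame _ fb)[d0 d1 d2] := nd.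
  apply: (normal_vector_eq0 Uy fb d0 d1 d2) => xi nx.
  rewrite dotDl dotNl dotZl; apply/eqP; rewrite subr_eq0; apply/eqP.
  by apply: (etrans (dot_nproj_normal _ (frE y Uy) nx)); apply: sb.
have f1x : f1 x = a1 by [].
have f2x : f2 x = a2 by [].
have [k0 [sx k0E]] := sP x a1 a2 n0 Ux ad0.
have {}k0E : k0 = lam by rewrite k0E f1x a11 a12 mulr0 subr0 !mulr1.
have n0N0 : n0 != 0 by rewrite -dot_eq0 nu0 oner_eq0.
pose W1 := U `&` [set y | s y != 0].
have oW1 : open W1 by exact: open_nonzero.
have W1U : W1 `<=` U by move=> y [].
have W1x : W1 x by split => //=; rewrite sx k0E scaler_eq0 negb_or lN0.
have [nu snu nuP] := unit_field oW1 (fun y (W1y : W1 y) => W1y.2) (smoothS W1U ss).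
have nux : nu x = n0.
  have [c c0 [cE cc]] := nuP x W1x.
  have cN : c != 0 by rewrite gt_eqF.
  have e : c *: nu x = lam *: n0 by rewrite -cE sx k0E.
  have [//|nE] := unit_proportional cN cc nu0 e.
  have /eqP : (c + lam) *: n0 = 0.
    by rewrite scalerDl -e nE scalerN addrN.
  by rewrite scaler_eq0 (negbTE n0N0) orbF gt_eqF // addr_gt0.
have adnu y : W1 y -> exists b1 b2, adapted_frame f y lam b1 b2 (nu y).
  move=> W1y; have Uy := W1U _ W1y; have [b1 [b2 [m ad]]] := all y Uy.
  have [k [sy _]] := sP y b1 b2 m Uy ad.
  have [c c0 [cE cc]] := nuP y W1y; have [_ _ mm _] := ad.
  have cN : c != 0 by rewrite gt_eqF.
  have [->|->] := unit_proportional cN cc mm (etrans (esym cE) sy).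
    by exists b1, b2.
  by exists b2, b1; apply: adapted_swap.
have sfW1 := smoothS W1U sf.
have sf1W : smooth_on W1 f1 := smoothS W1U sf1.
have sf2W : smooth_on W1 f2 := smoothS W1U sf2.
pose Q (sg : R) (v w : E) y :=
  dot ('D_v ('D_w f) y) (nu y) + sg * dot ('D_v f y) ('D_w f y).
have sQ sg v w : smooth_on W1 (Q sg v w).
  have sw : smooth_on W1 ('D_w f) := smooth_derive w sfW1.
  exact: (smoothD oW1 (smooth_dot oW1 (smooth_derive v sw) snu)
    (smoothM oW1 (@smooth_cst _ _ R W1 sg)
      (smooth_dot oW1 (smooth_derive v sfW1) sw))).
have QN y b1 b2 v w : adapted_frame f y lam b1 b2 (nu y) ->
    Q (- lam) v w y = - (2 * lam) * (dot ('D_v f y) b2 * dot ('D_w f y) b2).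
  move=> ad; have [e1 e2] := principal_form v w ad.
  exact: (form_minus e1 e2).
have QP y b1 b2 v w : adapted_frame f y lam b1 b2 (nu y) ->
    Q lam v w y = 2 * lam * (dot ('D_v f y) b1 * dot ('D_w f y) b1).
  move=> ad; have [e1 e2] := principal_form v w ad.
  exact: (form_plus e1 e2).
(* The kernel vectors of Q (- lam) and of Q lam, in the basis f1, f2; this
   basis being (e1, e2) at x, they do not vanish there. *)
pose g1 y := Q (- lam) w2 w2 y *: f1 y - Q (- lam) w1 w2 y *: f2 y.
pose g2 y := Q lam w1 w1 y *: f2 y - Q lam w2 w1 y *: f1 y.
have sg1 : smooth_on W1 g1.
  exact: (smoothB oW1 (smoothZ oW1 (sQ _ _ _) sf1W) (smoothZ oW1 (sQ _ _ _) sf2W)).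
have sg2 : smooth_on W1 g2.
  exact: (smoothB oW1 (smoothZ oW1 (sQ _ _ _) sf2W) (smoothZ oW1 (sQ _ _ _) sf1W)).
have g1P y b1 b2 : adapted_frame f y lam b1 b2 (nu y) ->
   g1 y = (- (2 * lam) * dot (f2 y) b2 *
     (dot (f2 y) b2 * dot (f1 y) b1 - dot (f1 y) b2 * dot (f2 y) b1)) *: b1.
  move=> ad; have [[_ _ _ fE] _ _ _] := ad.
  exact: (eigenvector_field (fE w1) (fE w2) (QN _ _ _ w2 w2 ad) (QN _ _ _ w1 w2 ad)).
have g2P y b1 b2 : adapted_frame f y lam b1 b2 (nu y) ->
   g2 y = (2 * lam * dot (f1 y) b1 *
     (dot (f1 y) b1 * dot (f2 y) b2 - dot (f2 y) b1 * dot (f1 y) b2)) *: b2.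
  move=> ad; have [[_ _ _ fE] _ _ _] := ad.
  have fE' v : 'D_v f y = dot ('D_v f y) b2 *: b2 + dot ('D_v f y) b1 *: b1.
    by apply: (etrans (fE v)); rewrite addrC.
  exact: (eigenvector_field (fE' w2) (fE' w1) (QP _ _ _ w1 w1 ad) (QP _ _ _ w2 w1 ad)).
have adx : adapted_frame f x lam a1 a2 (nu x) by rewrite nux.
have g1x : g1 x != 0.
  rewrite (g1P x a1 a2 adx) f1x f2x a11 a22 a12 (dotC a2) a12.
  rewrite mul0r subr0 !mulr1 scaler_eq0 negb_or oppr_eq0 mulf_neq0 ?pnatr_eq0 //.
  by rewrite -dot_eq0 a11 oner_eq0.
have g2x : g2 x != 0.
  rewrite (g2P x a1 a2 adx) f1x f2x a11 a22 a12 (dotC a2) a12.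
  rewrite mul0r subr0 !mulr1 scaler_eq0 negb_or mulf_neq0 ?pnatr_eq0 //.
  by rewrite -dot_eq0 a22 oner_eq0.
pose W2 := W1 `&` [set y | g1 y != 0].
have oW2 : open W2 by exact: (open_nonzero oW1 sg1).
have W21 : W2 `<=` W1 by move=> y [].
pose W := W2 `&` [set y | g2 y != 0].
have oW : open W by exact: (open_nonzero oW2 (smoothS W21 sg2)).
have WW1 : W `<=` W1 by move=> y [[]].
have [e1 se1 e1P] := unit_field oW (fun y (Wy : W y) => Wy.1.2) (smoothS WW1 sg1).
have [e2 se2 e2P] := unit_field oW (fun y (Wy : W y) => Wy.2) (smoothS WW1 sg2).
exists W, e1, e2, nu; split.
- split; [exact: oW|exact: (conj (conj W1x g1x) g2x)|].
  exact: (subset_trans WW1 W1U).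
- by split; [exact: se1|exact: se2|exact: smoothS WW1 snu].
move=> y Wy; have Uy := W1U _ (WW1 _ Wy).
have [b1 [b2 ad]] := adnu y (WW1 _ Wy).
have [[[b11 b22 _] _ _ _] _ _ _] := ad.
have [c1 c10 [c1E u1]] := e1P y Wy; have [c2 c20 [c2E u2]] := e2P y Wy.
have c1N : c1 != 0 by rewrite gt_eqF.
have c2N : c2 != 0 by rewrite gt_eqF.
have [->|->] := unit_proportional c1N u1 b11 (etrans (esym c1E) (g1P y b1 b2 ad));
  have [->|->] := unit_proportional c2N u2 b22 (etrans (esym c2E) (g2P y b1 b2 ad)).
- exact: ad.
- exact: adapted_opp2 Uy ad.
- exact: adapted_opp1 Uy ad.
- exact: adapted_opp1 Uy (adapted_opp2 Uy ad).
Qed.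

End AdaptedFrameFields.

(** * The two constant planes of a surface of principal curvature one *)

Section ProductDerivatives.
Context {R : realType} {E : normedModType R} {N : nat}.
Implicit Types (A B : E -> 'rV[R]_N).

Lemma derive_mul (a b : E -> R) y v : differentiable a y -> differentiable b y ->
  'D_v (fun z => a z * b z) y = 'D_v a y * b y + a y * 'D_v b y.
Proof.
exact: (@derive_bilinear R E R R R (GRing.mul : {bilinear R -> R -> R})
  (@mul_continuous R)).
Qed.

Lemma differentiable_mul (a b : E -> R) y : differentiable a y ->
  differentiable b y -> differentiable (fun z => a z * b z) y.
Proof.
exact: (@differentiable_bilinear R E R R R (GRing.mul : {bilinear R -> R -> R})
  (@mul_continuous R)).
Qed.

Lemma differentiable_dot_const A xi y : differentiable A y ->
  differentiable (fun z => dot (A z) xi) y.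
Proof. by move=> dA; apply: (differentiable_dot dA (differentiable_cst xi y)). Qed.

(** The tensor product of A and B, tested on the pair (xi, zeta). *)
Definition tensor A B xi zeta (y : E) : R := dot (A y) xi * dot (B y) zeta.

Lemma differentiable_tensor A B xi zeta y : differentiable A y ->
  differentiable B y -> differentiable (tensor A B xi zeta) y.
Proof.
by move=> dA dB; apply: differentiable_mul; apply: differentiable_dot_const.
Qed.

Lemma derive_tensor A B xi zeta y v a b : differentiable A y ->
  differentiable B y -> 'D_v A y = a -> 'D_v B y = b ->
  'D_v (tensor A B xi zeta) y =
    dot a xi * dot (B y) zeta + dot (A y) xi * dot b zeta.
Proof.
move=> dA dB <- <-.
apply: (etrans (derive_mul v (differentiable_dot_const xi dA)
  (differentiable_dot_const zeta dB))).
exact: (congr2 (fun p q => p * _ + _ * q) (derive_dot_const xi v dA)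
  (derive_dot_const zeta v dB)).
Qed.

(** If A and B turn into each other, A ^ B keeps its plane and its area. *)
Lemma derive_wedge A B xi zeta y v c d : differentiable A y ->
  differentiable B y -> 'D_v A y = c *: B y -> 'D_v B y = d *: A y ->
  'D_v (tensor A B xi zeta - tensor A B zeta xi) y = 0.
Proof.
move=> dA dB DA DB.
have d1 := diff_derivable (v := v) (differentiable_tensor xi zeta dA dB).
have d2 := diff_derivable (v := v) (differentiable_tensor zeta xi dA dB).
apply: (etrans (deriveB d1 d2)).
apply: (etrans (congr2 (fun p q => p - q) (derive_tensor xi zeta dA dB DA DB)
  (derive_tensor zeta xi dA dB DA DB))).
by rewrite !dotZl; ring.
Qed.

End ProductDerivatives.

(** The bivector a ^ b, as a skew matrix acting on rows. *)
Definition wedge {R : realType} {N : nat} (a b : 'rV[R]_N) : 'M[R]_N :=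
  a^T *m b - b^T *m a.

Lemma wedgeNr {R : realType} {N : nat} (a b : 'rV[R]_N) : wedge a (- b) = - wedge a b.
Proof. by rewrite /wedge mulmxN linearN mulNmx opprD opprK. Qed.

Lemma wedgeNl {R : realType} {N : nat} (a b : 'rV[R]_N) : wedge (- a) b = - wedge a b.
Proof. by rewrite /wedge mulmxN linearN mulNmx opprD opprK. Qed.

Section LocalRigidity.
Context {R : realType} {n : nat}.
Local Notation E := 'rV[R]_2.
Local Notation V := 'rV[R]_n.+1.
Variables (f : E -> V) (U : set E).
Hypotheses (oU : open U) (sf : smooth_on U f).
Hypothesis (fI : forall x, U x -> injective ('d f x)).
Hypothesis (fS : forall x, U x -> dot (f x) (f x) = 1).
Implicit Types (x y u v w : E) (xi nu : V).

Lemma wedgeE (a b : V) i j : wedge a b i j =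
  dot a (delta_mx 0 i) * dot b (delta_mx 0 j) -
  dot a (delta_mx 0 j) * dot b (delta_mx 0 i).
Proof. by rewrite !dot_delta !mxE !big_ord1 !mxE [X in _ - X]mulrC. Qed.

Lemma wedge_constant (A B : E -> V) x e :
  (forall y, ball x e y -> differentiable A y) ->
  (forall y, ball x e y -> differentiable B y) ->
  (forall y v, ball x e y -> exists c d,
     'D_v A y = c *: B y /\ 'D_v B y = d *: A y) ->
  forall y, ball x e y -> wedge (A y) (B y) = wedge (A x) (B x).
Proof.
move=> dA dB DAB y By; apply/matrixP => i j; rewrite !wedgeE.
pose k := tensor A B (delta_mx 0 i) (delta_mx 0 j)
   - tensor A B (delta_mx 0 j) (delta_mx 0 i).
apply: (@ball_constant R E k x e) By => [z Bz|z v Bz].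
  by apply: differentiableB; apply: differentiable_tensor; [apply: dA|apply: dB|apply: dA|apply: dB].
have [c [d [h1 h2]]] := DAB z v Bz.
exact: derive_wedge (dA z Bz) (dB z Bz) h1 h2.
Qed.

(** For a torus of radius 1/sqrt 2 in two orthogonal planes, f - nu and f + nu
    are the doubled components of f in the planes, and the e_i are tangent to
    the circles. The two bivectors of J are then those of the planes, up to
    sign and scaled to be of area sqrt 2. *)
Definition torus_frame x (J : 'M[R]_n.+1 * 'M[R]_n.+1) := exists e1 e2 nu,
  adapted_frame f x 1 e1 e2 nu /\
  J = (wedge (nu - f x) e1, wedge (nu + f x) e2).

(** With lam = 1 and zero connection form, the structure equations say that nu
    - f and e1 turn into each other, and so do nu + f and e2. Both bivectors
    are therefore locally constant. *)
Lemma torus_frame_local x lam : 0 < lam -> U x ->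
  (forall y, U y -> exists e1 e2 nu, adapted_frame f y lam e1 e2 nu) ->
  lam = 1 /\ exists e J, [/\ 0 < e, ball x e `<=` U &
    forall y, ball x e y -> torus_frame y J].
Proof.
move=> l0 Ux all.
have [W [e1 [e2 [nu [[oW Wx WU] [s1 s2 sn] ad]]]]] := adapted_frame_field oU sf fI fS l0 Ux all.
have lam1 := principal_curvature_eq1 oU sf fI fS oW WU s1 s2 sn ad l0 Wx.
split=> //; move: l0 ad; rewrite lam1 => l0 ad {all}.
have /nbhs_ballP[e /= e0 eW] : nbhs x W by exact: open_near oW Wx.
exists e, (wedge (nu x - f x) (e1 x), wedge (nu x + f x) (e2 x)); split => //.
  exact: (subset_trans eW WU).
have sfW := smoothS WU sf.
pose A a := (fun z => nu z + a *: f z).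
have sA a : smooth_on W (A a).
  exact: (smoothD oW sn (smoothZ oW (@smooth_cst _ _ R W a) sfW)).
have A1 z : A (-1) z = nu z - f z by rewrite /A scaleN1r.
have A2 z : A 1 z = nu z + f z by rewrite /A scale1r.
have om0 z v (Wz : W z) := connection_form_eq0 oU sf fI fS oW WU s1 s2 sn ad l0 v Wz.
have h1 := @wedge_constant (A (-1)) e1 x e
  (fun y By => smooth_differentiable (sA (-1)) (eW y By))
  (fun y By => smooth_differentiable s1 (eW y By)).
have h2 := @wedge_constant (A 1) e2 x e
  (fun y By => smooth_differentiable (sA 1) (eW y By))
  (fun y By => smooth_differentiable s2 (eW y By)).
move=> y By; exists (e1 y), (e2 y), (nu y); split; first by apply: ad; apply: eW.
rewrite -!A1 -!A2 (h1 _ y By) ?(h2 _ y By) // => z v /eW Wz.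
  exists (2 * dot ('D_v f z) (e2 z)), (- dot ('D_v f z) (e2 z)); split.
    apply: (etrans (derive_nu_addZ oU sf fI fS oW WU s1 s2 sn ad l0 1 v Wz)).
    by rewrite subrr mul0r scale0r add0r.
  apply: (etrans (derive_e2' oU sf fI fS oW WU s1 s2 ad v Wz)).
  rewrite (om0 z v Wz); move: (dot _ _) => t.
  by rewrite oppr0 scale0r addr0 mul1r -scalerDr /A scale1r addrC.
exists (- (2) * dot ('D_v f z) (e1 z)), (dot ('D_v f z) (e1 z)); split.
  apply: (etrans (derive_nu_addZ oU sf fI fS oW WU s1 s2 sn ad l0 (-1) v Wz)).
  by rewrite addNr mul0r scale0r addr0 -opprD.
apply: (etrans (derive_e1 oU sf fI fS oW WU s1 ad v Wz)).
rewrite (om0 z v Wz); move: (dot _ _) => t.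
by rewrite scale0r addr0 mul1r /A scalerDr scalerA mulrN1 addrC.
Qed.

(** The principal form lam * (e1^2 - e2^2) determines the frame up to signs
    and an exchange of the directions. The expansion of b1 and b2 in (e1, e2)
    is orthogonal, and comparing II(b1, b1) forces p^2 - q^2 to be 1 or -1. *)
Lemma torus_frame_unique x J K : U x -> torus_frame x J -> torus_frame x K ->
  [\/ K = (J.1, J.2), K = (- J.1, J.2), K = (J.1, - J.2) | K = (- J.1, - J.2)] \/
  [\/ K = (J.2, J.1), K = (- J.2, J.1), K = (J.2, - J.1) | K = (- J.2, - J.1)].
Proof.
move=> Ux [e1 [e2 [nu [ad ->]]]] [b1 [b2 [m [bd ->]]]] /=.
have [[[e11 e22 e12] _ _ eE] nn uu sE] := ad.
have [[[b11 b22 b12] [u1 B1] [u2 B2] _] nm mm sB] := bd.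
have b1E : b1 = dot b1 e1 *: e1 + dot b1 e2 *: e2 by rewrite -B1; apply: eE.
have b2E : b2 = dot b2 e1 *: e1 + dot b2 e2 *: e2 by rewrite -B2; apply: eE.
have pq := dot_expand b1 b1E; have rs := dot_expand b2 b2E.
have prqs := dot_expand b2 b1E.
rewrite (dotC b2 b1) b11 b22 b12 in pq rs prqs.
set p := dot b1 e1 in b1E pq rs prqs; set q := dot b1 e2 in b1E pq rs prqs.
set r := dot b2 e1 in b2E pq rs prqs; set s := dot b2 e2 in b2E pq rs prqs.
move/esym in pq; move/esym in rs; move/esym in prqs.
have rho : (p * p - q * q) * dot nu m = 1.
  have h1 : dot ('D_u1 ('D_u1 f) x) m = 1.
    apply: (etrans (sB _ _ _ nm)); rewrite B1 mm b11 b12.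
    by rewrite mulr0 subr0 !mulr1.
  apply: etrans h1; apply: esym; apply: (etrans (sE _ _ _ nm)).
  by rewrite B1 mul1r.
set c := p * p - q * q in rho.
have cle : c ^+ 2 <= 1.
  have : c ^+ 2 + 4 * (p * q) ^+ 2 = (p * p + q * q) ^+ 2 by rewrite /c; ring.
  by rewrite pq expr1n => <-; rewrite lerDl mulr_ge0 ?sqr_ge0.
(* Since c * <nu, m> = 1 and c^2 <= 1, the squared length of m - c nu is both
   nonnegative and nonpositive. *)
have mE0 : dot (m - c *: nu) (m - c *: nu) = c ^+ 2 - 1.
  rewrite !(dotDl, dotDr, dotNl, dotNr, dotZl, dotZr) mm uu (dotC m nu) rho.
  by ring.
have mE : m = c *: nu.
  apply/eqP; rewrite -subr_eq0 -dot_eq0 eq_le dot_ge0 andbT mE0.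
  by rewrite subr_le0.
have c2 : c ^+ 2 == 1.
  have := mm; rewrite mE dotZl dotZr uu mulr1 -expr2 => ->.
  by [].
have sqr_pm (z : R) : z * z = 1 -> z = 1 \/ z = -1.
  by move/eqP; rewrite -expr2 sqrf_eq1 => /orP[/eqP|/eqP]; [left|right].
have sqr0 (z : R) : z * z = 0 -> z = 0.
  by move/eqP; rewrite -expr2 sqrf_eq0 => /eqP.
move: c2; rewrite sqrf_eq1 => /orP[/eqP c1|/eqP c1].
- left; have q0 : q = 0 by apply: sqr0; rewrite /c in c1; lra.
  have p1 : p * p = 1 by rewrite q0 in pq; lra.
  have r0 : r = 0.
    by apply: sqr0; rewrite -[LHS]mul1r -p1; move: prqs; rewrite q0 mulr0 addr0
      => /eqP; rewrite mulf_eq0 => /orP[/eqP ->|/eqP ->]; ring.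
  have s1 : s * s = 1 by rewrite r0 in rs; lra.
  rewrite mE c1 b1E b2E q0 r0 !scale0r addr0 add0r scale1r.
  by have [->|->] := sqr_pm _ p1; have [->|->] := sqr_pm _ s1;
    rewrite ?scaleN1r ?scale1r ?wedgeNr; [constructor 1|constructor 3|constructor 2|constructor 4].
- right; have p0 : p = 0 by apply: sqr0; rewrite /c in c1; lra.
  have q1 : q * q = 1 by rewrite p0 in pq; lra.
  have s0 : s = 0.
    by apply: sqr0; rewrite -[LHS]mul1r -q1; move: prqs; rewrite p0 mulr0 add0r
      => /eqP; rewrite mulf_eq0 => /orP[/eqP ->|/eqP ->]; ring.
  have r1 : r * r = 1 by rewrite s0 in rs; lra.
  rewrite mE c1 b1E b2E p0 s0 !scale0r addr0 add0r scaleN1r.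
  have -> : - nu - f x = - (nu + f x) by rewrite opprD.
  have -> : - nu + f x = - (nu - f x) by rewrite opprB addrC.
  by have [->|->] := sqr_pm _ q1; have [->|->] := sqr_pm _ r1;
    rewrite ?scaleN1r ?scale1r ?wedgeNr ?wedgeNl ?opprK;
    [constructor 4|constructor 2|constructor 3|constructor 1].
Qed.

End LocalRigidity.

(** * The totally geodesic case *)

Section TotallyGeodesic.
Context {R : realType} {n : nat}.
Local Notation E := 'rV[R]_2.
Local Notation V := 'rV[R]_n.+1.
Variables (f : E -> V) (U : set E).
Hypotheses (oU : open U) (sf : smooth_on U f).
Hypothesis (fI : forall x, U x -> injective ('d f x)).
Hypothesis (fS : forall x, U x -> dot (f x) (f x) = 1).
Implicit Types (x y u v w : E) (xi nu : V).

Definition projector3 (a b c : V) : 'M[R]_n.+1 :=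
  a^T *m a + b^T *m b + c^T *m c.

Lemma mul_projector3 (z a b c : V) :
  z *m projector3 a b c = dot z a *: a + dot z b *: b + dot z c *: c.
Proof. by rewrite !mulmxDr !mulmxA !dot11 !mul_scalar_mx. Qed.

(** For a projector Q: its image contains the position and tangent plane. *)
Definition in_plane (Q : 'M[R]_n.+1) x :=
  f x *m Q = f x /\ forall v, 'D_v f x *m Q = 'D_v f x.

Lemma frame_in_plane x e1 e2 : U x -> tangent_frame f x e1 e2 ->
  in_plane (projector3 (f x) e1 e2) x.
Proof.
move=> Ux fr; have [f1 f2] := frame_orth oU sf fS Ux fr; have [_ _ _ fE] := fr.
split=> [|v]; rewrite mul_projector3.
  by rewrite fS // f1 f2 !scale0r !addr0 scale1r.
apply: etrans (esym (fE v)).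
by rewrite dotC (dot_chart_derive oU sf fS v Ux) scale0r add0r.
Qed.

(** Expresses the condition by the projector alone, which makes it insensitive
    to moving along a region where the projector is constant. *)
Lemma in_planeP x e1 e2 Q : U x -> tangent_frame f x e1 e2 ->
  in_plane Q x <-> projector3 (f x) e1 e2 *m Q = projector3 (f x) e1 e2.
Proof.
move=> Ux fr; have [h0 hv] := frame_in_plane Ux fr.
have [_ [u1 E1] [u2 E2] _] := fr; split=> [[q0 qv]|kq].
  by rewrite /projector3 !mulmxDl -!mulmxA q0 -E1 -E2 !qv.
split=> [|v]; first by rewrite -[in LHS]h0 -mulmxA kq h0.
by move: (hv v); move: ('D_v f x) => a ha; rewrite -[in LHS]ha -mulmxA kq ha.
Qed.

(** For lam = 0 the structure equations say that the derivatives of f, e1 and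
    e2 stay in their span; the orthogonal projector on that span is then
    constant. *)
Lemma projector_local x : U x ->
  (forall y, U y -> exists e1 e2 nu, adapted_frame f y 0 e1 e2 nu) ->
  exists E1 E2 e, [/\ 0 < e, ball x e `<=` U &
   forall y, ball x e y -> tangent_frame f y (E1 y) (E2 y) /\
     projector3 (f y) (E1 y) (E2 y) = projector3 (f x) (E1 x) (E2 x)].
Proof.
move=> Ux all; have [E1 [E2 [s1 s2 fr]]] := orthonormal_frame oU sf fI.
have /nbhs_ballP[e /= e0 eU] : nbhs x U by exact: open_near oU Ux.
exists E1, E2, e; split => // y By; split; first exact: fr (eU y By).
(* With lam = 0 every orthonormal tangent frame is principal. *)
have [nu ad] : exists nu : E -> V, forall y, U y -> adapted_frame f y 0 (E1 y) (E2 y) (nu y).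
  have /choice[nu h] : forall y : E, exists m : V, U y -> adapted_frame f y 0 (E1 y) (E2 y) m.
    move=> z; have [Uz|nUz] := pselect (U z); last by exists 0.
    have [a [b [m [fab nm mm sE]]]] := all z Uz; exists m => _.
    split => //; first exact: fr.
    by move=> v w xi nx; apply: (etrans (sE v w xi nx)); rewrite !mul0r.
  by exists nu.
have UU : U `<=` U by [].
apply/matrixP => i j.
have KE z : projector3 (f z) (E1 z) (E2 z) i j =
   (tensor f f (delta_mx 0 i) (delta_mx 0 j)
   + tensor E1 E1 (delta_mx 0 i) (delta_mx 0 j)
   + tensor E2 E2 (delta_mx 0 i) (delta_mx 0 j)) z.
  rewrite -[RHS]/(tensor _ _ _ _ _ + tensor _ _ _ _ _ + tensor _ _ _ _ _).
  by rewrite /tensor !dot_delta !mxE !big_ord1 !mxE.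
rewrite !KE; apply: (@ball_constant R E _ x e) By => [z Bz|z v Bz].
  have Uz := eU z Bz.
  have df := smooth_differentiable sf Uz.
  have d1 := smooth_differentiable s1 Uz; have d2 := smooth_differentiable s2 Uz.
  by do ![apply: differentiableD]; apply: differentiable_tensor.
have Uz := eU z Bz.
have df := smooth_differentiable sf Uz.
have d1 := smooth_differentiable s1 Uz; have d2 := smooth_differentiable s2 Uz.
pose T (A : E -> V) := tensor A A (delta_mx 0 i) (delta_mx 0 j).
have dT A : differentiable A z -> derivable (T A) z v.
  by move=> dA; apply: diff_derivable; apply: differentiable_tensor.
have [_ _ _ fE] := fr z Uz.
have D0 := derive_tensor (delta_mx 0 i) (delta_mx 0 j) df df (fE v) (fE v).
have De1 := derive_e1 oU sf fI fS oU UU s1 ad v Uz.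
have De2 := derive_e2' oU sf fI fS oU UU s1 s2 ad v Uz.
have D1 := derive_tensor (delta_mx 0 i) (delta_mx 0 j) d1 d1 De1 De1.
have D2 := derive_tensor (delta_mx 0 i) (delta_mx 0 j) d2 d2 De2 De2.
apply: (etrans (deriveD (derivableD (dT _ df) (dT _ d1)) (dT _ d2))).
apply: (etrans (congr1 (fun a => a + _) (deriveD (dT _ df) (dT _ d1)))).
apply: (etrans (congr2 (fun a b => a + b) (congr2 (fun a b => a + b) D0 D1) D2)).
move: (dot ('D_v f z) (E1 z)) (dot ('D_v f z) (E2 z)) (dot ('D_v E1 z) (E2 z)).
move=> a b c; rewrite !mul0r oppr0 !scale0r !addr0 !dot_lin2.
by ring.
Qed.

End TotallyGeodesic.

(** * From charts to the connected orbit *)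

Section Atlas.
Context {R : realType} {n : nat}.
Local Notation E := 'rV[R]_2.
Local Notation V := 'rV[R]_n.+1.
Variables (M : set V) (B : atlas E V).
Implicit Types (i j : ix B) (x y : E) (g : 'M[R]_n.+1).

(** All that is used of the differentiable structure of G: each single element
    acts on the surface by maps differentiable in the charts. *)
Definition acts_smoothly g := forall i j x, dom B i x ->
  (par B j @` dom B j) (par B i x *m g) ->
  exists (O : set E) (phi : E -> E),
    [/\ open O, O x, O `<=` dom B i, forall y, O y -> differentiable phi y &
     forall y, O y -> dom B j (phi y) /\ par B j (phi y) = par B i y *m g].

Lemma acts_smoothly_id : smooth_map B B id -> acts_smoothly 1%:M.
Proof.
move=> h i j x Dx Px; rewrite mulmx1 in Px.
have [Y [phi [oY Yx YD sphi hphi]]] := h i j x Dx Px.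
exists Y, phi; split => // y Yy; first exact: smooth_differentiable sphi Yy.
by rewrite mulmx1; apply: hphi.
Qed.

Lemma acts_smoothly_group (k : nat) (G : set 'M[R]_n.+1)
  (A : atlas 'rV[R]_k 'M[R]_n.+1) g :
  immersed_submanifold G A -> G g ->
  smooth_map (prod_atlas A B) B (fun gx => gx.2 *m gx.1) -> acts_smoothly g.
Proof.
move=> [GA _ _ _] Gg h i j x Dx Px.
have [l _ [a Da ga]] : (\bigcup_i (par A i @` dom A i)) g by rewrite -GA.
have [|Y [phi [oY Yx YD sphi hphi]]] := h (l, i) j (a, x) (conj Da Dx).
  by rewrite /= ga.
pose s (y : E) : 'rV[R]_k * E := (a, y).
have ds y : differentiable s y.
  apply: differentiable_pair; first exact: differentiable_cst.
  by have [] := @is_diff_id R E y.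
exists (s @^-1` Y), (phi \o s); split => //.
- apply: open_comp => // y _; exact: differentiable_continuous.
- by move=> y /YD[].
- move=> y Yy; apply: differentiable_comp => //.
  exact: smooth_differentiable sphi Yy.
by move=> y /hphi; rewrite /= ga.
Qed.

Hypothesis imm : immersed_submanifold M B.
Hypothesis MS : M `<=` @sphere R n.
Hypothesis con : atlas_connected M B.

Lemma dom_open i : open (dom B i).
Proof. by have [_ /(_ i)[]] := imm. Qed.

Lemma par_smooth i : smooth_on (dom B i) (par B i).
Proof. by have [_ /(_ i)[]] := imm. Qed.

Lemma par_immersion i x : dom B i x -> injective ('d (par B i) x).
Proof. by have [_ _ h _] := imm; apply: h. Qed.

Lemma par_in i x : dom B i x -> M (par B i x).
Proof. by have [-> _ _ _] := imm; move=> Dx; exists i => //; exists x. Qed.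

Lemma par_onto q : M q -> exists i x, dom B i x /\ par B i x = q.
Proof. by have [-> _ _ _] := imm; move=> [i _ [x Dx <-]]; exists i, x. Qed.

Lemma par_sphere i x : dom B i x -> dot (par B i x) (par B i x) = 1.
Proof. by move=> /par_in/MS. Qed.

Lemma adapted_equivariant g i j x x' lam e1 e2 nu : g *m g^T = 1%:M ->
  acts_smoothly g -> dom B i x -> dom B j x' -> par B j x' = par B i x *m g ->
  adapted_frame (par B i) x lam e1 e2 nu ->
  adapted_frame (par B j) x' lam (e1 *m g) (e2 *m g) (nu *m g).
Proof.
move=> go ag Dx Dx' xx' ad.
have [|Y [phi [oY Yx YD dphi hphi]]] := ag i j x Dx; first by exists x'.
have -> : x' = phi x.
  have [_ /(_ j)[_ _ inj] _ _] := imm; have [Dphi pE] := hphi x Yx.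
  by apply: inj; rewrite ?inE // pE.
apply: (@adapted_transition R n (par B i) (par B j) (dom B i) (dom B j) _ _ _ _ _ _
  g Y phi go oY YD dphi _ _ x lam e1 e2 nu Yx ad).
- exact: par_smooth.
- exact: par_immersion.
- exact: dom_open.
- exact: par_smooth.
- exact: par_immersion.
- exact: par_sphere.
- by move=> y /hphi[].
- by move=> y /hphi[].
Qed.

(** The points with the property and those without it both form open sets.
    Frames are expressed in charts, and so is P; hence the compatibility
    hypothesis on overlaps. *)
Lemma connected_propagation (P : ix B -> E -> Prop) i0 x0 :
  (forall i j x x', dom B i x -> dom B j x' -> par B i x = par B j x' ->
     P i x -> P j x') ->
  (forall i x, dom B i x -> exists e, [/\ 0 < e, ball x e `<=` dom B i &
     forall y, ball x e y -> (P i y <-> P i x)]) ->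
  dom B i0 x0 -> P i0 x0 ->
  forall i x, dom B i x -> P i x.
Proof.
move=> Pinv Ploc D0 P0.
pose X := [set q | exists i x, [/\ dom B i x, par B i x = q & P i x]].
have XM : X `<=` M by move=> q [i [x [Dx <- _]]]; apply: par_in.
have XP i x : dom B i x -> X (par B i x) -> P i x.
  by move=> Dx [j [x' [Dx' e Px']]]; apply: Pinv e Px'.
have XO : atlas_open B X.
  move=> i; rewrite openE => x [Dx Xx]; apply/nbhs_ballP.
  have [e [e0 eD eP]] := Ploc i x Dx; exists e => // y By.
  split; first exact: eD.
  by exists i, y; split => //; [exact: eD|apply/(eP y By)/XP].
have XO' : atlas_open B (M `\` X).
  move=> i; rewrite openE => x [Dx [_ nXx]]; apply/nbhs_ballP.
  have [e [e0 eD eP]] := Ploc i x Dx; exists e => // y By.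
  split; first exact: eD.
  split; first exact: (par_in (eD y By)).
  move=> /(XP i y (eD y By))/(eP y By) Px; apply: nXx.
  by exists i, x.
have [X0|XM'] := con XM XO XO'.
  have : X (par B i0 x0) by exists i0, x0.
  by rewrite X0.
by move=> i x Dx; apply: XP => //; rewrite XM'; apply: par_in.
Qed.

End Atlas.

Section SignedSwaps.
Context {R : realType} {n : nat}.
Local Notation E := 'rV[R]_2.
Local Notation V := 'rV[R]_n.+1.
Implicit Types (J K : 'M[R]_n.+1 * 'M[R]_n.+1).

(** The ambiguity of the pair of bivectors at a point. *)
Definition signed_swaps J : seq ('M[R]_n.+1 * 'M[R]_n.+1) :=
  [:: (J.1, J.2); (- J.1, J.2); (J.1, - J.2); (- J.1, - J.2);
      (J.2, J.1); (- J.2, J.1); (J.2, - J.1); (- J.2, - J.1)].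

Variables (f : E -> V) (U : set E).
Hypotheses (oU : open U) (sf : smooth_on U f).
Hypothesis (fI : forall x, U x -> injective ('d f x)).
Hypothesis (fS : forall x, U x -> dot (f x) (f x) = 1).

Lemma torus_frame_swaps x J K : U x -> torus_frame f x J ->
  torus_frame f x K <-> K \in signed_swaps J.
Proof.
move=> Ux tJ; split=> [tK|].
  rewrite !inE; have [] := torus_frame_unique Ux tJ tK.
    by case=> ->; rewrite eqxx ?orbT.
  by case=> ->; rewrite eqxx ?orbT.
have opp1 L : torus_frame f x L -> torus_frame f x (- L.1, L.2).
  move=> [e1 [e2 [nu [ad ->]]]]; exists (- e1), e2, nu; split.
    exact: (adapted_opp1 sf Ux ad).
  by rewrite wedgeNr.
have opp2 L : torus_frame f x L -> torus_frame f x (L.1, - L.2).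
  move=> [e1 [e2 [nu [ad ->]]]]; exists e1, (- e2), nu; split.
    exact: (adapted_opp2 sf Ux ad).
  by rewrite wedgeNr.
have swap L : torus_frame f x L -> torus_frame f x (- L.2, - L.1).
  move=> [e1 [e2 [nu [ad ->]]]]; exists e2, e1, (- nu); split.
    exact: (adapted_swap Ux ad).
  by rewrite /= -!wedgeNl opprD opprB (addrC (f x)).
have oo L : torus_frame f x L -> torus_frame f x (- L.1, - L.2).
  by move=> /opp1/opp2.
have {}swap L : torus_frame f x L -> torus_frame f x (L.2, L.1).
  by move=> /swap/oo; rewrite /= !opprK.
case: J tJ => J1 J2 tJ; rewrite !inE /=.
move=> /orP[|/orP[|/orP[|/orP[|/orP[|/orP[|/orP[|]]]]]]] /eqP ->.
- exact: tJ.
- exact: (opp1 _ tJ).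
- exact: (opp2 _ tJ).
- exact: (oo _ tJ).
- exact: (swap _ tJ).
- exact: (opp1 _ (swap _ tJ)).
- exact: (opp2 _ (swap _ tJ)).
- exact: (oo _ (swap _ tJ)).
Qed.

End SignedSwaps.

Section Homogeneous.
Context {R : realType} {n : nat}.
Local Notation E := 'rV[R]_2.
Local Notation V := 'rV[R]_n.+1.
Variables (M : set V) (B : atlas E V).

Lemma orthonormal_equator (a b c : V) :
  dot a a = 1 -> dot b b = 1 -> dot c c = 1 ->
  dot a b = 0 -> dot a c = 0 -> dot b c = 0 ->
  M `<=` @sphere R n -> (forall q, M q -> q *m projector3 a b c = q) ->
  equatorial M.
Proof.
move=> aa bb cc ab ac bc MS Mq.
exists (@sphere R n `&` [set x | x \in <<[:: a; b; c]>>%VS]); last first.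
  move=> q q_in_M; split; first exact: MS.
  rewrite /= -(Mq q q_in_M) mul_projector3.
  by rewrite !rpredD // rpredZ // memv_span // !inE eqxx ?orbT.
exists <<[:: a; b; c]>>%VS; split => //.
have : free [tuple a; b; c].
  apply/freeP => k.
  rewrite !big_ord_recl big_ord0 /= addr0 => k0 i.
  have ka := congr1 (fun z => dot z a) k0.
  have kb := congr1 (fun z => dot z b) k0.
  have kc := congr1 (fun z => dot z c) k0.
  rewrite !dotDl !dotZl !dot0l aa (dotC b a) ab (dotC c a) ac in ka.
  rewrite !dotDl !dotZl !dot0l bb ab (dotC c b) bc in kb.
  rewrite !dotDl !dotZl !dot0l cc ac bc in kc.
  rewrite !mulr0 !mulr1 !addr0 ?add0r in ka kb kc.
  case: i => [[|[|[|//]]]] hi.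
  - by rewrite -[RHS]ka; congr k; apply: val_inj.
  - by rewrite -[RHS]kb; congr k; apply: val_inj.
  - by rewrite -[RHS]kc; congr k; apply: val_inj.
by rewrite /free => /eqP ->.
Qed.

Hypotheses (hn : (3 <= n)%N) (hhom : homogeneous_surface M B).
Hypotheses (hmin : minimal B) (hflat : flat_normal_connection B).

(** One principal frame, at p, is moved by G to every point, so the principal
    curvature lam is constant. If lam = 0 the projector on the span of
    position and tangent plane is constant, which is the equatorial case.
    Otherwise lam = 1 and the pair of bivectors is locally constant up to
    signed swaps, hence a torus frame for the same J everywhere. An element of
    G moves the torus frame at p to one at another point, so it preserves J up
    to a signed swap. *)
Lemma homogeneous_torus_frame : ~ equatorial M ->
  exists (G : set 'M[R]_n.+1) (p : V) (J : 'M[R]_n.+1 * 'M[R]_n.+1),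
  [/\ (forall g, G g -> g *m g^T = 1%:M) /\
      [/\ G 1%:M, forall g h, G g -> G h -> G (g *m h) &
          forall g, G g -> G (invmx g)],
      M = [set p *m g | g in G],
      forall i x, dom B i x -> torus_frame (par B i) x J &
      forall g, G g -> (g^T *m J.1 *m g, g^T *m J.2 *m g) \in signed_swaps J].
Proof.
move=> hneq; have [MS imm con [k [G [A [[GO Gg immG _ _] [p Mp] act]]]]] := hhom.
have [G1 GM GV] := Gg.
have Mpp : M p by rewrite Mp; exists 1%:M => //; rewrite mulmx1.
have [i0 [x0 [D0 p0]]] := par_onto imm Mpp.
have sm i : smooth_on (dom B i) (par B i) := par_smooth imm i.
have im i := @par_immersion R n M B imm i.
have sp i := @par_sphere R n M B imm MS i.
have od i := dom_open imm i.
have [_ _ _ trans] := imm; have aid := acts_smoothly_id trans.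
have flat i zeta : normal_field (par B i) (dom B i) zeta ->
    forall v w y, dom B i y -> normal_curvature (par B i) v w zeta y = 0.
  by move=> nf; apply: (hflat (od i)).
have [lam [a1 [a2 [m [l0 ad0]]]]] := adapted_frame_exists (od i0) (sm i0)
  (im i0) (sp i0) hn D0 (hmin D0) (flat i0).
have equi g i j x x' lam' e1 e2 nu : G g -> dom B i x -> dom B j x' ->
    par B j x' = par B i x *m g -> adapted_frame (par B i) x lam' e1 e2 nu ->
    adapted_frame (par B j) x' lam' (e1 *m g) (e2 *m g) (nu *m g).
  move=> GG Dx Dx' xx'; apply: (adapted_equivariant imm MS (GO g GG)) xx' => //.
  exact: acts_smoothly_group immG GG act.
have same i j x x' lam' e1 e2 nu : dom B i x -> dom B j x' ->
    par B i x = par B j x' -> adapted_frame (par B i) x lam' e1 e2 nu ->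
    adapted_frame (par B j) x' lam' e1 e2 nu.
  move=> Dx Dx' xx' ad; rewrite -[e1]mulmx1 -[e2]mulmx1 -[nu]mulmx1.
  by apply: equi ad => //; rewrite mulmx1.
have all i x : dom B i x -> exists e1 e2 nu, adapted_frame (par B i) x lam e1 e2 nu.
  move=> Dx; have : M (par B i x) := par_in imm Dx.
  rewrite Mp => -[g GG xE]; exists (a1 *m g), (a2 *m g), (m *m g).
  by apply: equi ad0 => //; rewrite p0.
have [lam0|lamN0] := eqVneq lam 0.
  rewrite {}lam0 in all ad0 l0; exfalso; apply: hneq.
  have [fr0 _ _ _] := ad0; have [[a11 a22 a12] _ _ _] := fr0.
  have [h1 h2] := frame_orth (od i0) (sm i0) (sp i0) D0 fr0.
  pose Q := projector3 (par B i0 x0) a1 a2.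
  apply: (orthonormal_equator (sp i0 x0 D0) a11 a22 h1 h2 a12 MS) => q q_in_M.
  have [i [x [Dx <-]]] := par_onto imm q_in_M.
  suff : in_plane (par B i) Q x by case.
  apply: (connected_propagation imm con
    (P := fun i x => in_plane (par B i) Q x) _ _ D0 _ Dx); last first.
  - exact: (frame_in_plane (od i0) (sm i0) (sp i0) D0 fr0).
  - move=> i' x' Dx'.
    have [E1 [E2 [e [e0 eD eP]]]] := projector_local (od i') (sm i') (im i')
       (sp i') Dx' (all i').
    exists e; split => // y By.
    have [fry Ky] := eP y By; have [frx _] := eP x' (ballxx x' e0).
    have hy := in_planeP (od i') (sm i') (sp i') Q (eD y By) fry.
    have hx := in_planeP (od i') (sm i') (sp i') Q Dx' frx.
    by rewrite hy hx Ky.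
  move=> i1 i2 x1 x2 D1 D2 e12 h.
  have [e1 [e2 [nu ad]]] := all i1 x1 D1.
  have [fr1 _ _ _] := ad; have [fr2 _ _ _] := same _ _ _ _ _ _ _ _ D1 D2 e12 ad.
  apply/(in_planeP (od i2) (sm i2) (sp i2) Q D2 fr2); rewrite -e12.
  exact/(in_planeP (od i1) (sm i1) (sp i1) Q D1 fr1).
have {}l0 : 0 < lam by rewrite lt_def lamN0.
have [lam1 _] := torus_frame_local (od i0) (sm i0) (im i0) (sp i0) l0 D0 (all i0).
rewrite {}lam1 in l0 ad0 all.
pose J := (wedge (m - par B i0 x0) a1, wedge (m + par B i0 x0) a2).
have allJ i x : dom B i x -> torus_frame (par B i) x J.
  move=> Dx; apply: (connected_propagation imm con
    (P := fun i x => torus_frame (par B i) x J) _ _ D0 _ Dx); last first.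
  - by exists a1, a2, m.
  - move=> i' x' Dx'; have [_ [e [J0 [e0 eD eP]]]] := torus_frame_local (od i')
      (sm i') (im i') (sp i') l0 Dx' (all i').
    exists e; split => // y By.
    have hy := torus_frame_swaps (sm i') J (eD y By) (eP y By).
    have hx := torus_frame_swaps (sm i') J Dx' (eP x' (ballxx x' e0)).
    by rewrite hy hx.
  move=> i1 i2 x1 x2 D1 D2 e12 [e1 [e2 [nu [ad ->]]]].
  exists e1, e2, nu; split; first exact: same D1 D2 e12 ad.
  by rewrite e12.
exists G, p, J; split => // g GG.
have Mpg : M (p *m g) by rewrite Mp; exists g.
have [j [x' [Dx' xE]]] := par_onto imm Mpg.
apply/(torus_frame_swaps (sm j) _ Dx' (allJ j x' Dx')).
exists (a1 *m g), (a2 *m g), (m *m g); split.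
  by apply: equi ad0 => //; rewrite p0.
have wg (a b : V) : g^T *m wedge a b *m g = wedge (a *m g) (b *m g).
  by rewrite /wedge mulmxBr mulmxBl !trmx_mul !mulmxA.
by rewrite /= !wg xE p0 !mulmxBl !mulmxDl.
Qed.

End Homogeneous.

(** * Nearest points on a chart *)

Section NearestPoint.
Context {R : realType} {k N : nat}.
Local Notation E := 'rV[R]_k.
Local Notation V := 'rV[R]_N.
Variables (f : E -> V) (U : set E).
Hypotheses (oU : open U) (sf : smooth_on U f) (finj : set_inj U f).

Lemma compact_closed_ball (x : E) (r : R) : compact (closed_ball_ Num.norm x r).
Proof.
apply: bounded_closed_compact; last exact: closed_closed_ball_.
exists (`|x| + r); split; first exact: num_real.
move=> z hz y hy; apply: le_trans (ltW hz).
have -> : y = x - (x - y) by rewrite opprB addrC subrK.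
by apply: (le_trans (ler_normB _ _)); rewrite lerD2l.
Qed.

Lemma compact_sphere (x : E) (r : R) : compact [set y : E | `|x - y| = r].
Proof.
have S_closed : closed [set y : E | `|x - y| = r].
  rewrite [X in closed X](_ : _ = (fun y : E => `|x - y|) @^-1` [set r]) //.
  apply: closed_comp; last exact: closed_eq.
  move=> y _; apply: (@continuous_comp _ _ _ (fun y : E => x - y) Num.norm).
    by apply: continuousB; [exact: cst_continuous|].
  exact: norm_continuous.
apply: (subclosed_compact S_closed (compact_closed_ball (x := x) (r := r))).
by move=> y /= e; rewrite /closed_ball_ /= e.
Qed.

Lemma smooth_within (A : set E) (h : E -> R) : A `<=` U -> smooth_on U h ->
  {within A, continuous h}.
Proof.
move=> AU sh; apply: continuous_in_subspaceT => y; rewrite inE => /AU Uy.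
exact: smooth_continuous sh Uy.
Qed.

Let h q (y : E) := dot (f y - q) (f y - q).

Lemma smooth_subst q : smooth_on U (fun y => f y - q).
Proof. exact: (smoothB oU sf (@smooth_cst _ _ V U q)). Qed.

Lemma smooth_dist q : smooth_on U (h q).
Proof. exact: (smooth_dot oU (smooth_subst q) (smooth_subst q)). Qed.

Lemma derive_dist q y v : U y -> 'D_v (h q) y = 2 * dot (f y - q) ('D_v f y).
Proof.
move=> Uy; have df := smooth_differentiable sf Uy.
have dq : differentiable (fun=> q) y := differentiable_cst q y.
have e : 'D_v (fun z => f z - q) y = 'D_v f y.
  apply: (etrans (deriveB (diff_derivable df) (diff_derivable dq))).
  apply: (etrans (congr1 (fun a => _ - a) (derive_cst q y v))).
  by rewrite subr0.
have dfq := smooth_differentiable (smooth_subst q) Uy.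
apply: (etrans (derive_dot v dfq dfq)).
apply: (etrans (congr2 (fun a b => dot a (f y - q) + dot (f y - q) b) e e)).
by rewrite [X in X + _]dotC mulr_natl mulr2n.
Qed.

(** Minimize the distance to q over a closed coordinate ball. On its boundary
    f keeps a positive distance from f x0, by injectivity and compactness, so
    for q close to f x0 the minimum is interior and hence critical. *)
Lemma nearest_point x0 : U x0 -> exists2 m, 0 < m &
  forall q, dot (f x0 - q) (f x0 - q) < m ->
  exists c, [/\ U c, forall v, dot (f c - q) ('D_v f c) = 0 &
    dot (f c - q) (f c - q) <= dot (f x0 - q) (f x0 - q)].
Proof.
move=> Ux0; have /nbhs_ballP[e /= e0 eU] : nbhs x0 U by exact: open_near oU Ux0.
pose r := e / 2; have r0 : 0 < r by rewrite divr_gt0.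
have rU : closed_ball_ Num.norm x0 r `<=` U.
  move=> y /= hy; apply: eU; rewrite -ball_normE /=.
  by apply: (le_lt_trans hy); rewrite /r; lra.
pose S := [set y : E | `|x0 - y| = r].
have SU : S `<=` U by move=> y /= hy; apply: rU; rewrite /closed_ball_ /= hy.
have [m m0 mS] : exists2 m, 0 < m & forall y, S y -> m <= h (f x0) y.
  have [S0|/set0P/negP/negPn/eqP S0] := pselect (S !=set0); last first.
    by exists 1 => // y; rewrite S0.
  have [c cS cm] := compact_EVT_min S0 (@compact_sphere x0 r)
    (smooth_within SU (smooth_dist (f x0))).
  rewrite inE in cS; exists (h (f x0) c).
    rewrite dot_gt0 subr_eq0; apply/eqP => fc.
    have cx0 : c = x0 by apply: finj => //; rewrite inE //; apply: SU.
    by move: cS; rewrite /S /= cx0 subrr normr0 => re; move: r0; rewrite -re ltxx.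
  by move=> y Sy; apply: cm; rewrite inE.
exists (m / 4); first by rewrite divr_gt0.
move=> q qm.
have K0 : closed_ball_ Num.norm x0 r !=set0.
  by exists x0; rewrite /closed_ball_ /= subrr normr0 ltW.
have [c cK cm] := compact_EVT_min K0 (@compact_closed_ball x0 r)
  (smooth_within rU (smooth_dist q)).
rewrite inE in cK.
have hc : h q c <= h q x0.
  by apply: cm; rewrite inE /closed_ball_ /= subrr normr0 ltW.
have cr : `|x0 - c| < r.
  rewrite lt_neqAle cK andbT; apply/eqP => cS; have := mS c cS.
  apply/negP; rewrite -ltNge.
  (* The parallelogram law keeps a boundary point that is close to q close to
     f x0. *)
  have parallelogram : h (f x0) c <= 2 * h q c + 2 * h q x0.
    have -> : h (f x0) c = 2 * h q c + 2 * h q x0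
       - dot ((f c - q) + (f x0 - q)) ((f c - q) + (f x0 - q)).
      rewrite /h; have -> : f c - f x0 = (f c - q) - (f x0 - q).
        by rewrite opprB addrA subrK.
      move: (f c - q) (f x0 - q) => a b.
      by rewrite !(dotDl, dotDr, dotNl, dotNr) (dotC b a); ring.
    by rewrite gerBl dot_ge0.
  apply: (le_lt_trans parallelogram); rewrite -/(h q x0) in qm; move: hc qm; clear.
  by move: (h q c) (h q x0) => a b; lra.
have Uc := rU c cK; exists c; split => // v.
pose d := r - `|x0 - c|; have d0 : 0 < d by rewrite subr_gt0.
(* The line through the interior minimum c stays in the disc for parameters
   smaller than b. *)
pose b := d / (1 + `|v|).
have v1 : 0 < 1 + `|v| by rewrite ltr_pwDl.
have b0 : 0 < b by rewrite divr_gt0.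
have line t : t \in `](- b), b[%R -> closed_ball_ Num.norm x0 r (c + t *: v).
  rewrite in_itv /= => /andP[tb1 tb2]; rewrite /closed_ball_ /=.
  have -> : x0 - (c + t *: v) = (x0 - c) - t *: v by rewrite opprD addrA.
  apply: (le_trans (ler_normB _ _)); rewrite -lerBrDl -/d normrZ.
  have tb : `|t| <= b by rewrite ler_norml !ltW.
  apply: (le_trans (ler_wpM2r (normr_ge0 v) tb)).
  rewrite /b mulrAC ler_pdivrMr // ler_pM2l //.
  by rewrite lerDr.
pose g t := h q (c + t *: v).
have dg t : t \in `](- b), b[%R -> is_derive t 1 g ('D_v (h q) (c + t *: v)).
  move=> /line/rU Uy; apply: is_derive_line; apply: diff_derivable.
  exact: smooth_differentiable (smooth_dist q) Uy.
have zb : (0 : R) \in `](- b), b[%R by rewrite in_itv /= oppr_lt0 b0.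
have bb : - b <= b by rewrite ge0_cp // ltW.
have gmin : is_derive (0 : R) 1 g 0.
  apply: (derive1_at_min bb _ zb) => [t /dg[]//|t /line tK].
  by rewrite /g scale0r addr0; apply: cm; rewrite inE.
have : 'D_v (h q) (c + 0 *: v) = 0.
  by have [_ <-] := dg 0 zb; have [_ ->] := gmin.
rewrite scale0r addr0 => D0; have := etrans (esym (derive_dist q v Uc)) D0.
by move/eqP; rewrite mulf_eq0 pnatr_eq0 => /eqP.
Qed.

End NearestPoint.

(** * The torus of two orthogonal planes *)

Lemma unit_circle_angle {R : realType} (x y : R) : x ^+ 2 + y ^+ 2 = 1 ->
  exists t, x = cos t /\ y = sin t.
Proof.
move=> xy.
have x1 : -1 <= x <= 1.
  rewrite -ler_norml -(expr_le1 (n := 2)) // real_normK ?num_real // -xy lerDl.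
  exact: sqr_ge0.
have cx : cos (acos x) = x by apply: acosK; rewrite in_itv.
have : y ^+ 2 == sin (acos x) ^+ 2.
  by rewrite sin2cos2 cx -xy addrC addKr.
rewrite eqf_sqr => /orP[/eqP yE|/eqP yE]; first by exists (acos x).
by exists (- acos x); rewrite cosN sinN.
Qed.

Section TorusPoint.
Context {R : realType} {n : nat}.
Local Notation E := 'rV[R]_2.
Local Notation V := 'rV[R]_n.+1.
Implicit Types (q z : V) (s t al be : R).

Lemma mul_wedge z (a b : V) : z *m wedge a b = dot z a *: b - dot z b *: a.
Proof. by rewrite /wedge mulmxBr !mulmxA !dot11 !mul_scalar_mx. Qed.

Lemma dot_wedge_self z (a b : V) : dot z (z *m wedge a b) = 0.
Proof. by rewrite mul_wedge dotDr dotNr !dotZr mulrC subrr. Qed.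

Definition orthonormal_pair (a b : V) := [/\ dot a a = 1, dot b b = 1 & dot a b = 0].

Variables (a1 a2 b1 b2 : V).
Hypotheses (oa : orthonormal_pair a1 a2) (ob : orthonormal_pair b1 b2).
Hypotheses (ab11 : dot a1 b1 = 0) (ab12 : dot a1 b2 = 0)
  (ab21 : dot a2 b1 = 0) (ab22 : dot a2 b2 = 0).

Definition torus_point s t : V := (Num.sqrt 2)^-1 *:
  (cos s *: a1 + sin s *: a2 + (cos t *: b1 + sin t *: b2)).

Let dots : [/\ dot a1 a1 = 1, dot a2 a2 = 1, dot b1 b1 = 1 & dot b2 b2 = 1].
Proof. by have [? ? _] := oa; have [? ? _] := ob. Qed.

Let dots0 : ((dot a1 a2 = 0) * (dot a2 a1 = 0) * (dot b1 b2 = 0) * (dot b2 b1 = 0) *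
  (dot b1 a1 = 0) * (dot b2 a1 = 0) * (dot b1 a2 = 0) * (dot b2 a2 = 0))%type.
Proof.
have [_ _ a12] := oa; have [_ _ b12] := ob.
by rewrite (dotC a2) (dotC b2 b1) !(dotC b1 _) !(dotC b2 _).
Qed.

Lemma inv_sqrt2_sqr : (Num.sqrt 2)^-1 * (Num.sqrt 2)^-1 = 2^-1 :> R.
Proof. by rewrite -invfM -expr2 sqr_sqrtr. Qed.

Lemma torus_point_coords s t :
  [/\ dot (torus_point s t) a1 = (Num.sqrt 2)^-1 * cos s,
      dot (torus_point s t) a2 = (Num.sqrt 2)^-1 * sin s,
      dot (torus_point s t) b1 = (Num.sqrt 2)^-1 * cos t &
      dot (torus_point s t) b2 = (Num.sqrt 2)^-1 * sin t].
Proof.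
have [h1 h2 h3 h4] := dots.
rewrite /torus_point !(dotDl, dotZl) h1 h2 h3 h4 !dots0 ab11 ab12 ab21 ab22.
by rewrite !(mulr0, mulr1, addr0, add0r).
Qed.

Lemma dot_torus_points s t s' t' : dot (torus_point s t) (torus_point s' t') =
  2^-1 * (cos (s - s') + cos (t - t')).
Proof.
rewrite {2}/torus_point !(dotDr, dotZr).
have [-> -> -> ->] := torus_point_coords s t.
by rewrite !cosB -inv_sqrt2_sqr; ring.
Qed.

Lemma torus_point_dist s t s' t' :
  dot (torus_point s t - torus_point s' t') (torus_point s t - torus_point s' t') =
  2 - cos (s - s') - cos (t - t').
Proof.
rewrite !(dotDl, dotDr, dotNl, dotNr) !dot_torus_points !subrr !cos0.
have -> : s' - s = - (s - s') by rewrite opprB.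
have -> : t' - t = - (t - t') by rewrite opprB.
by rewrite !cosN; field.
Qed.

Lemma dot_torus_wedge1 s t s' t' :
  dot (torus_point s t) (torus_point s' t' *m wedge a1 a2) = 2^-1 * sin (s - s').
Proof.
rewrite mul_wedge dotDr dotNr !dotZr.
have [-> -> _ _] := torus_point_coords s t.
have [-> -> _ _] := torus_point_coords s' t'.
by rewrite sinB -inv_sqrt2_sqr; ring.
Qed.

Lemma dot_torus_wedge2 s t s' t' :
  dot (torus_point s t) (torus_point s' t' *m wedge b1 b2) = 2^-1 * sin (t - t').
Proof.
rewrite mul_wedge dotDr dotNr !dotZr.
have [_ _ -> ->] := torus_point_coords s t.
have [_ _ -> ->] := torus_point_coords s' t'.
by rewrite sinB -inv_sqrt2_sqr; ring.
Qed.

Lemma torus_point_eq s t s' t' : cos s = cos s' -> sin s = sin s' ->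
  cos t = cos t' -> sin t = sin t' -> torus_point s t = torus_point s' t'.
Proof. by rewrite /torus_point => -> -> -> ->. Qed.

Lemma torus_point_inj s t s' t' : torus_point s t = torus_point s' t' ->
  [/\ cos s = cos s', sin s = sin s', cos t = cos t' & sin t = sin t'].
Proof.
move=> e; have [h1 h2 h3 h4] := torus_point_coords s t.
have [h1' h2' h3' h4'] := torus_point_coords s' t'; rewrite -e in h1' h2' h3' h4'.
have k0 : (Num.sqrt 2)^-1 != 0 :> R by rewrite invr_eq0 gt_eqF // sqrtr_gt0.
by split; apply: (mulfI k0); rewrite -?h1 -?h2 -?h3 -?h4.
Qed.

Lemma dot_mul_wedge_self q (a b : V) : orthonormal_pair a b ->
  dot (q *m wedge a b) (q *m wedge a b) = dot q a ^+ 2 + dot q b ^+ 2.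
Proof.
move=> [aa bb ab]; rewrite mul_wedge !(dotDl, dotDr, dotNl, dotNr, dotZl, dotZr).
by rewrite aa bb (dotC b a) ab; ring.
Qed.

Lemma mul_wedge_sqr q (a b : V) : orthonormal_pair a b ->
  q *m wedge a b *m wedge a b = - (dot q a *: a + dot q b *: b).
Proof.
move=> [aa bb ab]; rewrite (mul_wedge q) mulmxBl -!scalemxAl !mul_wedge.
rewrite aa bb (dotC b a) ab !scale0r !scale1r sub0r subr0.
by rewrite scalerN opprD.
Qed.

Variables (c1 c2 : R).
Hypotheses (c1E : c1 ^+ 2 = 2) (c2E : c2 ^+ 2 = 2).
Let J : 'M[R]_n.+1 * 'M[R]_n.+1 := (c1 *: wedge a1 a2, c2 *: wedge b1 b2).

(** J.1 and J.2 are quarter turns, scaled by sqrt 2, on their planes and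
    vanish on the orthogonal complements, so the hypotheses say that q is the
    sum of its components in the two planes and that both have length 1/sqrt
    2. *)
Lemma torus_point_onto q :
  dot (q *m J.1) (q *m J.1) = 1 -> dot (q *m J.2) (q *m J.2) = 1 ->
  q = - (2^-1 *: (q *m J.1 *m J.1 + q *m J.2 *m J.2)) ->
  exists s t, q = torus_point s t.
Proof.
have sq2 : Num.sqrt 2 ^+ 2 = 2 :> R by rewrite sqr_sqrtr.
rewrite /= -!scalemxAr !dotZl !dotZr -!scalemxAl !scalerA !mulrA -!expr2 c1E c2E.
rewrite !dot_mul_wedge_self // !mul_wedge_sqr // => h1 h2 qE.
have [s [cs ss]] : exists s, Num.sqrt 2 * dot q a1 = cos s /\ Num.sqrt 2 * dot q a2 = sin s.
  by apply: unit_circle_angle; rewrite !exprMn sq2 -mulrDr.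
have [t [ct st]] : exists s, Num.sqrt 2 * dot q b1 = cos s /\ Num.sqrt 2 * dot q b2 = sin s.
  by apply: unit_circle_angle; rewrite !exprMn sq2 -mulrDr.
exists s, t; rewrite {1}qE /torus_point -cs -ss -ct -st.
have k0 : Num.sqrt 2 != 0 :> R by rewrite gt_eqF // sqrtr_gt0.
rewrite -!scalerA -!scalerDr !scalerA mulVf // scale1r.
by rewrite -opprD opprK mulVf // scale1r.
Qed.

(** In the frame, f J.1 = - e1 and f J.2 = e2, while e1 J.1 = f - nu and e2
    J.2 = - (f + nu). So the position lies on the torus of the two planes, and
    its tangent directions there are tangent to the surface. *)
Lemma torus_frame_point (f : E -> V) (U : set E) x :
  open U -> smooth_on U f -> (forall x, U x -> dot (f x) (f x) = 1) -> U x ->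
  torus_frame f x J -> let q := f x in
  [/\ exists s t, q = torus_point s t, exists u, 'D_u f x = q *m J.1 &
      exists u, 'D_u f x = q *m J.2].
Proof.
move=> oU sf fS Ux [e1 [e2 [nu [ad [J1 J2]]]]] q.
have [fr [n0 nv] nn _] := ad; have [[e11 e22 e12] [u1 E1] [u2 E2] _] := fr.
have [f1 f2] := frame_orth oU sf fS Ux fr; have qq := fS x Ux.
have [_ n1 n2] : [/\ dot nu (f x) = 0, dot nu e1 = 0 & dot nu e2 = 0].
  by split=> //; [rewrite -E1|rewrite -E2]; apply: nv.
rewrite -/q in f1 f2 qq n0 J1 J2.
have qJ1 : q *m J.1 = - e1.
  rewrite /= J1 mul_wedge f1 scale0r subr0 dotDr dotNr (dotC q nu) n0 qq.
  by rewrite sub0r scaleN1r.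
have qJ2 : q *m J.2 = e2.
  rewrite /= J2 mul_wedge f2 scale0r subr0 dotDr (dotC q nu) n0 qq.
  by rewrite add0r scale1r.
split; last 2 first.
- by exists (- u1); rewrite qJ1 -E1; apply: derive_opp Ux.
- by exists u2; rewrite qJ2.
have h1 : - e1 *m J.1 = nu - q.
  rewrite mulNmx /= J1 mul_wedge e11 dotDr dotNr (dotC e1 nu) (dotC e1 q) n1 f1.
  by rewrite subrr scale0r sub0r opprK scale1r.
have h2 : e2 *m J.2 = - (nu + q).
  rewrite /= J2 mul_wedge e22 dotDr (dotC e2 nu) (dotC e2 q) n2 f2.
  by rewrite addr0 scale0r sub0r scale1r.
apply: torus_point_onto; rewrite ?qJ1 ?h1 ?qJ2 ?h2 ?dotNl ?dotNr ?opprK //.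
have -> : nu - q - (nu + q) = (- (2)) *: q.
  by rewrite scaleNr scaler_nat mulr2n !opprD addrACA subrr add0r.
by rewrite scalerA mulrN mulVf ?pnatr_eq0 // scaleN1r opprK.
Qed.

End TorusPoint.

(** * The orbit fills the torus *)

Lemma cos_near0 {R : realType} (e : R) : 0 < e ->
  exists2 d : R, 0 < d & forall t, `|t| < d -> 1 - cos t < e.
Proof.
move=> e0; have := @continuous_cos R 0 => /cvgrPdist_lt/(_ e e0)/nbhs_ballP[d /= d0 h].
exists d => // t td; have := h t; rewrite /ball /= sub0r normrN => /(_ td).
by rewrite cos0; apply: le_lt_trans; apply: ler_norm.
Qed.

Lemma sin_eq0_cos {R : realType} (t : R) : sin t = 0 -> cos t = 1 \/ cos t = -1.
Proof.
move=> s0; have := cos2Dsin2 t; rewrite s0 expr0n addr0 => /eqP.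
by rewrite sqrf_eq1 => /orP[/eqP|/eqP]; [left|right].
Qed.

Lemma cos_sum_close {R : realType} (x y : R) : x <= 1 -> y <= 1 ->
  2 - x - y < 1 -> x != -1 /\ y != -1.
Proof. by move=> x1 y1 h; split; apply/eqP => e; subst; lra. Qed.

(** A number of subdivisions of a small angle pair: at least 8, so that the
    multiples up to the eighth stay small, and divisible by whatever number
    the pigeonhole principle on the eight signed swaps returns. *)
Lemma common_multiple8 : exists2 f8, (8 <= f8)%N &
  forall m, (0 < m <= 8)%N -> (m %| f8)%N.
Proof. by exists 840%N => // -[|[|[|[|[|[|[|[|[|m]]]]]]]]]. Qed.

Section TorusNeighborhood.
Context {R : realType} {n : nat}.
Local Notation E := 'rV[R]_2.
Local Notation V := 'rV[R]_n.+1.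
Variables (a1 a2 b1 b2 : V).
Hypotheses (oa : orthonormal_pair a1 a2) (ob : orthonormal_pair b1 b2).
Hypotheses (ab11 : dot a1 b1 = 0) (ab12 : dot a1 b2 = 0)
  (ab21 : dot a2 b1 = 0) (ab22 : dot a2 b2 = 0).
Variables (c1 c2 : R).
Hypotheses (c1E : c1 ^+ 2 = 2) (c2E : c2 ^+ 2 = 2).
Let J : 'M[R]_n.+1 * 'M[R]_n.+1 := (c1 *: wedge a1 a2, c2 *: wedge b1 b2).
Local Notation T := (torus_point a1 a2 b1 b2).

Let c1N0 : c1 != 0.
Proof. by rewrite -sqrf_eq0 c1E pnatr_eq0. Qed.

Let c2N0 : c2 != 0.
Proof. by rewrite -sqrf_eq0 c2E pnatr_eq0. Qed.

(** The surface lies in the torus and has the same dimension, but its own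
    topology might be finer. For a point q of the torus near p take a nearest
    point of the chart: criticality in the two torus directions makes both
    sines of the angle differences vanish, and closeness excludes the
    antipodal angles. So q is the nearest point itself. *)
Lemma torus_neighborhood (f : E -> V) (U : set E) x0 :
  open U -> smooth_on U f -> set_inj U f ->
  (forall x, U x -> dot (f x) (f x) = 1) -> U x0 -> f x0 = T 0 0 ->
  (forall x, U x -> torus_frame f x J) ->
  exists2 d : R, 0 < d & forall s t, `|s| < d -> `|t| < d ->
    exists c, U c /\ f c = T s t.
Proof.
move=> oU sf finj fS Ux0 fx0 tf.
have [m m0 mP] := nearest_point oU sf finj Ux0.
have [|d d0 dP] := @cos_near0 R (Num.min m 1 / 2).
  by rewrite divr_gt0 // lt_min m0 ltr01.
exists d => // s t /dP hs /dP ht.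
have dist0 : dot (f x0 - T s t) (f x0 - T s t) = 2 - cos s - cos t.
  by rewrite fx0 (torus_point_dist oa ob) // !sub0r !cosN.
have dist_min : dot (f x0 - T s t) (f x0 - T s t) < Num.min m 1.
  by rewrite dist0; lra.
have [|c [Uc crit cle]] := mP (T s t).
  by apply: (lt_le_trans dist_min); rewrite ge_min lexx.
exists c; split => //.
have [[s' [t' cE]] [u1 D1] [u2 D2]] :=
  torus_frame_point oa ob c1E c2E oU sf fS Uc (tf c Uc).
have crit0 (u : E) (K : 'M[R]_n.+1) (k : R) : k != 0 -> 'D_u f c = f c *m (k *: K) ->
    dot (f c) (f c *m K) = 0 -> dot (T s t) (f c *m K) = 0.
  move=> k0 Du f0; have := crit u; rewrite Du -scalemxAr dotZr dotDl dotNl f0.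
  by rewrite sub0r => /eqP; rewrite mulf_eq0 (negbTE k0) oppr_eq0 => /eqP.
have h1 := crit0 _ _ _ c1N0 D1 (dot_wedge_self _ _ _).
have h2 := crit0 _ _ _ c2N0 D2 (dot_wedge_self _ _ _).
rewrite cE (dot_torus_wedge1 oa ob) // in h1.
rewrite cE (dot_torus_wedge2 oa ob) // in h2.
have half0 : (2^-1 : R) != 0 by rewrite invr_eq0 pnatr_eq0.
move/eqP: h1; rewrite mulf_eq0 (negbTE half0) /= => /eqP s1.
move/eqP: h2; rewrite mulf_eq0 (negbTE half0) /= => /eqP s2.
have dist1 : dot (f c - T s t) (f c - T s t) = 2 - cos (s - s') - cos (t - t').
  rewrite cE (torus_point_dist oa ob) // -(opprB s) -(opprB t).
  by rewrite !cosN.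
have lt1 : 2 - cos (s - s') - cos (t - t') < 1.
  rewrite -dist1; apply: (le_lt_trans cle); apply: (lt_le_trans dist_min).
  by rewrite ge_min lexx orbT.
apply/eqP; rewrite -subr_eq0 -dot_eq0 dist1.
have [x1 y1] := cos_sum_close (cos_le1 _) (cos_le1 _) lt1.
have [->|h] := sin_eq0_cos s1; last by rewrite h eqxx in x1.
have [->|h] := sin_eq0_cos s2; last by rewrite h eqxx in y1.
by rewrite -addrA -opprD subrr.
Qed.

Variable (G : set 'M[R]_n.+1).
Hypothesis GO : forall g, G g -> g *m g^T = 1%:M.
Hypotheses (G1 : G 1%:M) (GM : forall g h, G g -> G h -> G (g *m h)).
Hypothesis GV : forall g, G g -> G (invmx g).
Hypothesis GJ : forall g, G g ->
  (g^T *m J.1 *m g, g^T *m J.2 *m g) \in signed_swaps J.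

(** An isometry that commutes with the quarter turn of a plane preserves this
    plane, the image of the square of the turn, and its orientation, so it
    rotates it. *)
Lemma rotation_of_commuting (x y : V) (h : 'M[R]_n.+1) :
  orthonormal_pair x y -> h *m h^T = 1%:M ->
  wedge x y *m h = h *m wedge x y ->
  exists d, x *m h = cos d *: x + sin d *: y /\ y *m h = cos d *: y - sin d *: x.
Proof.
move=> oxy ho hK; have [xx yy xy] := oxy.
have xK : x *m wedge x y = y.
  by rewrite mul_wedge xx xy scale0r subr0 scale1r.
have xhE : x *m h = dot (x *m h) x *: x + dot (x *m h) y *: y.
  apply: oppr_inj; rewrite -(mul_wedge_sqr _ oxy).
  rewrite -(mulmxA x) -hK (mulmxA x) -(mulmxA _ h) -hK !mulmxA.
  by rewrite (mul_wedge_sqr _ oxy) xx xy scale0r addr0 scale1r mulNmx.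
have n1 : dot (x *m h) (x *m h) = 1 by rewrite (dot_orthogonal ho).
rewrite {1}xhE in n1.
rewrite !dotDl !dotZl (dotC x) (dotC y) -!expr2 in n1.
have [d [cd sd]] := unit_circle_angle n1.
exists d; rewrite -cd -sd; split => //.
have yK : y *m wedge x y = - x.
  by rewrite mul_wedge (dotC y) xy yy scale0r sub0r scale1r.
by rewrite -{1}xK -mulmxA hK mulmxA {1}xhE mulmxDl -!scalemxAl xK yK scalerN.
Qed.

Lemma rotation_of_stabilizer h : h *m h^T = 1%:M ->
  h *m J.1 *m h^T = J.1 -> h *m J.2 *m h^T = J.2 ->
  exists s0 t0, forall s t, T s t *m h = T (s + s0) (t + t0).
Proof.
move=> ho e1 e2.
have comm (K : 'M[R]_n.+1) (k : R) : k != 0 -> h *m (k *: K) *m h^T = k *: K ->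
    K *m h = h *m K.
  move=> k0 e; apply: (scalerI k0); rewrite scalemxAl -e -!mulmxA.
  by rewrite (mulmx1C ho) mulmx1 scalemxAr.
have [s0 [ha1 ha2]] := rotation_of_commuting oa ho (comm _ _ c1N0 e1).
have [t0 [hb1 hb2]] := rotation_of_commuting ob ho (comm _ _ c2N0 e2).
exists s0, t0 => s t.
rewrite /torus_point -scalemxAl !mulmxDl -!scalemxAl ha1 ha2 hb1 hb2.
congr (_ *: (_ + _)); rewrite ?cosD ?sinD.
  by apply: dot_inj => z; rewrite !(dotDl, dotNl, dotZl); ring.
by apply: dot_inj => z; rewrite !(dotDl, dotNl, dotZl); ring.
Qed.

(** Group elements acting on the whole torus as a translation of the angles;
    an element that merely moves one point to another need not, since it may
    reflect or exchange the planes. *)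
Definition translation (s0 t0 : R) :=
  exists2 h, G h & forall s t, T s t *m h = T (s + s0) (t + t0).

Lemma translation_muln k s0 t0 : translation s0 t0 ->
  translation (s0 *+ k) (t0 *+ k).
Proof.
move=> [h Gh hE]; elim: k => [|k [h' Gh' hE']].
  by exists 1%:M => // s t; rewrite mulmx1 !mulr0n !addr0.
exists (h *m h'); first exact: GM.
by move=> s t; rewrite mulmxA hE hE' !mulrS !addrA.
Qed.

(** Each of nine elements pulls J back to one of the eight signed swaps of J.
    Two of them agree, so their quotient fixes J, hence is a pair of rotations
    of the two planes. *)
Lemma pigeonhole_translation (g : 'I_9 -> 'M[R]_n.+1) (s0 t0 : R) :
  (forall k, G (g k) /\ T 0 0 *m g k = T (s0 *+ k) (t0 *+ k)) ->
  exists2 m, (0 < m <= 8)%N & translation (s0 *+ m) (t0 *+ m).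
Proof.
move=> gP.
have gV h : G h -> invmx h = h^T.
  move=> Gh; have hh := GO Gh; have /mulmx1_unit[uh _] := hh.
  by rewrite -[RHS]mul1mx -(mulVmx uh) -mulmxA hh mulmx1.
have gT h : G h -> G h^T by move=> Gh; rewrite -gV //; apply: GV.
pose type k := (g k *m J.1 *m (g k)^T, g k *m J.2 *m (g k)^T).
have typeP k : type k \in signed_swaps J.
  by have := GJ (gT _ (gP k).1); rewrite trmxK.
have : ~~ injectiveb type.
  apply/negP => /injectiveP inj.
  have := @uniq_leq_size _ (map type (enum 'I_9)) (signed_swaps J).
  rewrite (map_inj_uniq inj) enum_uniq size_map size_enum_ord /= => /(_ isT).
  suff h : {subset map type (enum 'I_9) <= signed_swaps J} by move=> /(_ h).
  by move=> _ /mapP[k _ ->].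
case/injectivePn => k0 [l0 kl0 tkl0].
wlog kl : k0 l0 kl0 tkl0 / (k0 < l0)%N.
  move=> H; have := kl0; rewrite -val_eqE /= neq_ltn => /orP[kl|lk].
    exact: H tkl0 kl.
  by apply: (H l0 k0) => //; rewrite eq_sym.
exists (l0 - k0)%N.
  by rewrite subn_gt0 kl /= (leq_trans (leq_subr _ _)) // -ltnS.
have [Gk kE] := gP k0; have [Gl lE] := gP l0.
(* As g^T is the inverse of g, h moves the k0-th multiple to the l0-th. *)
pose h := (g k0)^T *m g l0.
have Gh : G h by apply: GM => //; apply: gT.
have kk : (g k0)^T *m g k0 = 1%:M by apply: mulmx1C; apply: GO.
have stab (K : 'M[R]_n.+1) : g k0 *m K *m (g k0)^T = g l0 *m K *m (g l0)^T ->
    h *m K *m h^T = K.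
  move=> e; rewrite /h trmx_mul trmxK.
  have -> : (g k0)^T *m g l0 *m K *m ((g l0)^T *m g k0) =
      (g k0)^T *m (g l0 *m K *m (g l0)^T) *m g k0 by rewrite !mulmxA.
  by rewrite -e !mulmxA kk mul1mx -!mulmxA kk mulmx1.
move: tkl0 => [e1 e2].
have [d1 [d2 hE]] := rotation_of_stabilizer (GO Gh) (stab _ e1) (stab _ e2).
have := hE (s0 *+ k0) (t0 *+ k0).
rewrite -kE /h -mulmxA (mulmxA (g k0)) (GO Gk) mul1mx lE => /esym/(torus_point_inj oa ob ab11 ab12 ab21 ab22).
move=> [c1' s1' c2' s2']; exists h => // s t; rewrite hE.
have shift (x y d z : R) : cos (x + d) = cos z -> sin (x + d) = sin z ->
    cos (y + d) = cos (y + (z - x)) /\ sin (y + d) = sin (y + (z - x)).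
  move=> cz sz; have -> : y + d = (y - x) + (x + d) by rewrite addrA subrK.
  have -> : y + (z - x) = (y - x) + z by rewrite addrA addrAC.
  by rewrite (cosD (y - x) (x + d)) (sinD (y - x) (x + d)) cz sz -cosD -sinD.
have [h1 h2] := shift _ s _ _ c1' s1'; have [h3 h4] := shift _ t _ _ c2' s2'.
by apply: torus_point_eq; rewrite mulrnBr // ltnW.
Qed.

(** Let (s, t) = N (s', t') with N = K f8, so that the multiples k (s', t'), k
    <= 8, are close to (0, 0) and reached by G. For some m <= 8 the m-th one
    is reached by a translation, and as m divides f8 a power of it is the
    translation by (s, t). *)
Lemma torus_orbit (d : R) : 0 < d ->
  (forall s t, `|s| < d -> `|t| < d -> exists2 g, G g & T 0 0 *m g = T s t) ->
  forall s t, exists2 g, G g & T 0 0 *m g = T s t.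
Proof.
move=> d0 near0 s t.
pose K := (Num.bound ((`|s| + `|t|) / d)).+1.
have KP (x : R) : `|x| <= `|s| + `|t| -> `|x| / K%:R < d.
  move=> xst; rewrite ltr_pdivrMr ?ltr0n // mulrC -ltr_pdivrMr //.
  apply: (@le_lt_trans _ _ ((`|s| + `|t|) / d)).
    by rewrite ler_pM2r ?invr_gt0.
  (* K exceeds (|s| + |t|) / d, so dividing by K brings the angles below d. *)
  have := @archi_boundP R ((`|s| + `|t|) / d).
  rewrite divr_ge0 ?addr_ge0 ?(ltW d0) // => /(_ isT)/lt_trans; apply.
  by rewrite ltr_nat ltnS.
have [f8 f88 f8P] := common_multiple8.
have f80 : (0 < f8)%N by apply: leq_trans f88.
pose s0 := s / K%:R / f8%:R; pose t0 := t / K%:R / f8%:R.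
have small (x : R) (k : 'I_9) : `|x| <= `|s| + `|t| -> `|(x / K%:R / f8%:R) *+ k| < d.
  move=> /KP; apply: le_lt_trans.
  rewrite normrMn !normrM !normfV !normr_nat -[leLHS]mulr_natr -[leLHS]mulrA ler_piMr //.
  rewrite mulrC ler_pdivrMr ?ltr0n // mul1r ler_nat.
  by apply: leq_trans f88; rewrite -ltnS.
have hg (k : 'I_9) : exists g, G g /\ T 0 0 *m g = T (s0 *+ k) (t0 *+ k).
  have [||g Gg gE] := near0 (s0 *+ k) (t0 *+ k); last by exists g.
    by apply: small; rewrite lerDl.
  by apply: small; rewrite lerDr.
have [g gP] := choice hg.
have [m /andP[m0 m8] tr] := pigeonhole_translation gP.
have mf : (m %| f8)%N by apply: f8P; rewrite m0.
have K0 : K%:R != 0 :> R by rewrite pnatr_eq0.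
have f0 : f8%:R != 0 :> R by rewrite pnatr_eq0 -lt0n.
have back (x : R) : (x / K%:R / f8%:R) *+ m *+ (f8 %/ m * K) = x.
  rewrite -mulrnA mulnA (mulnC m) divnK // mulrnA -(mulr_natr (x / K%:R / f8%:R) f8) divfK //.
  by rewrite -(mulr_natr (x / K%:R) K) divfK.
have [h Gh hE] := translation_muln (f8 %/ m * K) tr.
by exists h => //; rewrite hE !add0r !back.
Qed.

End TorusNeighborhood.

(** * Moving the torus to standard position *)

(** Downward induction on the number N - m of missing vectors. *)
Lemma orthonormal_completion {R : realType} {N : nat} (m : nat) (w : nat -> 'rV[R]_N) :
  (m <= N)%N -> (forall i j, (i < m)%N -> (j < m)%N -> dot (w i) (w j) = (i == j)%:R) ->
  exists w' : nat -> 'rV[R]_N, (forall i, (i < m)%N -> w' i = w i) /\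
    forall i j, (i < N)%N -> (j < N)%N -> dot (w' i) (w' j) = (i == j)%:R.
Proof.
move=> mN; rewrite -(subKn mN); elim: (N - m)%N (leq_subr m N) w => [|d IH] dN w wo.
  by rewrite subn0 in wo *; exists w.
set l := (N - d.+1)%N in wo *.
have lN : (l < N)%N by rewrite ltn_subrL /= (leq_trans _ dN).
have lS : (N - d)%N = l.+1 by rewrite /l subnS prednK // subn_gt0.
have [u uu uF] := unit_orthogonal (\matrix_(i < l) w i) lN.
have uw i : (i < l)%N -> dot (w i) u = 0.
  move=> il; have /matrixP/(_ (Ordinal il) 0) := uF.
  rewrite !mxE => <-; rewrite dotE; apply: eq_bigr => k _.
  by rewrite !mxE.
pose v i := if (i < l)%N then w i else u.
have vo i j : (i < N - d)%N -> (j < N - d)%N -> dot (v i) (v j) = (i == j)%:R.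
  rewrite lS !ltnS /v => il jl.
  case: ltnP => il'; case: ltnP => jl'.
  - exact: wo.
  - have -> : j = l by apply/eqP; rewrite eqn_leq jl.
    by rewrite uw // ltn_eqF.
  - have -> : i = l by apply/eqP; rewrite eqn_leq il.
    by rewrite dotC uw // gtn_eqF.
  have -> : i = l by apply/eqP; rewrite eqn_leq il.
  have -> : j = l by apply/eqP; rewrite eqn_leq jl.
  by rewrite uu eqxx.
have [w' [w'v w'o]] := IH (ltnW dN) v vo.
exists w'; split => // i il; rewrite w'v ?lS 1?ltnS 1?ltnW //.
by rewrite /v il.
Qed.

(** Complete the orthonormal vectors spanning the two planes to an orthonormal
    basis and move it to the standard one. *)
Lemma torus_clifford {R : realType} {n : nat} (a1 a2 b1 b2 : 'rV[R]_n.+1) :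
  (3 <= n)%N -> orthonormal_pair a1 a2 -> orthonormal_pair b1 b2 ->
  dot a1 b1 = 0 -> dot a1 b2 = 0 -> dot a2 b1 = 0 -> dot a2 b2 = 0 ->
  exists2 T : 'M[R]_n.+1, @orthogonal_group R n.+1 T &
    [set x *m T | x in [set x | exists s t, x = torus_point a1 a2 b1 b2 s t]]
      = @clifford_torus R n.
Proof.
move=> n3 oa ob ab11 ab12 ab21 ab22.
have [a11 a22 a12] := oa; have [b11 b22 b12] := ob.
pose w0 i := nth 0 [:: a1; a2; b1; b2] i.
have [||w [ww0 wo]] := @orthonormal_completion R n.+1 4 w0.
- exact: n3.
- case=> [|[|[|[|//]]]] [|[|[|[|//]]]] _ _; rewrite /w0 //=;
  by rewrite ?ab11 ?ab12 ?ab21 ?ab22 ?a12 ?b12 // dotC.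
pose O := \matrix_(i < n.+1) w i.
have coord x j : (x *m O^T) 0 j = dot x (w j).
  rewrite dotE mxE; apply: eq_bigr => k _.
  by rewrite !mxE.
have OO : O *m O^T = 1%:M.
  apply/matrixP => i j.
  have := coord (w i) j; rewrite (wo _ _ (ltn_ord i) (ltn_ord j)) => h.
  rewrite [RHS]mxE; apply: etrans (etrans h _); last by rewrite -val_eqE.
  by rewrite !mxE; apply: eq_bigr => k _; rewrite !mxE.
exists O^T; first by rewrite /orthogonal_group /= trmxK; apply: mulmx1C.
have i0 : (inord 0 : 'I_n.+1) = 0%N :> nat by rewrite inordK.
have i1 : (inord 1 : 'I_n.+1) = 1%N :> nat by rewrite inordK // ltnS (leq_trans _ n3).
have i2 : (inord 2 : 'I_n.+1) = 2%N :> nat by rewrite inordK // ltnS (leq_trans _ n3).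
have i3 : (inord 3 : 'I_n.+1) = 3%N :> nat by rewrite inordK.
have w_0 : w 0%N = a1 by rewrite ww0.
have w_1 : w 1%N = a2 by rewrite ww0.
have w_2 : w 2%N = b1 by rewrite ww0.
have w_3 : w 3%N = b2 by rewrite ww0.
have w_gt (j : 'I_n.+1) s t : (3 < j)%N -> dot (torus_point a1 a2 b1 b2 s t) (w j) = 0.
  move=> j3.
  have z k : (k <= 3)%N -> dot (w k) (w j) = 0.
    move=> k3; rewrite wo // ?ltn_eqF //; first exact: leq_ltn_trans k3 j3.
    by rewrite ltnS (leq_trans k3).
  rewrite /torus_point !(dotDl, dotZl) -w_0 -w_1 -w_2 -w_3 !z //.
  by rewrite !(mulr0, addr0).
have k0 : 0 < (Num.sqrt 2)^-1 :> R by rewrite invr_gt0 sqrtr_gt0.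
have sq2 : Num.sqrt 2 ^+ 2 = 2 :> R by rewrite sqr_sqrtr.
have k2 : (Num.sqrt 2)^-1 ^+ 2 = 2^-1 :> R by rewrite exprVn sq2.
apply/seteqP; split=> [_ [_ [s [t ->]] <-]|y [y01 y23 y4]] /=.
  have [h1 h2 h3 h4] := torus_point_coords oa ob ab11 ab12 ab21 ab22 s t.
  split=> [||i i3']; rewrite ?coord ?i0 ?i1 ?i2 ?i3 ?w_0 ?w_1 ?w_2 ?w_3.
  - rewrite h1 h2 !exprMn -mulrDr cos2Dsin2 mulr1 sqrtr_sqr.
    by rewrite ger0_norm // ltW.
  - rewrite h3 h4 !exprMn -mulrDr cos2Dsin2 mulr1 sqrtr_sqr.
    by rewrite ger0_norm // ltW.
  exact: w_gt.
have angle (u v : R) : Num.sqrt (u ^+ 2 + v ^+ 2) = (Num.sqrt 2)^-1 ->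
    exists s, u = (Num.sqrt 2)^-1 * cos s /\ v = (Num.sqrt 2)^-1 * sin s.
  move=> uv; have uv2 : u ^+ 2 + v ^+ 2 = 2^-1.
    by rewrite -k2 -uv sqr_sqrtr // addr_ge0 // sqr_ge0.
  have [|s [us vs]] := @unit_circle_angle R (Num.sqrt 2 * u) (Num.sqrt 2 * v).
    by rewrite !exprMn sq2 -mulrDr uv2 divff // pnatr_eq0.
  have r0 : Num.sqrt 2 != 0 :> R by rewrite gt_eqF // sqrtr_gt0.
  by exists s; rewrite -us -vs !mulrA mulVf // !mul1r.
have [s [y0 y1]] := angle _ _ y01; have [t [y2 y3]] := angle _ _ y23.
have [h1 h2 h3 h4] := torus_point_coords oa ob ab11 ab12 ab21 ab22 s t.
exists (torus_point a1 a2 b1 b2 s t); first by exists s, t.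
apply/rowP => j; rewrite coord.
have [j3|j3] := ltnP 3 j; first by rewrite w_gt // y4.
have {}j3 : [|| j == inord 0, j == inord 1, j == inord 2 | j == inord 3].
  by rewrite -!val_eqE /= i0 i1 i2 i3; case: (nat_of_ord j) j3 => [|[|[|[|]]]].
case/or4P: j3 => /eqP ->; rewrite ?i0 ?i1 ?i2 ?i3 ?w_0 ?w_1 ?w_2 ?w_3.
- by rewrite h1 y0.
- by rewrite h2 y1.
- by rewrite h3 y2.
- by rewrite h4 y3.
Qed.

Theorem theorem3p4 (R : realType) (n : nat) (hn : (3 <= n)%N)
    (M : set 'rV[R]_n.+1) (B : atlas 'rV[R]_2 'rV[R]_n.+1)
    (hhom : homogeneous_surface M B)
    (hmin : minimal B)
    (hflat : flat_normal_connection B)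
    (hneq : ~ equatorial M) :
  exists2 T : 'M[R]_n.+1, @orthogonal_group R n.+1 T &
    [set x *m T | x in M] = @clifford_torus R n.
Proof.
have [MS imm _ _] := hhom.
have [G [p [J [[GO [G1 GM GV]] Mp tf GJ]]]] :=
  homogeneous_torus_frame hn hhom hmin hflat hneq.
have Mpp : M p by rewrite Mp; exists 1%:M => //; rewrite mulmx1.
have [i0 [x0 [D0 p0]]] := par_onto imm Mpp.
have [e1 [e2 [nu [ad JE]]]] := tf i0 x0 D0.
have [fr /(normal_frame _ fr)[nf n1 n2] nn _] := ad.
have sp i := @par_sphere R n M B imm MS i.
have od i : open (dom B i) by have [_ /(_ i)[]] := imm.
have [f1 f2] := frame_orth (@od i0) (par_smooth imm i0) (@sp i0) D0 fr.
have ff := @sp i0 x0 D0; rewrite p0 in nf f1 f2 ff JE.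
have [[e11 e22 e12] _ _ _] := fr.
have r0 : Num.sqrt 2 != 0 :> R by rewrite gt_eqF // sqrtr_gt0.
pose k : R := (Num.sqrt 2)^-1; have k2 : k * k = 2^-1 := inv_sqrt2_sqr.
(* Together with e1 and e2, orthonormal bases of the two planes; p has angles
   (0, 0). *)
pose a1 := k *: (p - nu); pose b1 := k *: (p + nu).
have two0 : (2 : R) != 0 by rewrite pnatr_eq0.
have oa : orthonormal_pair a1 e1.
  split=> //; last by rewrite dotZl dotDl dotNl f1 n1 subrr mulr0.
  rewrite dotZl dotZr mulrA k2 !(dotDl, dotDr, dotNl, dotNr) ff nn nf (dotC p) nf.
  by field.
have ob : orthonormal_pair b1 e2.
  split=> //; last by rewrite dotZl dotDl f2 n2 addr0 mulr0.
  rewrite dotZl dotZr mulrA k2 !(dotDl, dotDr) ff nn nf (dotC p) nf.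
  by field.
have ab11 : dot a1 b1 = 0.
  rewrite dotZl dotZr !(dotDl, dotDr, dotNl, dotNr) ff nn nf (dotC p) nf.
  by ring.
have ab12 : dot a1 e2 = 0 by rewrite dotZl dotDl dotNl f2 n2 subrr mulr0.
have ab21 : dot e1 b1 = 0 by rewrite dotZr dotC dotDl f1 n1 addr0 mulr0.
have ab22 : dot e1 e2 = 0 by [].
have c1E : (- Num.sqrt 2) ^+ 2 = 2 :> R by rewrite sqrrN sqr_sqrtr.
have c2E : Num.sqrt 2 ^+ 2 = 2 :> R by rewrite sqr_sqrtr.
have wZ (c : R) (a b : 'rV[R]_n.+1) : wedge (c *: a) b = c *: wedge a b.
  by rewrite /wedge linearZ -scalemxAl -scalemxAr scalerBr.
have {}JE : J = ((- Num.sqrt 2) *: wedge a1 e1, Num.sqrt 2 *: wedge b1 e2).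
  rewrite JE -!wZ /a1 /b1 !scalerA mulNr mulfV // scaleN1r scale1r opprB.
  by rewrite (addrC p).
rewrite {}JE in tf GJ.
have T00 : p = torus_point a1 e1 b1 e2 0 0.
  rewrite /torus_point cos0 sin0 !scale1r !scale0r !addr0 /a1 /b1 -scalerDr.
  rewrite scalerA k2 addrACA addNr addr0 -mulr2n -(scaler_nat 2 p) scalerA.
  by rewrite mulVf // scale1r.
have [T To TM] := torus_clifford hn oa ob ab11 ab12 ab21 ab22.
exists T => //; rewrite -TM; congr [set x *m T | x in _].
apply/seteqP; split=> [q Mq|_ [s [t ->]]].
  have [i [x [Dx <-]]] := par_onto imm Mq.
  by have [] := torus_frame_point oa ob c1E c2E (@od i)
    (par_smooth imm i) (@sp i) Dx (tf i x Dx).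
have [_ /(_ i0)[_ _ inj] _ _] := imm.
have [d d0 near0] := torus_neighborhood oa ob ab11 ab12 ab21 ab22 c1E c2E
  (@od i0) (par_smooth imm i0) inj (@sp i0) D0 (etrans p0 T00) (tf i0).
(* The orbit contains a neighbourhood of p in the torus, hence all of it. *)
have [s' t' hs ht|g Gg gE] := torus_orbit oa ob ab11 ab12 ab21 ab22 c1E c2E GO G1
  GM GV GJ d0 _ s t.
  have [c [Dc cE]] := near0 s' t' hs ht.
  have : M (par B i0 c) := par_in imm Dc.
  by rewrite Mp => -[g Gg gE]; exists g => //; rewrite -T00 gE.
by rewrite Mp; exists g => //; rewrite -gE -T00.
Qed.
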